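(* Let $(T(t))_{t\ge0}$ be a strongly continuous semigroup on a Banach space $X$ with $\mathcal{R}\{T(t):0<t<1\}<\infty$. Then $(T(t))_{t\ge0}$ is $\mathcal{R}$-analytic if and only if there is a polynomial $f\in\mathbb{C}[z]$ such that $$\lim_{\varepsilon\downarrow0}\mathcal{R}\{f(T(t)):0<t<\varepsilon\}<\|f\|_{\mathbb{D}}.$$
   Context: Banach spaces are complex. For $f\in\mathbb{C}[z]$, $\|f\|_{\mathbb{D}}:=\sup_{|z|\le 1}|f(z)|$. For a bounded operator $S$ and $f(z)=\sum_k a_k z^k$, $f(S)=\sum_k a_k S^k$. Fix $p\in[1,\infty)$. Let $r_k(t)=\operatorname{sign}\sin(2^k\pi t)$ be the $k$-th Rademacher function on $[0,1]$. For $\mathcal{T}\subseteq\mathcal{L}(X)$, the $\mathcal{R}$-bound $\mathcal{R}\{\mathcal{T}\}\in[0,\infty]$ is the smallest constant $C$ such that $$\Big\|\sum_{k=1}^n r_kT_kx_k\Big\|_{L^p([0,1];X)}\le C\Big\|\sum_{k=1}^n r_kx_k\Big\|_{L^p([0,1];X)}$$ for all $n\in\mathbb{N}$, $T_1,\dots,T_n\in\mathcal{T}$, $x_1,\dots,x_n\in X$ ($\infty$ if there is none). Finiteness of the $\mathcal{R}$-bound does not depend on $p$, although its value does; all $\mathcal{R}$-bounds in the statement are taken with respect to the same fixed $p$. With $\Sigma_\delta=\{z\in\mathbb{C}\setminus\{0\}:|\arg z|<\delta\}$, a semigroup $(T(t))_{t\ge0}$ is $\mathcal{R}$-analytic if it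 is holomorphic (extends to a holomorphic $\mathcal{L}(X)$-valued map on a sector) and there is $\delta>0$ such that the extension is defined on $\Sigma_\delta$ and $\mathcal{R}\{T(z):z\in\Sigma_\delta,|z|\le1\}<\infty$. *)

(* Defs.v *)
From HB Require Import structures.
From mathcomp Require Import all_boot all_order all_algebra.
From mathcomp Require Import all_classical all_reals all_analysis.
From mathcomp Require Export complex.

Set Implicit Arguments.
Unset Strict Implicit.
Unset Printing Implicit Defensive.

Import Order.TTheory GRing.Theory Num.Theory.
Import numFieldNormedType.Exports.

Local Open Scope classical_set_scope.
Local Open Scope ring_scope.
Local Open Scope complex_scope.

(* Norms over the scalar field R[i] take their values in R[i]: `|x| is the
   real norm embedded in R[i]. *)
Definition rnorm {R : realType} {V : normedModType R[i]} (x : V) : R :=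
  complex.Re `|x|.

Section Operators.
Context {R : realType} {X : completeNormedModType R[i]}.

Definition bounded_operator (S : X -> X) : Prop := linear S /\ continuous S.

Definition opnorm (S : X -> X) : \bar R :=
  ereal_sup [set (rnorm (S x))%:E | x in [set x : X | rnorm x <= 1]].

Definition poly_op (f : {poly R[i]}) (S : X -> X) : X -> X :=
  fun x => \sum_(k < size f) f`_k *: iter k S x.

End Operators.

Definition disk_norm {R : realType} (f : {poly R[i]}) : R :=
  sup [set complex.Re `|f.[z]| | z in [set z : R[i] | `|z| <= 1]].

Section RBound.
Context {R : realType} {X : completeNormedModType R[i]}.

Definition rademacher (k : nat) (t : R) : R := Num.sg (sin (2 ^+ k * pi * t)).

(* the L^p([0,1]; X)-norm: the L^p norm of t |-> `|g t| on [0,1] (the function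
   below is extended by 0 outside of [0,1]) *)
Definition Lp_norm01 (p : R) (g : R -> X) : \bar R :=
  ('N[lebesgue_measure]_(p%:E)
     [(fun t : measurableTypeR R => (rnorm (g t))%:E) \_ `[0%R, 1%R]])%E.

Definition rademacher_sum n (x : 'I_n -> X) (t : R) : X :=
  \sum_(k < n) (rademacher k.+1 t)%:C *: x k.

Definition R_bounded_by (p : R) (TT : set (X -> X)) (C : R) : Prop :=
  forall n (S : 'I_n -> X -> X) (x : 'I_n -> X), (forall k, TT (S k)) ->
    (Lp_norm01 p (rademacher_sum (fun k => S k (x k)))
      <= C%:E * Lp_norm01 p (rademacher_sum x))%E.

Definition R_bound (p : R) (TT : set (X -> X)) : \bar R :=
  ereal_inf [set C%:E | C in [set C : R | 0 <= C /\ R_bounded_by p TT C]].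

End RBound.

Section Sectors.
Context {R : realType}.

(* the argument of z in ]-pi, pi] (meaningful for z != 0) *)
Definition carg (z : R[i]) : R :=
  let theta := acos (complex.Re z / complex.Re `|z|) in
  if 0 <= complex.Im z then theta else - theta.

Definition sector (delta : R) : set R[i] :=
  [set z | z != 0 /\ `|carg z| < delta].

End Sectors.

Section Semigroups.
Context {R : realType} {X : completeNormedModType R[i]}.

Definition holomorphic_on (U : set R[i]) (F : R[i] -> X -> X) : Prop :=
  forall z, U z -> exists D : X -> X, bounded_operator D /\
    opnorm (fun x => h^-1 *: (F (z + h) x - F z x) - D x)
      @[h --> (0 : R[i]^o)^'] --> 0%E.

Record C0_semigroup (T : R -> X -> X) : Prop := {
  sg_bounded : forall t : R, 0 <= t -> bounded_operator (T t) ;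
  sg_0 : forall x, T 0 x = x ;
  sg_D : forall (s t : R) (x : X), 0 <= s -> 0 <= t -> T (s + t) x = T s (T t x) ;
  sg_cont : forall x, {within `[0, +oo[, continuous (fun t : R => T t x)} }.

Definition R_analytic (p : R) (T : R -> X -> X) : Prop :=
  exists delta : R, 0 < delta /\
  exists Tc : R[i] -> X -> X,
    [/\ forall t : R, 0 < t -> Tc t%:C = T t,
        forall z, sector delta z -> bounded_operator (Tc z),
        holomorphic_on (sector delta) Tc &
        (R_bound p [set Tc z | z in [set z | sector delta z /\ (`|z| <= 1)%R]]
          < +oo)%E].

End Semigroups.

(* Main.v *)
Require Import Defs.
From mathcomp Require Import all_boot all_order all_algebra.
From mathcomp Require Import all_classical all_reals all_analysis.
From mathcomp Require Import measurable_realfun ring lra zify.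
Import Order.TTheory GRing.Theory Num.Theory.
Import numFieldNormedType.Exports.
Local Open Scope classical_set_scope.
Local Open Scope ring_scope.
Local Open Scope complex_scope.

(** Everything takes place in the powers [X ^ n] with the Rademacher norm
    [rad_norm], in which an R-bound becomes an ordinary operator bound.

    If [T] is R-analytic, Cauchy's estimate applied to the holomorphic maps
    [w |-> (T(s_k (1 + w)) x_k)_k] gives
    [R{T((m + 1) t) - T(m t)} <= C / m] for small [t].  For [m >= C] the
    polynomial ['X^(m.+1) - 'X^m] has R-bounds at most 1 near 0, while its norm
    on the disk is at least 2.

    Conversely, let the R-bound of [f(T(t))] near 0 be at most [rho], less than
    the disk norm of [f].  By the maximum modulus principle
    [|f(zeta)| > rho] for some root of unity [zeta], so that
    [(zeta - T(t)) y] bounds [y] uniformly in small [t].  For [S = T(1 / (6 L))]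
    this bounds the geometric sums [sum_i (S / w)^i] along roots of unity [w]
    close to 1, for which a small power of [w] is [zeta]; averaging their cubes
    over all roots of unity [w] of order [3 L] produces a multiple of a power
    of [S], and the resulting estimate says that [T((1 + u) t) - T(t)] is
    R-bounded by [C u].  Hence [t A T(t)] is R-bounded, where [A] is the
    generator, [A^n T(t) = (A T(t / (n + 1)))^n T(t / (n + 1))] yields
    [R{t^n A^n T(t) / n!} <= C' g^n], and the series
    [T(t + i y) = sum_n (i y)^n A^n T(t) / n!] converges on a sector, where it
    is R-bounded by the contraction principle. *)

Import Normc.
Set Implicit Arguments.
Unset Strict Implicit.
Unset Printing Implicit Defensive.

(** * Complex moduli and seminorms *)

(** The lower bound lives at one unimodular [zeta], the wanted regularity at 1. The link: a root of
    unity [w] of order dividing [3 L] and of frequency [d], so at distance about [d / L] from 1,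
    reaches [zeta] after at most [6 L / d] steps, and its geometric sum is then of size [L / d]
    instead of [L]. Of the three factors of the cube, two make the sum over [d] converge, and the
    third absorbs the factor [S - 1] of [S^q - 1]. What remains is of order [L^2 q]; the
    normalisation is of order [L^3], which leaves [q / L].

    Hitting [zeta] exactly needs divisibility, so it can be arranged only for [d <= j0]. For the
    other frequencies an averaging of [S] replaces the lower bound, at a cost of order [1 / j0];
    strong continuity removes the averaging in the limit.

    Everything is run on [X ^ n] for the semigroup [s |-> (T(s t_k))_k], whose constants [M] and [B]
    depend neither on [n] nor on the [t_k]. Strong continuity and differentiability are not uniform
    in this sense, and they are used only in limits whose rates disappear from the conclusion. *)

Section ComplexModulus.
Context {R : realType}.
Implicit Types (z w : R[i]) (a : R).

Lemma normcE z : `|z| = (normc z)%:C.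
Proof. by case: z. Qed.

Lemma normc_Re z : normc z = complex.Re `|z|.
Proof. by rewrite normcE. Qed.

Lemma normc_ge0 z : 0 <= normc z.
Proof. by case: z => a b /=; rewrite sqrtr_ge0. Qed.

Lemma normc_gt0 z : (0 < normc z) = (z != 0).
Proof. by rewrite lt_def normc_ge0 andbT; congr (~~ _); apply/eqP/eqP => [/eq0_normc//|->]; rewrite normc0. Qed.

Lemma eq_complexP z w : complex.Re z = complex.Re w -> complex.Im z = complex.Im w -> z = w.
Proof. by case: z w => a b [c d] /= -> ->. Qed.

Lemma le_of_eq a b : a = b -> a <= b.
Proof. by move->. Qed.

Lemma normcD z w : normc (z + w) <= normc z + normc w.
Proof. exact: le_normcD. Qed.

Lemma normcB z w : normc (z - w) = normc (w - z).
Proof. by rewrite -[LHS]normcN opprB. Qed.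

Lemma normcR a : normc a%:C = `|a|.
Proof. by rewrite /= expr0n /= addr0 sqrtr_sqr. Qed.

Lemma normc_nat (n : nat) : normc (n%:R : R[i]) = n%:R.
Proof. by rewrite -[n%:R](rmorph_nat (real_complex R)) normcR ger0_norm ?ler0n. Qed.

Lemma normcX z n : normc (z ^+ n) = normc z ^+ n.
Proof. by elim: n => [|n IH]; rewrite ?expr0 ?normc1// !exprS normcM IH. Qed.

Lemma normc_i : normc ('i : R[i]) = 1.
Proof. by rewrite /= expr0n /= expr1n add0r sqrtr1. Qed.

Lemma normc_sum (I : Type) (r : seq I) (P : pred I) (F : I -> R[i]) :
  normc (\sum_(i <- r | P i) F i) <= \sum_(i <- r | P i) normc (F i).
Proof.
apply: (big_ind2 (fun z a => normc z <= a)) => //; first by rewrite normc0.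
by move=> z a w b za wb; exact: le_trans (normcD _ _) (lerD za wb).
Qed.

Lemma ler_normcBl z w : normc z - normc w <= normc (z - w).
Proof. by rewrite lerBlDr -{1}(subrK w z) normcD. Qed.

Lemma normr_Re z : `|complex.Re z| <= normc z.
Proof. by rewrite -lecR -normcE normc_ge_Re. Qed.

Lemma normr_Im z : `|complex.Im z| <= normc z.
Proof. by case: z => a b /=; rewrite -sqrtr_sqr ler_wsqrtr// lerDr sqr_ge0. Qed.

Lemma normc_le z : normc z <= `|complex.Re z| + `|complex.Im z|.
Proof.
rewrite {1}[z]complexE; apply: le_trans (normcD _ _) _.
by rewrite normcM normc_i mul1r !normcR.
Qed.

Lemma sqr_normcE z : normc z ^+ 2 = complex.Re z ^+ 2 + complex.Im z ^+ 2.
Proof. by case: z => a b /=; rewrite sqr_sqrtr// addr_ge0// sqr_ge0. Qed.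

End ComplexModulus.

Record is_seminorm {R : realType} (V : lmodType R[i]) (N : V -> R) : Prop := {
  snD : forall x y, N (x + y) <= N x + N y ;
  snZ : forall a x, N (a *: x) = normc a * N x }.

Section Seminorm.
Context {R : realType} {V : lmodType R[i]} {N : V -> R}.
Hypothesis hN : is_seminorm N.

Lemma sn0 : N 0 = 0.
Proof. by rewrite -[0 in LHS](scale0r 0) (snZ hN) normc0 mul0r. Qed.

Lemma snN x : N (- x) = N x.
Proof. by rewrite -scaleN1r (snZ hN) normcN normc1 mul1r. Qed.

Lemma sn_ge0 x : 0 <= N x.
Proof. by have := snD hN x (- x); rewrite subrr sn0 snN; lra. Qed.

Lemma snB x y : N (x - y) <= N x + N y.
Proof. by rewrite -(snN y) (snD hN). Qed.

Lemma snBC x y : N (x - y) = N (y - x).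
Proof. by rewrite -snN opprB. Qed.

Lemma sn_sum (I : Type) (r : seq I) (P : pred I) (F : I -> V) :
  N (\sum_(i <- r | P i) F i) <= \sum_(i <- r | P i) N (F i).
Proof.
apply: (big_ind2 (fun z a => N z <= a)) => //; first by rewrite sn0.
by move=> z a w b za wb; exact: le_trans (snD hN _ _) (lerD za wb).
Qed.

Lemma sn_triangle z x y : N (x - y) <= N (x - z) + N (z - y).
Proof. by rewrite -{1}(subrK z x) -addrA (snD hN). Qed.

Lemma snBl x y : N x <= N (x - y) + N y.
Proof. by rewrite -{1}(subrK y x) (snD hN). Qed.

Lemma snZR a x : 0 <= a -> N (a%:C *: x) = a * N x.
Proof. by move=> a0; rewrite (snZ hN) normcR ger0_norm. Qed.

End Seminorm.

(** * Roots of unity and the maximum modulus principle *)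

Section UnitCircle.
Context {R : realType}.
Implicit Types x : R.

Definition cis x : R[i] := cos (2 * pi * x) +i* sin (2 * pi * x).

Lemma cisD x y : cis (x + y) = cis x * cis y.
Proof.
rewrite /cis mulrDr cosD sinD; apply/eqP; rewrite eq_complex /=.
by apply/andP; split; apply/eqP => //; ring.
Qed.

Lemma cis0 : cis 0 = 1.
Proof. by rewrite /cis mulr0 cos0 sin0. Qed.

Lemma cis1 : cis 1 = 1.
Proof.
by rewrite /cis mulr1 mulrC mulr_natr cos2pi sin2pi.
Qed.

Lemma cisX x n : cis x ^+ n = cis (n%:R * x).
Proof.
elim: n => [|n IH]; first by rewrite mul0r cis0.
by rewrite exprS IH -cisD -natr1; congr cis; ring.
Qed.

Lemma cis_nat n : cis n%:R = 1.
Proof. by rewrite -[n%:R]mulr1 -cisX cis1 expr1n. Qed.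

Lemma normc_cis x : normc (cis x) = 1.
Proof. by rewrite /cis /= cos2Dsin2 sqrtr1. Qed.

Lemma cis_neq0 x : cis x != 0.
Proof. by rewrite -normc_gt0 normc_cis. Qed.

Lemma cisN x : cis (- x) = (cis x)^-1.
Proof.
by apply: (mulfI (cis_neq0 x)); rewrite -cisD subrr cis0 mulfV ?cis_neq0.
Qed.

Lemma normc_sub1X (z : R[i]) n : normc z = 1 ->
  normc (z ^+ n - 1) <= n%:R * normc (z - 1).
Proof.
move=> z1; rewrite subrX1 normcM mulrC ler_wpM2r ?normc_ge0//.
apply: le_trans (normc_sum _ _ _) _.
rewrite -[in leRHS](card_ord n) -sum1_card natr_sum.
by apply: ler_sum => i _; rewrite normcX z1 expr1n.
Qed.

Lemma normc_cis_sub1N x : normc (cis (- x) - 1) = normc (cis x - 1).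
Proof.
rewrite -[RHS]mul1r -(normc_cis (- x)) -normcM mulrBr -cisD addNr cis0 mulr1.
by rewrite normcB.
Qed.

(* Some multiple m * x lies in [1/4, 1/2], where the cosine is nonpositive; this
   avoids the convexity argument for the sine. *)
Lemma normc_cis_sub1_ge x : 0 < x <= 1 / 2 -> 2 * x <= normc (cis x - 1).
Proof.
move=> /andP[x0 x1].
have ix : 1 <= (2 * x)^-1 by rewrite invf_ge1; lra.
have /andP[m1 m2] := truncn_itv (ltW (lt_le_trans ltr01 ix)).
set m := Num.truncn _ in m1 m2.
have m0 : (0 < m)%N.
  by rewrite truncn_gt0.
have mx : m%:R * x <= 1 / 2.
  have : m%:R * (2 * x) <= 1 by rewrite -ler_pdivlMr ?div1r; [exact: m1|lra].
  lra.
have mx' : 1 / 4 <= m%:R * x.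
  have : 1 <= m.+1%:R * (2 * x).
    by rewrite -ler_pdivrMr ?div1r ?ltW//; lra.
  have : 1 <= m%:R :> R by rewrite ler1n.
  rewrite -natr1; nra.
have H1 : 1 <= normc (cis x ^+ m - 1).
  apply: le_trans (normr_Re _).
  rewrite cisX /cis /=.
  have -> : 2 * pi * (m%:R * x) = (2 * pi * (m%:R * x) - pi) + pi by ring.
  rewrite cosDpi.
  have p0 := pi_gt0 R.
  have : 0 <= cos (2 * pi * (m%:R * x) - pi).
    by apply: cos_ge0_pihalf; nra.
  by move=> H; rewrite ler0_norm; lra.
have := le_trans H1 (normc_sub1X m (normc_cis x)).
have : 0 <= normc (cis x - 1) by exact: normc_ge0.
have : 1 <= m%:R :> R by rewrite ler1n.
move: (normc _) => c; nra.
Qed.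

(** By the mean value theorem both coordinates are at most [2 pi x], which is at most [8 x] because
    [pi <= 4]. *)
Lemma normc_cis_sub1_le x : 0 <= x -> normc (cis x - 1) <= 16 * x.
Proof.
move=> x0; set t := 2 * pi * x.
have p0 := pi_gt0 R.
have p4 : pi <= 4 :> R by have [] := pihalf_02_cos_pihalf R; lra.
have t0 : 0 <= t by rewrite /t; nra.
have bs : `|sin t| <= t.
  have [c _] := MVT_segment t0 (fun y _ => is_derive_sin y)
    (continuous_subspaceT (@continuous_sin R)).
  rewrite sin0 !subr0 => ->; rewrite normrM (ger0_norm t0).
  rewrite ler_piMl// ler_norml; by rewrite cos_geN1 cos_le1.
have bc : `|cos t - 1| <= t.
  have [c _] := MVT_segment t0 (fun y _ => is_derive_cos y)
    (continuous_subspaceT (@continuous_cos R)).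
  rewrite cos0 !subr0 => ->; rewrite normrM (ger0_norm t0) normrN.
  rewrite ler_piMl// ler_norml; by rewrite sin_geN1 sin_le1.
apply: le_trans (normc_le _) _; rewrite /= subr0.
have : t <= 8 * x by rewrite /t; nra.
by move: bs bc; rewrite -/t; lra.
Qed.

Lemma cis_neq1 n m : (0 < m < n)%N -> cis (m%:R / n%:R) != 1.
Proof.
move=> /andP[m0 mn].
have n0 : 0 < n%:R :> R by rewrite ltr0n (ltn_trans m0).
have m0' : 0 < m%:R :> R by rewrite ltr0n.
have mn' : m%:R < n%:R :> R by rewrite ltr_nat.
rewrite -subr_eq0 -normc_gt0.
have x0 : 0 < m%:R / n%:R :> R by rewrite divr_gt0.
have x1 : m%:R / n%:R < 1 :> R by rewrite ltr_pdivrMr// mul1r.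
have [h|h] := leP (m%:R / n%:R) (1 / 2 : R).
  have := @normc_cis_sub1_ge (m%:R / n%:R); rewrite x0 h => /(_ isT); lra.
rewrite -normc_cis_sub1N.
have -> : cis (- (m%:R / n%:R)) = cis (1 - m%:R / n%:R) by rewrite cisD cis1 mul1r.
have := @normc_cis_sub1_ge (1 - m%:R / n%:R).
move=> /(_ ltac:(lra)); lra.
Qed.

Lemma sum_roots_of_unity n m : (0 < m < n)%N ->
  \sum_(j < n) cis (m%:R / n%:R) ^+ j = 0.
Proof.
move=> mn; have n1 := cis_neq1 mn.
have n0 : n%:R != 0 :> R by rewrite pnatr_eq0; lia.
apply: (mulfI (x := cis (m%:R / n%:R) - 1)); first by rewrite subr_eq0.
by rewrite -subrX1 cisX mulr0 mulrCA mulfV// mulr1 cis_nat subrr.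
Qed.

Lemma sum_roots_of_unity2 n (a b : nat) : (a < n)%N -> (b < n)%N ->
  \sum_(j < n) cis (j%:R / n%:R) ^+ a * (cis (j%:R / n%:R))^-1 ^+ b
    = if a == b then n%:R else 0.
Proof.
move=> an bn.
have n0 : n%:R != 0 :> R by rewrite pnatr_eq0; lia.
have E (j : 'I_n) : cis (j%:R / n%:R) ^+ a * (cis (j%:R / n%:R))^-1 ^+ b
    = cis ((a%:R - b%:R) / n%:R) ^+ j.
  rewrite -cisN !cisX -cisD; congr cis; ring.
rewrite (eq_bigr _ (fun j _ => E j)); case: eqP => [->|ab].
  rewrite subrr mul0r cis0 (eq_bigr (fun=> 1)); last by move=> *; rewrite expr1n.
  by rewrite sumr_const card_ord.
(* For [a < b] the negative exponent [a - b] is replaced by [n + a - b], since [cis] has period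
   1. *)
have [lt|gt|//] := ltngtP a b.
  have -> : cis ((a%:R - b%:R) / n%:R) = cis ((n + a - b)%N%:R / n%:R).
    rewrite natrB ?natrD; last lia.
    have -> : (n%:R + a%:R - b%:R) / n%:R = 1 + (a%:R - b%:R) / n%:R :> R.
      by field.
    by rewrite cisD cis1 mul1r.
  by apply: sum_roots_of_unity; lia.
by rewrite -natrB ?(ltnW gt)//; apply: sum_roots_of_unity; lia.
Qed.

End UnitCircle.

Section MaximumModulus.
Context {R : realType}.
Implicit Types f g : {poly R[i]}.

(** Discrete Fourier inversion: the inner sum is a reproducing kernel for polynomials with at most
    [n] coefficients. On the closed disk its modulus is at most [n]. *)
Lemma horner_roots_of_unity g n z : (size g <= n)%N -> (0 < n)%N ->
  n%:R * g.[z] = \sum_(j < n) g.[cis (j%:R / n%:R)] *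
    \sum_(k < n) (cis (j%:R / n%:R))^-1 ^+ k * z ^+ k.
Proof.
move=> gn n0.
under eq_bigr => j _ do rewrite (horner_coef_wide _ gn) big_distrl /=.
rewrite exchange_big /= (horner_coef_wide _ gn) mulr_sumr.
apply: eq_bigr => i _.
under eq_bigr => j _ do rewrite mulr_sumr.
rewrite exchange_big /= (bigD1 i)//= [X in _ + X]big1 ?addr0.
  rewrite (eq_bigr (fun j : 'I_n => g`_i * z ^+ i * (cis (j%:R / n%:R) ^+ i *
    (cis (j%:R / n%:R))^-1 ^+ i))); last by move=> j _; ring.
  by rewrite -mulr_sumr sum_roots_of_unity2// eqxx; ring.
move=> k ki.
rewrite (eq_bigr (fun j : 'I_n => g`_i * z ^+ k * (cis (j%:R / n%:R) ^+ i *
    (cis (j%:R / n%:R))^-1 ^+ k))); last by move=> j _; ring.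
rewrite -mulr_sumr sum_roots_of_unity2//.
by rewrite eq_sym -[_ == _]/(k == i) (negbTE ki) mulr0.
Qed.

Lemma bernoulli_ineq (r : R) n : 0 <= r -> 1 + n%:R * r <= (1 + r) ^+ n.
Proof.
move=> r0; elim: n => [|n IH]; first by rewrite mul0r expr0 addr0.
rewrite exprS -natr1.
have : 0 <= n%:R :> R by [].
move: IH; move: (_ ^+ n) n%:R => u v; nra.
Qed.

(* Applied to powers of [f], interpolation at the roots of unity loses only a
   factor linear in the exponent. *)
Lemma maximum_modulus f (rho : R) :
  (forall n j : nat, (0 < n)%N -> normc f.[cis (j%:R / n%:R)] <= rho) ->
  forall z, normc z <= 1 -> normc f.[z] <= rho.
Proof.
move=> H z z1; rewrite leNgt; apply/negP => hz.
have rho0 : 0 <= rho by apply: le_trans (H 1%N 0%N isT); exact: normc_ge0.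
have main m : normc f.[z] ^+ m <= (m * size f).+1%:R * rho ^+ m.
  set n := (m * size f).+1.
  have sn : (size (f ^+ m) <= n)%N.
    apply: leq_trans (size_poly_exp_leq _ _) _.
    by rewrite ltnS mulnC leq_mul2l leq_pred orbT.
  have n0 : (0 < n)%N by [].
  have n0' : 0 < n%:R :> R by rewrite ltr0n.
  have := congr1 (@normc R) (@horner_roots_of_unity (f ^+ m) n z sn n0).
  rewrite normcM normc_nat horner_exp normcX => E.
  rewrite -(ler_pM2l n0') E.
  apply: le_trans (normc_sum _ _ _) _.
  have -> : n%:R * (n%:R * rho ^+ m) = \sum_(j < n) rho ^+ m * n%:R.
    by rewrite sumr_const card_ord mulr_natl; congr (_ *+ _); exact: mulrC.
  apply: ler_sum => j _; rewrite normcM; apply: ler_pM; rewrite ?normc_ge0//.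
    by rewrite horner_exp normcX lerXn2r ?nnegrE ?normc_ge0// H.
  apply: le_trans (normc_sum _ _ _) _.
  rewrite -[in leRHS](card_ord n) -sum1_card natr_sum; apply: ler_sum => k _.
  rewrite normcM !normcX normcV normc_cis invr1 expr1n mul1r.
  by rewrite exprn_ile1// normc_ge0.
set a := normc f.[z] in hz main.
(* The midpoint stands in for [rho], which may be 0 and cannot be divided by. *)
pose r := (rho + a) / 2.
have r0 : 0 < r by rewrite /r; lra.
pose d := a / r - 1.
have d0 : 0 < d by rewrite /d subr_gt0 ltr_pdivlMr// mul1r /r; lra.
(* The exponent is [2 k]: Bernoulli's inequality for [k], squared, grows quadratically and so beats
   the linear right-hand side. *)
have bound k : (1 + k%:R * d) ^+ 2 <= (k * 2 * size f).+1%:R.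
  have e1 : (1 + d) ^+ (k * 2) <= (k * 2 * size f).+1%:R.
    have -> : 1 + d = a / r by rewrite /d; ring.
    rewrite expr_div_n ler_pdivrMr ?exprn_gt0//.
    apply: le_trans (main _) _; rewrite ler_wpM2l//.
    rewrite lerXn2r ?nnegrE ?(ltW r0)//; rewrite /r; lra.
  have b0 : 0 <= 1 + k%:R * d by rewrite addr_ge0// mulr_ge0// ltW.
  have b1 := bernoulli_ineq k (ltW d0).
  apply: le_trans e1; rewrite exprM; apply: lerXn2r => //.
  by rewrite nnegrE (le_trans b0 b1).
pose s : R := 2 * (size f)%:R / d ^+ 2 + 1.
have s0 : 0 < s.
  by rewrite /s ltr_wpDl// divr_ge0// sqr_ge0.
have /andP[_ k1] := truncn_itv (ltW s0).
set k := (Num.truncn s).+1 in k1.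
have := bound k; rewrite -natr1 !natrM.
have E : 2 * (size f)%:R = (s - 1) * d ^+ 2.
  by rewrite /s addrK divfK// expf_neq0// gt_eqF.
have k0 : 1 <= k%:R :> R by rewrite ler1n.
rewrite -(mulrA k%:R) E => B.
have : k%:R * d ^+ 2 * s < k%:R * d ^+ 2 * k%:R.
  by rewrite ltr_pM2l// mulr_gt0// ?exprn_gt0// (lt_le_trans ltr01).
have : 0 < k%:R * d ^+ 2 by rewrite mulr_gt0// ?exprn_gt0// (lt_le_trans ltr01).
have : 0 < k%:R * d by rewrite mulr_gt0// (lt_le_trans ltr01).
move: B.
have -> : k%:R * ((s - 1) * d ^+ 2) = k%:R * d ^+ 2 * s - k%:R * d ^+ 2 by ring.
have -> : (1 + k%:R * d) ^+ 2 = 1 + k%:R * d *+ 2 + k%:R * d ^+ 2 * k%:R by ring.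
by rewrite mulr2n; lra.
Qed.

End MaximumModulus.

(** * Polynomials of a linear map *)

Section PolynomialCalculus.
Context {R : realType} {V : lmodType R[i]}.
Implicit Types (S : V -> V) (g h : {poly R[i]}) (x : V).

(** The formula of [poly_op] over an arbitrary module, because it is also applied to maps of
    [X ^ n]. *)
Definition pev g S x : V := \sum_(k < size g) g`_k *: iter k S x.

Lemma pev_wide n g S x : (size g <= n)%N ->
  pev g S x = \sum_(k < n) g`_k *: iter k S x.
Proof.
move=> gn; rewrite /pev (big_ord_widen n (fun k => g`_k *: iter k S x))//.
rewrite big_mkcond; apply: eq_bigr => k _; case: ltnP => // gk.
by rewrite nth_default// scale0r.
Qed.

Lemma pevD g h S x : pev (g + h) S x = pev g S x + pev h S x.
Proof.
set n := maxn (size g) (size h).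
rewrite !(@pev_wide n)// ?leq_maxl ?leq_maxr//; last exact: size_polyD.
by rewrite -big_split; apply: eq_bigr => k _; rewrite coefD scalerDl.
Qed.

Lemma pevZ a g S x : pev (a *: g) S x = a *: pev g S x.
Proof.
rewrite !(@pev_wide (size g))// ?size_scale_leq// scaler_sumr.
by apply: eq_bigr => k _; rewrite coefZ scalerA.
Qed.

Lemma pev0 S x : pev 0 S x = 0.
Proof. by rewrite /pev size_poly0 big_ord0. Qed.

Lemma pevN g S x : pev (- g) S x = - pev g S x.
Proof. by rewrite -(scaleN1r g) pevZ scaleN1r. Qed.

Lemma pevB g h S x : pev (g - h) S x = pev g S x - pev h S x.
Proof. by rewrite pevD pevN. Qed.

Lemma pev_sum (I : Type) (r : seq I) (P : pred I) (F : I -> {poly R[i]}) S x :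
  pev (\sum_(i <- r | P i) F i) S x = \sum_(i <- r | P i) pev (F i) S x.
Proof.
apply: (big_ind2 (fun g y => pev g S x = y)) => [|g y h z <- <-|//].
- by rewrite pev0.
- by rewrite pevD.
Qed.

Lemma pevXn k S x : pev 'X^k S x = iter k S x.
Proof.
rewrite (@pev_wide k.+1) ?size_polyXn// big_ord_recr /= coefXn eqxx scale1r.
rewrite big1 ?add0r// => i _; rewrite coefXn; case: eqP => [e|_].
  by have := ltn_ord i; rewrite e ltnn.
by rewrite scale0r.
Qed.

Lemma pevC a S x : pev a%:P S x = a *: x.
Proof.
have -> : a%:P = a *: 'X^0 by rewrite expr0 alg_polyC.
by rewrite pevZ pevXn.
Qed.

Lemma pevX S x : pev 'X S x = S x.
Proof. exact: (pevXn 1). Qed.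

Lemma pev1 S x : pev 1 S x = x.
Proof. by rewrite -(expr0 'X) pevXn. Qed.

Lemma linear_iter S k : linear S -> linear (iter k S).
Proof.
move=> lS; elim: k => [|k IH]; first by move=> a u v.
by move=> a u v; rewrite !iterS IH lS.
Qed.

Lemma linear0_op S : linear S -> S 0 = 0.
Proof. by move=> lS; have := lS (-1) 0 0; rewrite !scaleN1r addNr addNr. Qed.

Lemma linearZ_op S a x : linear S -> S (a *: x) = a *: S x.
Proof. by move=> lS; have := lS a x 0; rewrite (linear0_op lS) !addr0. Qed.

Lemma linearD_op S x y : linear S -> S (x + y) = S x + S y.
Proof. by move=> lS; have := lS 1 x y; rewrite !scale1r. Qed.

Lemma linearN_op S x : linear S -> S (- x) = - S x.
Proof. by move=> lS; rewrite -(scaleN1r x) (linearZ_op _ _ lS) scaleN1r. Qed.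

Lemma linearB_op S x y : linear S -> S (x - y) = S x - S y.
Proof. by move=> lS; rewrite (linearD_op _ _ lS) (linearN_op _ lS). Qed.

Lemma linear_sum_op S (I : Type) (r : seq I) (P : pred I) (F : I -> V) :
  linear S -> S (\sum_(i <- r | P i) F i) = \sum_(i <- r | P i) S (F i).
Proof.
move=> lS; apply: (big_ind2 (fun y z => S y = z)) => [|g y h z <- <-|//].
- exact: linear0_op.
- exact: linearD_op.
Qed.

Lemma linear_pev g S : linear S -> linear (pev g S).
Proof.
move=> lS a u v; rewrite /pev scaler_sumr -big_split; apply: eq_bigr => k _ /=.
by rewrite (linear_iter k lS) scalerDr !scalerA mulrC.
Qed.

Lemma pevMX g S x : pev (g * 'X) S x = pev g S (S x).
Proof.
rewrite (@pev_wide (size g).+1); last first.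
  by rewrite (leq_trans (size_polyMleq _ _))// size_polyX addn2.
rewrite big_ord_recl coefMX eqxx scale0r add0r; apply: eq_bigr => k _.
by rewrite coefMX /= -iterS iterSr.
Qed.

Lemma pevM g h S x : linear S -> pev (g * h) S x = pev g S (pev h S x).
Proof.
move=> lS; elim/poly_ind: g h x => [|g c IH] h x; first by rewrite mul0r !pev0.
rewrite mulrDl -mulrA (mulrC 'X) pevD IH mul_polyC pevZ pevMX pevD pevC pevMX.
congr (pev g S _ + _).
rewrite /pev (linear_sum_op _ _ _ lS); apply: eq_bigr => k _.
by rewrite (linearZ_op _ _ lS) -iterS -iterSr.
Qed.

End PolynomialCalculus.

(** * From a lower bound at a root of unity to a Lipschitz estimate *)

Section OperatorBounds.
Context {R : realType} {V : lmodType R[i]} {N : V -> R}.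
Hypothesis hN : is_seminorm N.
Variable S : V -> V.
Hypothesis lS : linear S.
Implicit Types (g h : {poly R[i]}) (c d : R).

Definition bnd g c := forall x, N (pev g S x) <= c * N x.

Lemma bndD g h c d : bnd g c -> bnd h d -> bnd (g + h) (c + d).
Proof.
move=> gc hd x; rewrite pevD mulrDl.
exact: le_trans (snD hN _ _) (lerD (gc x) (hd x)).
Qed.

Lemma bndZ a g c : bnd g c -> bnd (a *: g) (normc a * c).
Proof.
by move=> gc x; rewrite pevZ (snZ hN) -mulrA ler_wpM2l ?normc_ge0.
Qed.

Lemma bndZ1 a g c : normc a = 1 -> bnd g c -> bnd (a *: g) c.
Proof. by move=> a1 /(bndZ a); rewrite a1 mul1r. Qed.

Lemma bndB g h c d : bnd g c -> bnd h d -> bnd (g - h) (c + d).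
Proof.
move=> gc hd; apply: bndD => //; rewrite -scaleN1r; apply: bndZ1 => //.
by rewrite normcN normc1.
Qed.

Lemma bndM g h c d : 0 <= c -> bnd g c -> bnd h d -> bnd (g * h) (c * d).
Proof.
move=> c0 gc hd x; rewrite (pevM _ _ _ lS).
by apply: le_trans (gc _) _; rewrite -mulrA ler_wpM2l.
Qed.

Lemma bnd_le g c d : c <= d -> bnd g c -> bnd g d.
Proof.
by move=> cd gc x; apply: le_trans (gc x) _; rewrite ler_wpM2r ?(sn_ge0 hN).
Qed.

Lemma bnd_sum (I : Type) (r : seq I) (P : pred I) (F : I -> {poly R[i]}) (c : I -> R) :
  (forall i, P i -> bnd (F i) (c i)) ->
  bnd (\sum_(i <- r | P i) F i) (\sum_(i <- r | P i) c i).
Proof.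
move=> H; apply: (big_ind2 bnd) => //.
- by move=> x; rewrite pev0 (sn0 hN) mul0r.
- by move=> *; exact: bndD.
Qed.

Lemma bnd1 : bnd 1 1.
Proof. by move=> x; rewrite pev1 mul1r. Qed.

End OperatorBounds.

(** * Geometric sums at roots of unity *)

Section GeometricSums.
Context {R : realType}.

(** Telescoping: [1 / u ^ 2 <= 2 / u - 2 / (u + 1)] for [u >= 1]; the factor 2 makes this hold from
    the first term on. *)
Lemma sum_inv_sqr (a n : nat) : (0 < a)%N ->
  \sum_(a <= j < n) (j%:R ^- 2 : R) <= 2 / a%:R.
Proof.
move=> a0; have [na|an] := leqP n a.
  by rewrite big_geq// divr_ge0.
suff : \sum_(a <= j < n) (j%:R ^- 2 : R) <= 2 / a%:R - 2 / n%:R.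
  have : 0 <= 2 / n%:R :> R by rewrite divr_ge0.
  lra.
elim: n an => // n IH; rewrite ltnS leq_eqVlt => /predU1P[<-|an].
  rewrite big_nat1.
  have a0' : 0 < a%:R :> R by rewrite ltr0n.
  have a1' : 1 <= a%:R :> R by rewrite ler1n.
  rewrite -[a.+1%:R]natr1; move: (a%:R : R) a0' a1' => u u0 u1.
  rewrite -subr_ge0.
  have -> : 2 / u - 2 / (u + 1) - u ^- 2 = (u - 1) / (u ^+ 2 * (u + 1)).
    by field; rewrite !gt_eqF// addr_gt0.
  by rewrite divr_ge0 ?subr_ge0// mulr_ge0 ?sqr_ge0// addr_ge0 ?ltW.
rewrite big_nat_recr/=; last exact: ltnW.
have IHn := IH an.
have n0 : 0 < n%:R :> R by rewrite ltr0n; lia.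
have n1 : 1 <= n%:R :> R by rewrite ler1n; lia.
suff H : n%:R ^- 2 <= 2 / n%:R - 2 / n.+1%:R :> R.
  by apply: le_trans (lerD IHn H) _; rewrite addrA subrK.
clear IH IHn.
rewrite -[n.+1%:R]natr1; move: (n%:R : R) n0 n1 => u u0 u1.
rewrite -subr_ge0.
have -> : 2 / u - 2 / (u + 1) - u ^- 2 = (u - 1) / (u ^+ 2 * (u + 1)).
  by field; rewrite !gt_eqF// addr_gt0.
by rewrite divr_ge0 ?subr_ge0// mulr_ge0 ?sqr_ge0// addr_ge0 ?ltW.
Qed.

Definition geom_poly (L : nat) (w : R[i]) : {poly R[i]} :=
  \sum_(i < L) w^-1 ^+ i *: 'X^i.

Lemma geom_polyE L w : geom_poly L w = \sum_(i < L) (w^-1 *: 'X) ^+ i.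
Proof. by apply: eq_bigr => i _; rewrite exprZn. Qed.

Lemma geom_polyM L w : w != 0 ->
  geom_poly L w * (w%:P - 'X) = w *: (1 - w^-1 ^+ L *: 'X^L).
Proof.
move=> w0; rewrite geom_polyE.
have -> : w%:P - 'X = w *: (1 - w^-1 *: 'X).
  by rewrite scalerBr scalerA mulfV// scale1r alg_polyC.
rewrite -scalerAr; congr (_ *: _).
by rewrite mulrC -[in RHS]exprZn -opprB mulNr -subrX1 opprB.
Qed.

Lemma geom_poly_coef L i : (geom_poly L 1)`_i = (i < L)%:R.
Proof.
rewrite /geom_poly invr1.
have -> : \sum_(i < L) 1 ^+ i *: 'X^i = \poly_(i < L) 1 :> {poly R[i]}.
  by rewrite poly_def; apply: eq_bigr => k _; rewrite expr1n.
by rewrite coef_poly; case: ltnP.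
Qed.

(** Up to degree [L - 1] the truncation at [L] is invisible: the square has coefficient [m + 1] in
    degree [m], and the cube has the partial sums of these. *)
Lemma geom_poly_cube_coef L : (0 < L)%N ->
  (geom_poly L 1 ^+ 3)`_L.-1 = (\sum_(m < L) m.+1)%:R.
Proof.
case: L => // L _; rewrite /= exprSr coefM natr_sum.
rewrite [LHS](eq_bigr (fun m : 'I_L.+1 => m.+1%:R)) // => m _.
rewrite geom_poly_coef.
have -> : (L - m < L.+1)%N by rewrite ltnS leq_subr.
rewrite mulr1 expr2 coefM [LHS](eq_bigr (fun=> 1)) ?sumr_const ?card_ord// => i _.
rewrite !geom_poly_coef.
have /= im := ltn_ord i; have /= mL := ltn_ord m.
have -> : (i < L.+1)%N by lia.
have -> : (m - i < L.+1)%N by lia.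
by rewrite mulr1.
Qed.

Lemma sum_succn L : (L ^ 2 <= 2 * \sum_(m < L) m.+1)%N.
Proof.
elim: L => // L IH; rewrite big_ord_recr /= mulnDr.
by move: IH; rewrite -!mulnn; move: (\sum_(m < L) _)%N => s; nia.
Qed.

(** All degrees of the cube lie below [3 * L]; this is why roots of unity of order [3 * L] can
    isolate a single coefficient. *)
Lemma size_geom_poly_cube L : (size (geom_poly L 1%R ^+ 3)%R <= 3 * L)%N.
Proof.
have s1 : (size (geom_poly L 1%R) <= L)%N.
  by apply/leq_sizeP => j Lj; rewrite geom_poly_coef ltnNge Lj.
case: L s1 => [|L] s1.
  by rewrite /geom_poly big_ord0 expr0n size_poly0.
apply: leq_trans (size_poly_exp_leq _ _) _; lia.
Qed.

(** [geom_poly L w] is [geom_poly L 1] at [w^-1 *: 'X], so [w] enters only through the characters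
    [w^-1 ^+ m]. *)
Lemma geom_poly_cubeE L (w : R[i]) :
  geom_poly L w ^+ 3 =
    \sum_(m < 3 * L) ((geom_poly L 1 ^+ 3)`_m * w^-1 ^+ m) *: 'X^m.
Proof.
have -> : geom_poly L w = geom_poly L 1 \Po (w^-1 *: 'X).
  rewrite geom_polyE /geom_poly raddf_sum /=; apply: eq_bigr => i _.
  by rewrite invr1 expr1n scale1r rmorphXn /= comp_polyX.
rewrite -rmorphXn /= comp_polyE.
rewrite (big_ord_widen (3 * L) (fun i => (geom_poly L 1 ^+ 3)`_i *: (w^-1 *: 'X) ^+ i)) ?size_geom_poly_cube//.
rewrite big_mkcond; apply: eq_bigr => i _.
rewrite exprZn scalerA; case: ltnP => // si.
by rewrite nth_default// mul0r scale0r.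
Qed.

Lemma geom_poly_average L : (0 < L)%N ->
  \sum_(j < 3 * L) cis (j%:R / (3 * L)%:R) ^+ L.-1 *:
    geom_poly L (cis (j%:R / (3 * L)%:R)) ^+ 3
  = ((3 * L)%:R * (\sum_(m < L) m.+1)%:R) *: 'X^(L.-1).
Proof.
move=> L0; under eq_bigr => j _ do rewrite geom_poly_cubeE scaler_sumr.
have Lo : (L.-1 < 3 * L)%N by lia.
have E (c : R[i]) (m : 'I_(3 * L)) :
    \sum_(j < 3 * L) cis (j%:R / (3 * L)%:R) ^+ L.-1 *:
      ((c * (cis (j%:R / (3 * L)%:R))^-1 ^+ m) *: 'X^m) =
    (c * (if L.-1 == m then (3 * L)%:R else 0)) *: 'X^m.
  rewrite -sum_roots_of_unity2// mulr_sumr scaler_suml.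
  by apply: eq_bigr => j _; rewrite scalerA; congr (_ *: _); ring.
rewrite exchange_big /= (bigD1 (Ordinal Lo))//= [X in _ + X]big1 ?addr0.
  by rewrite (E _ (Ordinal Lo)) eqxx geom_poly_cube_coef// mulrC.
move=> m mL; rewrite E eq_sym.
have /negbTE -> : m != L.-1 :> nat by [].
by rewrite mulr0 scale0r.
Qed.

End GeometricSums.

Definition average_poly {R : realType} (Q : nat) : {poly R[i]} :=
  Q%:R^-1 *: \sum_(i < Q) 'X^i.

(** There are two averages because [bnd_term_high] pairs each of two geometric sums with one of
    them. *)
Definition smoothing_poly {R : realType} (Q q : nat) : {poly R[i]} :=
  average_poly Q ^+ 2 * ('X^q - 1).

Lemma bnd_average {R : realType} {V : lmodType R[i]} {N : V -> R} (S : V -> V)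
    (M : R) (Q : nat) : is_seminorm N -> (0 < Q)%N ->
  (forall i, (i < Q)%N -> @bnd R V N S 'X^i M) ->
  @bnd R V N S (average_poly Q) M.
Proof.
move=> hN Q0 hM.
have -> : M = normc (Q%:R^-1 : R[i]) * (Q%:R * M).
  by rewrite normcV normc_nat mulKf// pnatr_eq0 -lt0n.
apply: (bndZ hN); rewrite mulr_natl -[X in M *+ X]card_ord -sumr_const.
by apply: (bnd_sum hN) => i _; exact: hM.
Qed.

(** * The estimate for powers of one operator, frequency by frequency *)

Section DiscreteEstimate.
Context {R : realType} {V : lmodType R[i]} {N : V -> R}.
Hypothesis hN : is_seminorm N.
Variable S : V -> V.
Hypothesis lS : linear S.
Variables (M B : R) (zeta : R[i]) (L : nat).
Hypotheses (M1 : 1 <= M) (B0 : 0 <= B) (L0 : (0 < L)%N).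
Hypothesis hM : forall i, (i <= 6 * L)%N -> @bnd R V N S 'X^i M.
Hypothesis hB : forall k, (0 < k <= 6 * L)%N ->
  forall y, N y <= B * N (zeta *: y - iter k S y).
Local Notation P := (geom_poly L).
Local Notation bnd := (@bnd R V N S).

Let M0 : 0 <= M. Proof. exact: le_trans M1. Qed.

Let leq_6L i : (i <= L)%N -> (i <= 6 * L)%N.
Proof. by move/leq_trans; apply; rewrite leq_pmull. Qed.

Let bnd_geom w : normc w = 1 -> bnd (P w) (L%:R * M).
Proof.
move=> w1; rewrite mulr_natl -[X in M *+ X]card_ord -sumr_const.
apply: bnd_sum => // i _; apply: bndZ1 => //.
  by rewrite normcX normcV w1 invr1 expr1n.
by apply: hM; apply: leq_6L; exact: ltnW.
Qed.

Let bnd_1X i : (i <= 6 * L)%N -> forall w, normc w = 1 ->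
  bnd (1 - w *: 'X^i) (1 + M).
Proof.
by move=> iL w w1; apply: bndB => //; [exact: bnd1|apply: bndZ1 => //; exact: hM].
Qed.

Let bnd_X1 i : (i <= 6 * L)%N -> bnd ('X^i - 1) (1 + M).
Proof. by move=> iL; rewrite [1 + M]addrC; apply: bndB => //; [exact: hM|exact: bnd1]. Qed.

Let bnd_sumX n : (n <= 6 * L)%N -> bnd (\sum_(i < n) 'X^i) (n%:R * M).
Proof.
move=> nL; rewrite mulr_natl -[X in M *+ X]card_ord -sumr_const.
by apply: bnd_sum => // i _; apply: hM; exact: leq_trans (ltnW (ltn_ord i)) nL.
Qed.

Let unit_neq0 (w : R[i]) : normc w = 1 -> w != 0.
Proof. by move=> w1; rewrite -normc_gt0 w1. Qed.

Let normc_VL (w : R[i]) : normc w = 1 -> normc (w^-1 ^+ L) = 1.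
Proof. by move=> w1; rewrite normcX normcV w1 invr1 expr1n. Qed.

(* [zeta - 'X^k = w ^ k - 'X^k] is a multiple of [w - 'X], and [w - 'X] times
   [P w] has only two terms: the bound does not involve [L]. *)
Lemma bnd_geom_low w k : normc w = 1 -> (0 < k <= 6 * L)%N -> w ^+ k = zeta ->
  bnd (P w) (B * ((1 + M) * (k%:R * M))).
Proof.
move=> w1 k0 wk x; apply: le_trans (hB k0 _) _; rewrite -mulrA ler_wpM2l//.
have -> : zeta *: pev (P w) S x - iter k S (pev (P w) S x) =
   pev ((zeta%:P - 'X^k) * P w) S x.
  by rewrite (pevM _ _ _ lS) pevB pevC pevXn.
have -> : (zeta%:P - 'X^k) * P w =
    (w *: (1 - w^-1 ^+ L *: 'X^L)) * (\sum_(i < k) w ^+ (k.-1 - i) *: 'X^i).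
  rewrite -geom_polyM ?unit_neq0// -mulrA mulrC; congr (_ * _).
  rewrite -wk rmorphXn /= subrXX; congr (_ * _); apply: eq_bigr => i _.
  by rewrite -rmorphXn /= mul_polyC; congr (_ ^+ _ *: _).
apply: (bndM lS _ _ _ x); first by rewrite addr_ge0.
- by apply: bndZ1 => //; apply: bnd_1X; [exact: leq_6L|exact: normc_VL].
- rewrite mulr_natl -[X in M *+ X]card_ord -sumr_const.
  apply: bnd_sum => // i _; apply: bndZ1 => //; first by rewrite normcX w1 expr1n.
  apply: hM; case/andP: k0 => _; apply: leq_trans; exact: ltnW.
Qed.

(** Write ['X - 1] as [(w - 1) - (w - 'X)]: the second part telescopes against [P w], and the first
    gains [normc (w - 1)], which compensates a bound [c] of order [1 / normc (w - 1)]. *)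
Lemma bnd_geom_sub1 w c : normc w = 1 -> bnd (P w) c ->
  bnd (P w * ('X - 1)) ((1 + M) + normc (w - 1) * c).
Proof.
move=> w1 hc.
have -> : P w * ('X - 1) =
    (- w) *: (1 - w^-1 ^+ L *: 'X^L) + (w - 1) *: P w.
  rewrite scaleNr -geom_polyM ?unit_neq0// -(mul_polyC (w - 1)) polyCB polyC1.
  by ring.
apply: bndD => //; last exact: bndZ.
apply: bndZ1 => //; first by rewrite normcN.
by apply: bnd_1X; [exact: leq_6L|exact: normc_VL].
Qed.

Variables (Q q j0 c0 : nat).
Hypotheses (Q0 : (0 < Q <= L)%N) (qL : (q <= L)%N) (LQ : (L <= c0 * Q)%N)
  (j00 : (0 < j0)%N).
(* Small powers of the roots of unity of low nonzero frequency [d] reach [zeta]. *)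
Hypothesis hfreq : forall d, (0 < d <= j0)%N -> exists2 k,
  (0 < k)%N && (k * d <= 6 * L)%N & cis (d%:R / (3 * L)%:R) ^+ k = zeta.
Hypothesis hfreqN : forall d, (0 < d <= j0)%N -> exists2 k,
  (0 < k)%N && (k * d <= 6 * L)%N & cis (- (d%:R / (3 * L)%:R)) ^+ k = zeta.

Local Notation Av := (@average_poly R Q).
Local Notation Z := (@smoothing_poly R Q q).

Let Lr0 : 0 < L%:R :> R. Proof. by rewrite ltr0n. Qed.

Let Qr0 : 0 < Q%:R :> R. Proof. by rewrite ltr0n; case/andP: Q0. Qed.

Let normc_Qinv : normc (Q%:R^-1 : R[i]) = Q%:R^-1.
Proof. by rewrite normcV normc_nat. Qed.

Let bnd_Av : bnd Av M.
Proof.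
apply: bnd_average => //; first by case/andP: Q0.
by move=> i iQ; apply/hM/leq_6L; apply: leq_trans (ltnW iQ) _; case/andP: Q0.
Qed.

Let Av_sub1 : Av * ('X - 1) = Q%:R^-1 *: ('X^Q - 1).
Proof. by rewrite -scalerAl mulrC -subrX1. Qed.

(** At frequency [d], [low_const * L / d] will bound [P w] and [smooth_const] will bound
    [P w * ('X - 1)] when [d] is low; [high_const * L / d] will bound [P w * Av] when [d] is high.
    The 6 comes from [k * d <= 6 * L], and 32 is [16 * 6 / 3] with the 16 of [normc_cis_sub1_le]. *)
Definition low_const := 6 * B * (1 + M) * M.
Definition smooth_const := (1 + M) + 32 * B * (1 + M) * M.
Definition high_const := 3 * (1 + M) * M * (1 + c0%:R).

Let low0 : 0 <= low_const.
Proof. by rewrite /low_const !mulr_ge0// addr_ge0. Qed.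

Let smooth0 : 0 <= smooth_const.
Proof. by rewrite /smooth_const addr_ge0// ?addr_ge0// !mulr_ge0// addr_ge0. Qed.

Let high0 : 0 <= high_const.
Proof. by rewrite /high_const !mulr_ge0// addr_ge0. Qed.

Let near_ge0 : 0 <= low_const ^+ 2 * smooth_const * M ^+ 3.
Proof. by rewrite mulr_ge0 ?exprn_ge0// mulr_ge0 ?exprn_ge0. Qed.

Let far_ge0 : 0 <= high_const ^+ 2 * M * (1 + M).
Proof. by rewrite mulr_ge0 ?addr_ge0// mulr_ge0 ?exprn_ge0. Qed.

(** Two geometric sums carry the decay [a], the third is spent on the factor ['X - 1] of ['X^q - 1],
    and the averages are merely bounded by [M]. *)
Let bnd_term w a b : normc w = 1 -> 0 <= a -> 0 <= b -> bnd (P w) a ->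
  bnd (P w * ('X - 1)) b ->
  bnd (P w ^+ 3 * Z) (a ^+ 2 * b * (q%:R * M) * M ^+ 2).
Proof.
move=> w1 a0 b0 ha hb.
have -> : P w ^+ 3 * Z =
    (P w ^+ 2 * (P w * ('X - 1))) * (\sum_(i < q) 'X^i) * Av ^+ 2.
  by rewrite /smoothing_poly subrX1; ring.
have qM0 : 0 <= q%:R * M by rewrite mulr_ge0.
rewrite !expr2; apply: (bndM lS); first by rewrite !mulr_ge0.
  apply: (bndM lS); first by rewrite !mulr_ge0.
    by do 2?[apply: (bndM lS) => //]; rewrite ?mulr_ge0.
  by apply: bnd_sumX; apply: leq_6L.
exact: (bndM lS).
Qed.

(** At frequency 0 there is no decay: two factors get the trivial bound [L * M]. A single such term
    is affordable, since [P 1 * ('X - 1)] telescopes. *)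
Lemma bnd_term0 : bnd (P 1 ^+ 3 * Z) (L%:R ^+ 2 * q%:R * ((1 + M) * M ^+ 5)).
Proof.
have H := bnd_geom (normc1 R).
have H' := bnd_geom_sub1 (normc1 R) H.
rewrite subrr normc0 mul0r addr0 in H'.
have LM0 : 0 <= L%:R * M by rewrite mulr_ge0.
have b0 : 0 <= 1 + M by rewrite addr_ge0.
apply: bnd_le (bnd_term (normc1 R) LM0 b0 H H') => //.
by apply: le_of_eq; ring.
Qed.

Lemma bnd_term_low w d : normc w = 1 -> (0 < d)%N ->
  normc (w - 1) <= 16 * (d%:R / (3 * L)%:R) ->
  (exists2 k, (0 < k)%N && (k * d <= 6 * L)%N & w ^+ k = zeta) ->
  bnd (P w ^+ 3 * Z) (L%:R ^+ 2 * q%:R *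
    (low_const ^+ 2 * smooth_const * M ^+ 3) * d%:R ^- 2).
Proof.
move=> w1 d0 wd [k /andP[k0 kd] wk].
have dr0 : 0 < d%:R :> R by rewrite ltr0n.
have kL : (0 < k <= 6 * L)%N.
  by rewrite k0/=; apply: leq_trans kd; rewrite leq_pmulr.
set a := low_const * L%:R / d%:R.
have a0 : 0 <= a by rewrite /a divr_ge0// mulr_ge0.
have ha : bnd (P w) a.
  apply: bnd_le (bnd_geom_low w1 kL wk) => //.
  rewrite /a ler_pdivlMr// /low_const.
  have : k%:R * d%:R <= 6 * L%:R :> R by rewrite -!natrM ler_nat.
  have : 0 <= B * (1 + M) * M by rewrite !mulr_ge0// addr_ge0.
  set u := B * (1 + M) * M => u0 h.
  have := ler_wpM2l u0 h; rewrite /u; lra.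
have hb : bnd (P w * ('X - 1)) smooth_const.
  apply: bnd_le (bnd_geom_sub1 w1 ha) => //.
  rewrite /smooth_const lerD2l.
  apply: le_trans (ler_wpM2r a0 wd) _.
  apply: le_of_eq.
  rewrite /a /low_const natrM; field.
  by rewrite !gt_eqF.
apply: bnd_le (bnd_term w1 a0 smooth0 ha hb) => //.
apply: le_of_eq.
by rewrite /a; field; rewrite gt_eqF.
Qed.

Lemma bnd_term_high w d : normc w = 1 -> (0 < d)%N ->
  2 * (d%:R / (3 * L)%:R) <= normc (w - 1) ->
  bnd (P w ^+ 3 * Z) (L%:R ^+ 3 * (high_const ^+ 2 * M * (1 + M)) * d%:R ^- 2).
Proof.
move=> w1 d0 wd.
have dr0 : 0 < d%:R :> R by rewrite ltr0n.
have M10 : 0 <= 1 + M by rewrite addr_ge0.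
set a := high_const * L%:R / d%:R.
have a0 : 0 <= a by rewrite /a divr_ge0// mulr_ge0.
have n0 : 0 < normc (w - 1).
  by apply: lt_le_trans wd; rewrite mulr_gt0// divr_gt0// ltr0n muln_gt0.
have ha : bnd (P w * Av) a.
  have e : (w - 1) *: (P w * Av) = P w * (Q%:R^-1 *: ('X^Q - 1))
     + w *: (1 - w^-1 ^+ L *: 'X^L) * Av.
    rewrite -Av_sub1 -geom_polyM ?unit_neq0// -mul_polyC polyCB polyC1; ring.
  have hb : bnd ((w - 1) *: (P w * Av))
      (L%:R * M * (Q%:R^-1 * (1 + M)) + (1 + M) * M).
    rewrite e; apply: bndD => //; apply: (bndM lS) => //.
    - by rewrite mulr_ge0.
    - exact: bnd_geom.
    - by rewrite -normc_Qinv; apply: bndZ => //; apply: bnd_X1; apply: leq_6L; case/andP: Q0.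
    - by apply: bndZ1 => //; apply: bnd_1X; [exact: leq_6L|exact: normc_VL].
  move=> x; have := hb x; rewrite pevZ (snZ hN) mulrC -ler_pdivlMr// => h.
  apply: le_trans h _; rewrite mulrAC ler_wpM2r ?(sn_ge0 hN)//.
  rewrite ler_pdivrMr//; apply: le_trans (ler_wpM2l a0 wd).
  have -> : a * (2 * (d%:R / (3 * L)%:R)) = 2 * (1 + M) * M * (1 + c0%:R).
    rewrite /a /high_const natrM; field.
    by rewrite !gt_eqF.
  have LQ' : L%:R / Q%:R <= c0%:R :> R.
    by rewrite ler_pdivrMr// -natrM ler_nat.
  have u0 : 0 <= (1 + M) * M by rewrite mulr_ge0.
  have := ler_wpM2l u0 LQ'.
  have : 0 <= (1 + M) * M * (1 + c0%:R) by rewrite mulr_ge0// addr_ge0.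
  by rewrite mulrCA; lra.
have -> : P w ^+ 3 * Z = (P w * Av) ^+ 2 * P w * ('X^q - 1).
  by rewrite /smoothing_poly; ring.
have -> : L%:R ^+ 3 * (high_const ^+ 2 * M * (1 + M)) / d%:R ^+ 2 =
    a * a * (L%:R * M) * (1 + M).
  by rewrite /a; field; rewrite gt_eqF.
rewrite expr2; apply: (bndM lS) => //; first by rewrite !mulr_ge0.
  apply: (bndM lS) => //; [by rewrite mulr_ge0|exact: (bndM lS)|].
  exact: bnd_geom.
by apply: bnd_X1; exact: leq_6L.
Qed.

Definition main_const :=
  2 * ((1 + M) * M ^+ 5 + 4 * (low_const ^+ 2 * smooth_const * M ^+ 3)).
Definition tail_const := 8 * (high_const ^+ 2 * M * (1 + M)).

(** The low-frequency bound is kept for all [d], so that [g] is a sum of two multiples of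
    [1 / d ^ 2], the second starting only beyond [j0]. *)
Let g (d : nat) : R :=
  L%:R ^+ 2 * q%:R * (low_const ^+ 2 * smooth_const * M ^+ 3) * d%:R ^- 2 +
  (if (j0 < d)%N then
     L%:R ^+ 3 * (high_const ^+ 2 * M * (1 + M)) * d%:R ^- 2 else 0).

Let g0 d : 0 <= g d.
Proof.
rewrite /g; apply: addr_ge0.
  by rewrite divr_ge0 ?exprn_ge0// mulr_ge0// mulr_ge0 ?exprn_ge0.
by case: ifP => // _; rewrite divr_ge0 ?exprn_ge0// mulr_ge0 ?exprn_ge0.
Qed.

Lemma bnd_term_near w d : (0 < d)%N -> (2 * d <= 3 * L)%N ->
  w = cis (d%:R / (3 * L)%:R) \/ w = cis (- (d%:R / (3 * L)%:R)) ->
  bnd (P w ^+ 3 * Z) (g d).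
Proof.
move=> d0 dL hw.
have x0 : 0 < d%:R / (3 * L)%:R :> R by rewrite divr_gt0 ?ltr0n ?muln_gt0.
have x1 : d%:R / (3 * L)%:R <= 1 / 2 :> R.
  rewrite ler_pdivrMr ?ltr0n ?muln_gt0//.
  have : (2 * d)%:R <= (3 * L)%:R :> R by rewrite ler_nat.
  rewrite natrM; lra.
have w1 : normc w = 1 by case: hw => ->; rewrite normc_cis.
have we : normc (w - 1) = normc (cis (d%:R / (3 * L)%:R) - 1 : R[i]).
  by case: hw => ->; rewrite ?normc_cis_sub1N.
have [jd|dj] := ltnP j0 d.
  apply: (bnd_le hN) (bnd_term_high w1 d0 _).
    by rewrite /g jd lerDr divr_ge0 ?exprn_ge0// mulr_ge0// mulr_ge0 ?exprn_ge0.
  by rewrite we normc_cis_sub1_ge// x0 x1.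
apply: (bnd_le hN) (bnd_term_low w1 d0 _ _).
- by rewrite /g ltnNge dj addr0.
- by rewrite we normc_cis_sub1_le// ltW.
- have dj' : (0 < d <= j0)%N by rewrite d0.
  by case: hw => ->; [exact: hfreq|exact: hfreqN].
Qed.

(** An index past the middle stands for the frequency [- (3 * L - j)]. Adding both bounds avoids
    splitting the sum and costs a factor 2. *)
Lemma bnd_term_all (j : nat) : (0 < j < 3 * L)%N ->
  bnd (P (cis (j%:R / (3 * L)%:R)) ^+ 3 * Z) (g j + g (3 * L - j)).
Proof.
move=> /andP[jp jL].
have [h|h] := leqP (2 * j) (3 * L).
  apply: (bnd_le hN) (bnd_term_near jp h _); last by left.
  by rewrite lerDl.
apply: (bnd_le hN) (@bnd_term_near _ (3 * L - j)%N _ _ _); first by rewrite lerDr.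
- by rewrite subn_gt0.
- by clear - h; lia.
- right; rewrite natrB ?(ltnW jL)//.
  have n0 : (3 * L)%:R != 0 :> R by rewrite pnatr_eq0 -lt0n muln_gt0.
  have -> : - (((3 * L)%:R - j%:R) / (3 * L)%:R) = j%:R / (3 * L)%:R - 1 :> R.
    by move: ((3 * L)%:R : R) n0 => u u0; field.
  by rewrite cisD cisN cis1 invr1 mulr1.
Qed.

Lemma sum_g : \sum_(1 <= j < 3 * L) g j <=
  2 * (L%:R ^+ 2 * q%:R * (low_const ^+ 2 * smooth_const * M ^+ 3)) +
  2 * (L%:R ^+ 3 * (high_const ^+ 2 * M * (1 + M))) / j0%:R.
Proof.
rewrite big_split /= lerD//.
  rewrite -mulr_sumr mulrC ler_wpM2r//.
    by rewrite mulr_ge0// mulr_ge0 ?exprn_ge0.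
  by apply: le_trans (sum_inv_sqr _ _) _ => //; rewrite divr1.
set c := _ * (_ * _ * _).
have c1 : 0 <= c by rewrite /c mulr_ge0 ?exprn_ge0.
rewrite -big_mkcond /= -mulr_sumr.
rewrite [leRHS](_ : _ = c * (2 / j0%:R)); last by ring.
rewrite ler_wpM2l//.
have [h|h] := leqP (3 * L) j0.
  rewrite big1_seq ?divr_ge0// => i; rewrite mem_index_iota; clear - h; lia.
rewrite (big_cat_nat (n := j0.+1))//=.
rewrite big1_seq ?add0r; last by move=> i; rewrite mem_index_iota; clear - h; lia.
rewrite (_ : \sum_(_ <= _ < _ | _) _ = \sum_(j0.+1 <= i < 3 * L) (i%:R ^- 2 : R)); last first.
  by rewrite big_nat_cond [RHS]big_nat_cond; apply: eq_bigl => i; case: (ltnP j0 i); rewrite ?andbT ?andbF.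
apply: le_trans (sum_inv_sqr _ _) _ => //.
by rewrite ler_pM2l// lef_pV2 ?posrE ?ltr0n// ler_nat.
Qed.

(* Averaging over the [3 * L]-th roots of unity extracts the coefficient of
   ['X^(L.-1)] in the cube of [1 + 'X + ... + 'X^(L.-1)], which is at least
   [L ^ 2 / 2]. *)
Lemma discrete_estimate :
  bnd ('X^(L.-1) * Z) (main_const * (q%:R / L%:R) + tail_const / j0%:R).
Proof.
set s := (\sum_(m < L) m.+1)%N.
have sL : L%:R ^+ 2 <= 2 * s%:R :> R by rewrite -natrX -natrM ler_nat sum_succn.
have s0 : 0 < s%:R :> R.
  have : 0 < L%:R ^+ 2 :> R by rewrite exprn_gt0.
  lra.
pose T : {poly R[i]} := \sum_(j < 3 * L) cis (j%:R / (3 * L)%:R) ^+ L.-1 *: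
    (P (cis (j%:R / (3 * L)%:R)) ^+ 3 * Z).
pose b : R := L%:R ^+ 2 * q%:R * ((1 + M) * M ^+ 5) +
  2 * (2 * (L%:R ^+ 2 * q%:R * (low_const ^+ 2 * smooth_const * M ^+ 3)) +
  2 * (L%:R ^+ 3 * (high_const ^+ 2 * M * (1 + M))) / j0%:R).
have hT : bnd T b.
  have L3 : (0 < 3 * L)%N by rewrite muln_gt0.
  rewrite /T -(big_mkord xpredT (fun j : nat => cis (j%:R / (3 * L)%:R) ^+ L.-1 *:
    (P (cis (j%:R / (3 * L)%:R)) ^+ 3 * Z))) big_ltn//.
  apply: (bndD hN).
    by rewrite mul0r cis0 expr1n scale1r; exact: bnd_term0.
  apply: (bnd_le hN (c := \sum_(1 <= j < 3 * L) (g j + g (3 * L - j)))).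
    rewrite big_split /= mulr2n mulrDl mul1r lerD ?sum_g//.
    rewrite big_nat_rev /= (eq_big_nat _ _ (F2 := g)) ?sum_g// => i iL.
    by congr g; clear - iL; lia.
  rewrite big_nat_cond [X in bnd _ X]big_nat_cond; apply: (bnd_sum hN) => j.
  rewrite andbT => jL; apply: (bndZ1 hN); first by rewrite normcX normc_cis expr1n.
  exact: bnd_term_all.
have ET : T = ((3 * L)%:R * s%:R) *: ('X^(L.-1) * Z).
  rewrite scalerAl -geom_poly_average// mulr_suml.
  by apply: eq_bigr => j _; rewrite scalerAl.
move=> x; have := hT x; rewrite ET pevZ (snZ hN) normcM !normc_nat.
have s3 : 0 < (3 * L)%:R * s%:R :> R by rewrite mulr_gt0// ltr0n muln_gt0.
rewrite mulrC -ler_pdivlMr// => h.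
apply: le_trans h _; rewrite mulrAC ler_wpM2r ?(sn_ge0 hN)// ler_pdivrMr//.
have j0r : 0 < j0%:R :> R by rewrite ltr0n.
set c := main_const * _ + _.
have c1 : 0 <= c.
  have u10 : 0 <= (1 + M) * M ^+ 5 by rewrite mulr_ge0 ?exprn_ge0// addr_ge0.
  rewrite /c /main_const /tail_const; apply: addr_ge0.
    by rewrite mulr_ge0 ?divr_ge0// mulr_ge0// addr_ge0// mulr_ge0.
  by rewrite divr_ge0// mulr_ge0.
apply: le_trans (_ : c * ((3 * L)%:R * (L%:R ^+ 2 / 2)) <= _); last first.
  by rewrite ler_wpM2l// ler_wpM2l//; lra.
rewrite /c /b /main_const /tail_const natrM.
set u1 := (1 + M) * _; set u2 := low_const ^+ 2 * _ * _.
set u3 := high_const ^+ 2 * _ * _.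
have u10 : 0 <= u1 by rewrite /u1 mulr_ge0 ?exprn_ge0// addr_ge0.
have u20 : 0 <= u2 := near_ge0.
have u30 : 0 <= u3 := far_ge0.
rewrite -subr_ge0.
have -> : (2 * (u1 + 4 * u2) * (q%:R / L%:R) + 8 * u3 / j0%:R) *
   (3 * L%:R * (L%:R ^+ 2 / 2)) - (L%:R ^+ 2 * q%:R * u1 +
  2 * (2 * (L%:R ^+ 2 * q%:R * u2) + 2 * (L%:R ^+ 3 * u3) / j0%:R)) =
  L%:R ^+ 2 * q%:R * (2 * u1 + 8 * u2) + 8 * (L%:R ^+ 3 * u3) / j0%:R.
  by field; rewrite !gt_eqF.
have L2 : 0 <= L%:R ^+ 2 * q%:R :> R by rewrite mulr_ge0 ?exprn_ge0.
have L3 : 0 <= L%:R ^+ 3 * u3 by rewrite mulr_ge0 ?exprn_ge0.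
have u12 : 0 <= 2 * u1 + 8 * u2 by lra.
by apply: addr_ge0; [exact: mulr_ge0|apply: divr_ge0 => //; exact: mulr_ge0].
Qed.

End DiscreteEstimate.

(** * From powers of one operator to a semigroup *)

Section SemigroupEstimate.
Context {R : realType} {V : lmodType R[i]} {N : V -> R}.
Hypothesis hN : is_seminorm N.
Variable T : R -> V -> V.
Variables (M B : R) (a b : nat).
Hypotheses (M1 : 1 <= M) (B0 : 0 <= B) (ab : (0 < a <= b)%N).
Hypothesis linT : forall s : R, 0 <= s -> linear (T s).
Hypothesis T0 : forall x, T 0 x = x.
Hypothesis TD : forall (s t : R) x, 0 <= s -> 0 <= t -> T (s + t) x = T s (T t x).
Hypothesis TM : forall (s : R) x, 0 <= s <= 1 -> N (T s x) <= M * N x.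
Hypothesis Tcont : forall x (e : R), 0 < e ->
  exists2 d : R, 0 < d & forall s, 0 <= s <= d -> N (T s x - x) <= e.
Hypothesis TB : forall (s : R) y, 0 < s <= 1 ->
  N y <= B * N (cis (a%:R / b%:R) *: y - T s y).

Let M0 : 0 <= M. Proof. exact: le_trans M1. Qed.

Lemma iter_semigroup h k x : 0 <= h -> iter k (T h) x = T (k%:R * h) x.
Proof.
move=> h0; elim: k => [|k IH]; first by rewrite mul0r T0.
by rewrite iterS IH -TD ?mulr_ge0//; congr (T _ x); rewrite -natr1; ring.
Qed.

Lemma average_close h Q e x : 0 <= h -> (0 < Q)%N -> Q%:R * h <= 1 ->
  (forall s, 0 <= s <= Q%:R * h -> N (T s x - x) <= e) ->
  N (pev (average_poly Q) (T h) x - x) <= e.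
Proof.
move=> h0 Q0 Qh H.
have Qr : 0 < Q%:R :> R by rewrite ltr0n.
have Qc : Q%:R != 0 :> R[i] by rewrite pnatr_eq0 -lt0n.
rewrite pevZ pev_sum.
have -> : Q%:R^-1 *: (\sum_(i < Q) pev 'X^i (T h) x) - x =
   Q%:R^-1 *: \sum_(i < Q) (T (i%:R * h) x - x) :> V.
  rewrite sumrB sumr_const card_ord scalerBr -(scaler_nat Q x) scalerA mulVf// scale1r.
  congr (_ *: _ - _); apply: eq_bigr => i _.
  by rewrite pevXn iter_semigroup.
rewrite (snZ hN) normcV normc_nat mulrC ler_pdivrMr//.
apply: le_trans (sn_sum hN _ _ _) _.
rewrite mulr_natr -[X in e *+ X]card_ord -sumr_const; apply: ler_sum => i _.
apply: H; rewrite mulr_ge0//= ler_wpM2r// ler_nat ltnW//.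
Qed.

(** The factor [M] pays for one more application of [T h], which raises the exponent [L - 1] of
    [discrete_estimate] to [L]. *)
Definition lipschitz_const := M * main_const M B.

Lemma lipschitz_const_ge0 : 0 <= lipschitz_const.
Proof.
have M10 : 0 <= 1 + M by rewrite addr_ge0.
have s0 : 0 <= smooth_const M B by rewrite /smooth_const addr_ge0// !mulr_ge0.
have near0 : 0 <= low_const M B ^+ 2 * smooth_const M B * M ^+ 3.
  by apply: mulr_ge0; [apply: mulr_ge0 => //; exact: sqr_ge0|exact: exprn_ge0].
apply: mulr_ge0 => //; apply: mulr_ge0 => //; apply: addr_ge0.
  by apply: mulr_ge0 => //; exact: exprn_ge0.
exact: mulr_ge0.
Qed.

(** With [L = m * (b * d)], the power [3 a m] of [cis (d / (3 L))] is [cis (a / b)]. For the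
    conjugate root the power [3 (2 b - a) m] has argument [a / b - 2], equal to [a / b] modulo 1;
    being at most [6 b m], this exponent is the origin of the bound [6 * L]. *)
Let freq_exists L j0 d : (0 < d <= j0)%N -> (b * j0`! %| L)%N -> (0 < L)%N ->
  (exists2 k, (0 < k)%N && (k * d <= 6 * L)%N &
    cis (d%:R / (3 * L)%:R) ^+ k = cis (a%:R / b%:R) :> R[i]) /\
  (exists2 k, (0 < k)%N && (k * d <= 6 * L)%N &
    cis (- (d%:R / (3 * L)%:R)) ^+ k = cis (a%:R / b%:R) :> R[i]).
Proof.
move=> dj bL L0.
have [a0 leab] := andP ab; have b0 : (0 < b)%N by exact: leq_trans leab.
have d0 : (0 < d)%N by case/andP: dj.
have dv : (b * d %| L)%N.
  by apply: dvdn_trans bL; rewrite dvdn_pmul2l// dvdn_fact.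
case/dvdnP: dv => m Lm.
have m0 : (0 < m)%N by case: m Lm => // Lm; rewrite Lm in L0.
have br : b%:R != 0 :> R by rewrite pnatr_eq0 -lt0n.
have dr : d%:R != 0 :> R by rewrite pnatr_eq0 -lt0n.
have mr : m%:R != 0 :> R by rewrite pnatr_eq0 -lt0n.
split.
- exists (a * (3 * m))%N; first by rewrite !muln_gt0 a0 m0 /= Lm; nia.
  rewrite cisX; congr cis; rewrite Lm !natrM; field.
  by rewrite br dr mr.
- exists ((2 * b - a) * (3 * m))%N.
    by rewrite !muln_gt0 m0 /= Lm; apply/andP; split; [lia|nia].
  rewrite cisX.
  have -> : ((2 * b - a) * (3 * m))%:R * - (d%:R / (3 * L)%:R) =
     a%:R / b%:R - 2%:R :> R.
    rewrite Lm !natrM natrB ?natrM; last lia.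
    by field; rewrite br dr mr.
  by rewrite cisD cisN cis_nat invr1 mulr1.
Qed.

(** With [h = 1 / (6 L')], the operator [T (1 / 6)] is the power [L'] of [T h], and the times [i h]
    with [i <= 6 L'] stay in [0, 1], where [M] and [B] apply. Expanding [q / L] by [m] gives the
    denominator the divisibility that [freq_exists] asks for. *)
Lemma rational_lipschitz q L x : (0 < L)%N -> (q <= L)%N ->
  N (T (1 / 6) (T (q%:R / L%:R / 6) x) - T (1 / 6) x) <=
    lipschitz_const * (q%:R / L%:R) * N x.
Proof.
move=> L0 qL; apply/ler_addgt0Pr => e e0.
(* [M * (1 + M)] bounds the operator [W] below, and the last [1 + M] accounts for two successive
   averages; [W (X - x)] will contribute at most [e / 2]. *)
pose c := M * (1 + M) * (1 + M).
have Mp : 0 < 1 + M by rewrite ltr_pwDl.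
have c0 : 0 < c by rewrite /c !mulr_gt0// (lt_le_trans ltr01).
have e2c : 0 < e / 2 / c by rewrite !divr_gt0.
have [rho rho0 hrho] := Tcont x e2c.
(* The order of the choices matters. Averages over [Q = L' / n0] steps of length [h] span the time
   [1 / (6 n0)] whatever [L'] is, so [n0] is fixed first by continuity at [x]; then [j0], depending
   on [n0] through [tail_const], makes the tail small. *)
pose n0 := (Num.truncn rho^-1).+1.
have n0r : rho^-1 < n0%:R.
  by have := rho0; rewrite -invr_gt0 => /ltW/truncn_itv/andP[].
pose K := M * tail_const M n0 * N x.
have K0 : 0 <= K.
  rewrite /K mulr_ge0 ?(sn_ge0 hN)// mulr_ge0// /tail_const.
  by rewrite mulr_ge0// mulr_ge0 ?addr_ge0// mulr_ge0// sqr_ge0.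
pose j0 := (Num.truncn (K / (e / 2))).+1.
have j0r : K / (e / 2) < j0%:R.
  by have : 0 <= K / (e / 2); [rewrite divr_ge0// ltW// divr_gt0|move/truncn_itv/andP => []].
have b0 : (0 < b)%N by case/andP: ab => a0; exact: leq_trans.
pose m := (n0 * (b * j0`!))%N.
have m0 : (0 < m)%N by rewrite !muln_gt0 b0 fact_gt0.
pose L' := (L * m)%N; pose q' := (q * m)%N; pose Q := (L * (b * j0`!))%N.
have L'0 : (0 < L')%N by rewrite muln_gt0 L0.
have Q0 : (0 < Q)%N by rewrite !muln_gt0 L0 b0 fact_gt0.
have L'Q : L' = (n0 * Q)%N by rewrite /L' /m /Q mulnCA.
have QL' : (Q <= L')%N by rewrite L'Q leq_pmull.
have q'L' : (q' <= L')%N by rewrite leq_mul2r qL orbT.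
have dvL' : (b * j0`! %| L')%N by rewrite /L' /m mulnA dvdn_mull.
pose h : R := (1 / 6) / L'%:R.
have Lr : 0 < L'%:R :> R by rewrite ltr0n.
have Lr' : L'%:R != 0 :> R by rewrite gt_eqF.
have h0 : 0 < h by rewrite !divr_gt0.
have h6 i : (i <= 6 * L')%N -> i%:R * h <= 1.
  move=> iL; have -> : i%:R * h = i%:R / (6 * L'%:R) by rewrite /h; field.
  by rewrite ler_pdivrMr ?mulr_gt0// mul1r -natrM ler_nat.
have lS := linT (ltW h0).
have hM i : (i <= 6 * L')%N -> bnd (N := N) (T h) 'X^i M.
  move=> iL y; rewrite pevXn (iter_semigroup _ _ (ltW h0)); apply: TM.
  by rewrite h6// andbT mulr_ge0// ltW.
have hB k : (0 < k <= 6 * L')%N ->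
    forall y, N y <= B * N (cis (a%:R / b%:R) *: y - iter k (T h) y).
  case/andP => k0 kL y; rewrite (iter_semigroup _ _ (ltW h0)); apply: TB.
  by rewrite h6// andbT mulr_gt0// ltr0n.
have D := discrete_estimate hN lS M1 B0 L'0 hM hB (Q := Q) (q := q') (j0 := j0)
  (c0 := n0) _ q'L' _ isT (fun d hd => (freq_exists hd dvL' L'0).1)
  (fun d hd => (freq_exists hd dvL' L'0).2).
rewrite Q0 QL' -L'Q leqnn in D; have {}D := D isT isT.
pose Av : {poly R[i]} := average_poly Q.
pose X := pev (Av ^+ 2) (T h) x.
have Qh : Q%:R * h <= rho.
  rewrite /h L'Q natrM.
  have n0p : 0 < n0%:R :> R by rewrite ltr0n.
  have Qp : 0 < Q%:R :> R by rewrite ltr0n.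
  have -> : Q%:R * (1 / 6 / (n0%:R * Q%:R)) = n0%:R^-1 / 6 :> R.
    by field; rewrite !gt_eqF.
  have : n0%:R^-1 < rho by rewrite -[rho]invrK ltf_pV2 ?posrE ?invr_gt0.
  have : 0 < n0%:R^-1 :> R by rewrite invr_gt0.
  lra.
have Qh1 : Q%:R * h <= 1 by apply: h6; apply: leq_trans QL' _; rewrite leq_pmull.
have close1 : N (pev Av (T h) x - x) <= e / 2 / c.
  apply: average_close (ltW h0) Q0 Qh1 _ => s /andP[s0 sQ].
  by apply: hrho; rewrite s0 (le_trans sQ).
have bAv : bnd (N := N) (T h) Av M.
  apply: bnd_average => // i iQ; apply: hM; apply: leq_trans (ltnW iQ) _.
  by apply: leq_trans QL' _; rewrite leq_pmull.
have close2 : N (X - x) <= (1 + M) * (e / 2 / c).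
  rewrite /X expr2 (pevM _ _ _ lS).
  apply: le_trans (sn_triangle hN (pev Av (T h) x) _ _) _.
  rewrite -(linearB_op _ _ (linear_pev _ lS)) mulrDl mul1r addrC lerD//.
  by apply: le_trans (bAv _) _; rewrite ler_wpM2l.
have e1 : q%:R / L%:R = q'%:R / L'%:R :> R.
  by rewrite /q' /L' (natrM _ q m) (natrM _ L m) -mulf_div divff ?mulr1// pnatr_eq0 -lt0n.
have u1 : q%:R / L%:R / 6 = q'%:R * h by rewrite e1 /h; ring.
have u0 : 0 <= q'%:R * h by rewrite mulr_ge0// ltW.
have L1 : (1 / 6 : R) = L'%:R * h by rewrite /h; field.
pose W y := T (1 / 6) (T (q'%:R * h) y) - T (1 / 6) y.
have WB y : N (W y) <= M * (1 + M) * N y.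
  apply: le_trans (snB hN _ _) _.
  have i6 : 0 <= (1 / 6 : R) <= 1 by apply/andP; split; lra.
  have iq : 0 <= q'%:R * h <= 1.
    by rewrite u0 h6//; apply: leq_trans q'L' _; rewrite leq_pmull.
  have t1 := TM y i6; have t2 := TM (T (q'%:R * h) y) i6.
  have t3 := ler_wpM2l M0 (TM y iq).
  have -> : M * (1 + M) * N y = M * (M * N y) + M * N y by ring.
  by rewrite lerD// (le_trans t2).
rewrite u1 e1 -/(W x).
have -> : W x = W X - W (X - x).
  have lq := linT u0.
  have l6 : linear (T (1 / 6)) by apply: linT; rewrite divr_ge0.
  rewrite /W !(linearB_op _ _ lq) !(linearB_op _ _ l6).
  by rewrite opprB addrA [_ - _ + (_ - _)]addrA subrK opprB addrC addrA subrK.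
apply: le_trans (snB hN _ _) _.
have WX : W X = T h (pev ('X^(L'.-1) * smoothing_poly Q q') (T h) x).
  have -> : 'X^(L'.-1) * smoothing_poly Q q' = 'X^(L'.-1) * ('X^q' - 1) * Av ^+ 2.
    by rewrite /smoothing_poly -/Av; ring.
  rewrite !(pevM _ _ _ lS) -/X pevB pev1 (linearB_op _ _ (linear_pev _ lS)).
  rewrite !pevXn (linearB_op _ _ lS) -!iterS prednK// !(iter_semigroup _ _ (ltW h0)).
  by rewrite -L1 /W /X expr2 (pevM _ _ _ lS).
have hX : N (W X) <= M * (main_const M B * (q'%:R / L'%:R) + tail_const M n0 / j0%:R) * N x.
  rewrite WX; apply: le_trans (TM _ _) _.
    by rewrite (ltW h0)/=; have := h6 1%N; rewrite mul1r muln_gt0 L'0; exact.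
  by rewrite -mulrA ler_wpM2l.
have hX' : N (W (X - x)) <= e / 2.
  apply: le_trans (WB _) _.
  have Mc : 0 <= M * (1 + M) by rewrite mulr_ge0// ltW.
  apply: le_trans (ler_wpM2l Mc close2) _.
  have -> : M * (1 + M) * ((1 + M) * (e / 2 / c)) = e / 2 by rewrite /c; field; rewrite !gt_eqF// (lt_le_trans ltr01).
  by [].
have hK : M * (tail_const M n0 / j0%:R) * N x <= e / 2.
  have -> : M * (tail_const M n0 / j0%:R) * N x = K / j0%:R by rewrite /K; ring.
  have jp : 0 < j0%:R :> R by rewrite ltr0n.
  have e2 : 0 < e / 2 by rewrite divr_gt0.
  by rewrite ler_pdivrMr// mulrC -ler_pdivrMr// ltW.
move: hX; rewrite mulrDr mulrDl mulrA -/lipschitz_const => hX.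
have e22 : e = e / 2 + e / 2 by rewrite -splitr.
rewrite [in leRHS]e22; lra.
Qed.

(* From rational to real [u] by right continuity at 0. *)
Lemma semigroup_lipschitz u x : 0 <= u <= 1 ->
  N (T (1 / 6) (T (u / 6) x) - T (1 / 6) x) <= lipschitz_const * u * N x.
Proof.
case/andP => u0 u1; apply/ler_addgt0Pr => e e0.
have Mp : 0 < M by rewrite (lt_le_trans ltr01).
have eM : 0 < e / (M * M) by rewrite divr_gt0// mulr_gt0.
have [rho rho0 hrho] := Tcont x eM.
pose L := (Num.truncn rho^-1).+1.
have Lr : rho^-1 < L%:R.
  by have := rho0; rewrite -invr_gt0 => /ltW/truncn_itv/andP[].
have Lp : 0 < L%:R :> R by rewrite ltr0n.
have Lp' : L%:R != 0 :> R by rewrite gt_eqF.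
have uL0 : 0 <= u * L%:R by rewrite mulr_ge0.
have /andP[q1 q2] := truncn_itv uL0.
set q := Num.truncn _ in q1 q2.
have qL : (q <= L)%N.
  by rewrite -(ler_nat R); apply: le_trans q1 _; rewrite ler_piMl// ltW.
pose v : R := q%:R / L%:R.
have vu : v <= u by rewrite /v ler_pdivrMr.
have uv : u - v <= rho.
  have : L%:R^-1 < rho by rewrite -[rho]invrK ltf_pV2 ?posrE ?invr_gt0.
  suff : u < v + L%:R^-1 by lra.
  by rewrite /v -[X in _ + X]mul1r -mulrDl natr1 ltr_pdivlMr.
have v0 : 0 <= v by rewrite divr_ge0.
have c0 : 0 <= lipschitz_const * N x.
  by rewrite mulr_ge0 ?(sn_ge0 hN)// lipschitz_const_ge0.
apply: le_trans (sn_triangle hN (T (1 / 6) (T (v / 6) x)) _ _) _.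
rewrite [leLHS]addrC lerD//.
  have L0 : (0 < L)%N by [].
  have H := rational_lipschitz x L0 qL; apply: le_trans H _.
  by rewrite -/v mulrAC [leRHS]mulrAC ler_wpM2l.
have l6 : linear (T (1 / 6)) by apply: linT; rewrite divr_ge0.
have v6 : 0 <= v / 6 by rewrite divr_ge0.
have d6 : 0 <= (u - v) / 6 by rewrite divr_ge0// subr_ge0.
have -> : u / 6 = v / 6 + (u - v) / 6 by ring.
rewrite (TD _ v6 d6) -(linearB_op _ _ l6) -(linearB_op _ _ (linT v6)).
have i6 : 0 <= (1 / 6 : R) <= 1 by apply/andP; split; lra.
have iv : 0 <= v / 6 <= 1 by rewrite v6/=; lra.
have id : 0 <= (u - v) / 6 <= rho by rewrite d6/=; lra.
apply: le_trans (TM _ i6) _; apply: le_trans (ler_wpM2l M0 (TM _ iv)) _.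
rewrite mulrA -[leRHS](@divfK _ (M * M)) ?gt_eqF ?mulr_gt0// mulrC.
by rewrite ler_wpM2r ?mulr_ge0// hrho.
Qed.

End SemigroupEstimate.

(** * Cauchy's estimate for functions with values in a seminormed space *)

Section MidpointSums.
Context {R : realType}.

Lemma nested_intervals (a l : nat -> R) :
  (forall n, 0 <= l n) -> (forall n, a n <= a n.+1) ->
  (forall n, a n.+1 + l n.+1 <= a n + l n) ->
  exists x, forall n, a n <= x <= a n + l n.
Proof.
move=> l0 inca decb.
have inca' n m : (n <= m)%N -> a n <= a m.
  by elim: m => [|m IH]; [rewrite leqn0 => /eqP ->|rewrite leq_eqVlt => /predU1P[->//|/IH/le_trans]; exact].
have decb' n m : (n <= m)%N -> a m + l m <= a n + l n.
  elim: m => [|m IH]; first by rewrite leqn0 => /eqP ->.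
  by rewrite leq_eqVlt => /predU1P[->//|/IH h]; exact: le_trans (decb m) h.
have ub n m : a m <= a n + l n.
  have [nm|mn] := leqP n m.
    by apply: le_trans (decb' _ _ nm); rewrite lerDl.
  by apply: le_trans (inca' _ _ (ltnW mn)) _; rewrite lerDl.
exists (sup (range a)) => n; apply/andP; split.
  apply: ub_le_sup; last by exists n.
  by exists (a 0 + l 0) => _ [m _ <-].
by apply: ge_sup; [exists (a 0), 0%N|move=> _ [m _ <-]].
Qed.

Lemma Re_half (x y : R[i]) :
  complex.Re ((x + y) / 2) = (complex.Re x + complex.Re y) / 2.
Proof.
have -> : (x + y) / 2 = (x + y) * (2^-1)%:C.
  by rewrite fmorphV rmorph_nat.
by case: x => a b; case: y => c d /=; ring.
Qed.

Lemma Im_half (x y : R[i]) :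
  complex.Im ((x + y) / 2) = (complex.Im x + complex.Im y) / 2.
Proof.
have -> : (x + y) / 2 = (x + y) * (2^-1)%:C.
  by rewrite fmorphV rmorph_nat.
by case: x => a b; case: y => c d /=; ring.
Qed.

Section Sums.
Context {V : lmodType R[i]}.
Implicit Types (G : R[i] -> V) (a b z : R[i]).

(* The midpoint rule on [2 ^ m] equal pieces of the segment from a to b. It is
   exactly additive under bisection and exactly odd under reversal. *)
Fixpoint midsum G m a b : V :=
  if m is m'.+1 then midsum G m' a ((a + b) / 2) + midsum G m' ((a + b) / 2) b
  else (b - a) *: G ((a + b) / 2).

Lemma midsum_rev G m a b : midsum G m b a = - midsum G m a b.
Proof.
elim: m a b => [|m IH] a b /=.
  by rewrite [b + a]addrC -scaleNr opprB.
by rewrite [b + a]addrC (IH a) (IH _ b) opprD [LHS]addrC.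
Qed.

Lemma midsumB G G' m a b :
  midsum (fun z => G z - G' z) m a b = midsum G m a b - midsum G' m a b.
Proof.
elim: m a b => [|m IH] a b /=; first by rewrite scalerBr.
by rewrite !IH opprD addrACA.
Qed.

(** The counterclockwise contour sum around the square with lower left corner [z] and side [s]. *)
Definition square_sum G m (z : R[i]) (s : R) : V :=
  midsum G m z (z + s%:C) + midsum G m (z + s%:C) (z + s%:C + s%:C * 'i) +
  midsum G m (z + s%:C + s%:C * 'i) (z + s%:C * 'i) +
  midsum G m (z + s%:C * 'i) z.

Lemma square_sumB G G' m z s :
  square_sum (fun w => G w - G' w) m z s =
    square_sum G m z s - square_sum G' m z s.
Proof.
rewrite /square_sum !midsumB !opprD [RHS]addrACA; congr (_ + _).
by rewrite [RHS]addrACA; congr (_ + _); rewrite [RHS]addrACA.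
Qed.

(** The four inner edges [x], [y], [w], [v] of the subdivided square are each traversed once in
    either direction. *)
Lemma cancel_edges (a1 a2 a3 a4 a5 a6 a7 a8 x y w v : V) :
  (a1 + a2) + (a3 + a4) + (a5 + a6) + (a7 + a8) =
  a1 + x + y + a8 + (a2 + a3 + w - x) + (- y + v + a6 + a7 + (- w + a4 + a5 - v)).
Proof.
rewrite [RHS](AC ((4*4)*(4*4)) ((1*5)*(6*14)*(15*11)*(12*4)*(2*8)*(3*9)*(7*13)*(10*16))).
by rewrite /= !subrr !addr0.
Qed.

(** An exact identity, with no limit: the level [m] drops by one as the edges are halved. *)
Lemma square_sum_split G m z (s : R) :
  square_sum G m.+1 z s =
    square_sum G m z (s / 2) +
    square_sum G m (z + (s / 2)%:C) (s / 2) +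
    (square_sum G m (z + (s / 2)%:C * 'i) (s / 2) +
     square_sum G m (z + (s / 2)%:C + (s / 2)%:C * 'i) (s / 2)).
Proof.
rewrite /square_sum /=.
have s2 : s%:C = (s / 2)%:C + (s / 2)%:C :> R[i] by rewrite -rmorphD /= -splitr.
set h := (s / 2)%:C in s2 *; rewrite s2.
have e1 : (z + (z + (h + h))) / 2 = z + h by field.
have e2 : (z + (h + h) + (z + (h + h) + (h + h) * 'i)) / 2 = z + h + h + h * 'i.
  by field.
have e3 : (z + (h + h) + (h + h) * 'i + (z + (h + h) * 'i)) / 2 =
   z + h + h * 'i + h * 'i by field.
have e4 : (z + (h + h) * 'i + z) / 2 = z + h * 'i by field.
rewrite e1 e2 e3 e4.
have f1 : z + (h + h) = z + h + h by ring.
have f2 : z + (h + h) + (h + h) * 'i = z + h + h * 'i + h + h * 'i by ring.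
have f3 : z + (h + h) * 'i = z + h * 'i + h * 'i by ring.
have f4 : z + h + h + h * 'i = z + h + h * 'i + h by ring.
have f5 : z + h * 'i + h = z + h + h * 'i by ring.
rewrite f2 f3 f1 f4 f5.
rewrite (midsum_rev G m (z + h) (z + h + h * 'i)).
rewrite (midsum_rev G m (z + h + h * 'i) (z + h * 'i)).
rewrite (midsum_rev G m (z + h + h * 'i + h) (z + h + h * 'i)).
rewrite (midsum_rev G m (z + h + h * 'i) (z + h + h * 'i + h * 'i)).
exact: cancel_edges.
Qed.

(** The midpoint rule is exact on affine functions; hence closed contour sums of these vanish at
    every level. *)
Lemma midsum_affine u v m a b :
  midsum (fun z => u + z *: v) m a b =
    (b - a) *: u + ((b - a) * ((a + b) / 2)) *: v.
Proof.
elim: m a b => [|m IH] a b /=; first by rewrite scalerDr scalerA.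
rewrite !IH addrACA -!scalerDl; congr (_ *: _ + _ *: _); by field.
Qed.

Lemma square_sum_affine u v m z s :
  square_sum (fun w => u + w *: v) m z s = 0.
Proof.
rewrite /square_sum !midsum_affine.
have comb (a b c d : R[i]) :
    a *: u + b *: v + (c *: u + d *: v) = (a + c) *: u + (b + d) *: v.
  by rewrite addrACA -!scalerDl.
rewrite !comb.
rewrite [X in X *: u](_ : _ = 0); last by ring.
rewrite [X in X *: v](_ : _ = 0); last by field.
by rewrite !scale0r addr0.
Qed.

Section Bounds.
Context {N : V -> R}.
Hypothesis hN : is_seminorm N.

(** [P] stands for a midpoint-convex set, below an edge of a square, so that [G] has to be
    controlled on that edge only. *)
Lemma midsum_bound (P : R[i] -> Prop) G K m a b :
  (forall x y, P x -> P y -> P ((x + y) / 2)) ->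
  P a -> P b -> (forall z, P z -> N (G z) <= K) ->
  N (midsum G m a b) <= normc (b - a) * K.
Proof.
move=> Pm Pa Pb PK; elim: m a b Pa Pb => [|m IH] a b Pa Pb /=.
  by rewrite (snZ hN) ler_wpM2l ?normc_ge0//; exact/PK/Pm.
have Pc := Pm _ _ Pa Pb.
have e1 : (a + b) / 2 - a = (b - a) / 2 by field.
have e2 : b - (a + b) / 2 = (b - a) / 2 by field.
have := lerD (IH _ _ Pa Pc) (IH _ _ Pc Pb); rewrite e1 e2 => h.
apply: le_trans (snD hN _ _) _; apply: le_trans h _.
rewrite normcM normcV -[2]/(2%:R) normc_nat.
have := normc_ge0 (b - a); move: (normc _) => u u0; lra.
Qed.

Definition in_square z (s : R) (w : R[i]) :=
  complex.Re z <= complex.Re w <= complex.Re z + s /\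
  complex.Im z <= complex.Im w <= complex.Im z + s.

Definition on_boundary z (s : R) (w : R[i]) := in_square z s w /\
  [\/ complex.Re w = complex.Re z, complex.Re w = complex.Re z + s,
      complex.Im w = complex.Im z | complex.Im w = complex.Im z + s].

Lemma square_sum_bound G K m z (s : R) : 0 <= s ->
  (forall w, on_boundary z s w -> N (G w) <= K) ->
  N (square_sum G m z s) <= 4 * s * K.
Proof.
move=> s0 H.
have nR : normc s%:C = s by rewrite normcR ger0_norm.
have nI : normc (s%:C * 'i) = s by rewrite normcM nR normc_i mulr1.
have bd : forall a b, on_boundary z s a -> on_boundary z s b ->
   (complex.Re a = complex.Re b /\
     (complex.Re a = complex.Re z \/ complex.Re a = complex.Re z + s)) \/
   (complex.Im a = complex.Im b /\
     (complex.Im a = complex.Im z \/ complex.Im a = complex.Im z + s)) ->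
   N (midsum G m a b) <= normc (b - a) * K.
  move=> a b [[ra ia] _] [[rb ib] _] [[eab ea]|[eab ea]].
  - apply: (@midsum_bound (fun w => complex.Re w = complex.Re a /\
       complex.Im z <= complex.Im w <= complex.Im z + s)) => //.
    + by move=> x y [x1 x2] [y1 y2]; rewrite Re_half Im_half x1 y1; split; lra.
    + move=> w [w1 w2]; apply: H; split; first by rewrite /in_square w1.
      by case: ea => <-; rewrite w1; [exact: Or41|exact: Or42].
  - apply: (@midsum_bound (fun w => complex.Im w = complex.Im a /\
       complex.Re z <= complex.Re w <= complex.Re z + s)) => //.
    + by move=> x y [x1 x2] [y1 y2]; rewrite Re_half Im_half x1 y1; split; lra.
    + move=> w [w1 w2]; apply: H; split; first by rewrite /in_square w1.
      by case: ea => <-; rewrite w1; [exact: Or43|exact: Or44].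
have c1 : on_boundary z s z by split; [rewrite /in_square; split; lra|exact: Or41].
have c2 : on_boundary z s (z + s%:C).
  by case: (z) => x y; split; [rewrite /in_square /=; split; lra|rewrite /= addr0; exact: Or43].
have c3 : on_boundary z s (z + s%:C + s%:C * 'i).
  by case: (z) => x y; split; [rewrite /in_square /=; split; lra|apply: Or42 => /=; ring].
have c4 : on_boundary z s (z + s%:C * 'i).
  by case: (z) => x y; split; [rewrite /in_square /=; split; lra|apply: Or41 => /=; ring].
have -> : 4 * s * K = s * K + s * K + s * K + s * K by ring.
have d1 : normc (z + s%:C - z) = s by rewrite addrAC subrr add0r.
have d2 : normc (z + s%:C + s%:C * 'i - (z + s%:C)) = s by rewrite addrAC subrr add0r.
have d3 : normc (z + s%:C * 'i - (z + s%:C + s%:C * 'i)) = s.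
  by rewrite -[RHS]nR -[in RHS]normcN; congr normc; ring.
have d4 : normc (z - (z + s%:C * 'i)) = s by rewrite opprD addNKr normcN.
apply: le_trans (snD hN _ _) _; apply: lerD.
apply: le_trans (snD hN _ _) _; apply: lerD.
apply: le_trans (snD hN _ _) _; apply: lerD.
- rewrite -[in leRHS]d1; apply: bd => //; right; case: (z) => x y /=.
  by rewrite addr0; split => //; left.
- rewrite -[in leRHS]d2; apply: bd => //; left; case: (z) => x y /=.
  by split; [ring|right].
- rewrite -[in leRHS]d3; apply: bd => //; right; case: (z) => x y /=.
  by split; [ring|right; ring].
- rewrite -[in leRHS]d4; apply: bd => //; left; case: (z) => x y /=.
  by split; [ring|left; ring].
Qed.

End Bounds.
End Sums.

Lemma square_sum_scaler {V : lmodType R[i]} (k : R[i] -> R[i]) (v : V) m z s :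
  square_sum (fun w => k w *: v) m z s = @square_sum R[i]^o k m z s *: v.
Proof.
have E a b : midsum (fun z => k z *: v) m a b = @midsum R[i]^o k m a b *: v.
  elim: m a b => [|m IH] a b /=; first by rewrite scalerA.
  by rewrite !IH scalerDl.
by rewrite /square_sum !E !scalerDl.
Qed.

End MidpointSums.

(** * Goursat's lemma with one exceptional point *)

Section Goursat.
Context {R : realType} {V : lmodType R[i]} {N : V -> R}.
Hypothesis hN : is_seminorm N.
Implicit Types (G F : R[i] -> V) (w z h : R[i]) (s e : R).

Definition has_cderiv G w (D : V) := forall e, 0 < e ->
  exists2 d : R, 0 < d & forall z, normc (z - w) <= d ->
    N (G z - G w - (z - w) *: D) <= e * normc (z - w).

Lemma in_square_dist z s w w' : in_square z s w -> in_square z s w' ->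
  normc (w' - w) <= 2 * s.
Proof.
case: z w w' => [a b] [c d] [c' d'] zw zw'.
apply: le_trans (normc_le _) _; move: zw zw' => /= [/= h1 h2] [/= h3 h4].
have : `|c' - c| <= s by rewrite ler_norml; apply/andP; split; lra.
have : `|d' - d| <= s by rewrite ler_norml; apply/andP; split; lra.
lra.
Qed.

(** Subtracting the first-order expansion at [w] does not change the contour sum, and the remainder
    is at most [e * (2 * s)] on a boundary of length [4 * s]. *)
Lemma square_sum_local G w D e : 0 < e -> has_cderiv G w D ->
  exists2 d : R, 0 < d & forall z s, 0 <= s -> 2 * s <= d -> in_square z s w ->
    forall m, N (square_sum G m z s) <= 8 * e * s ^+ 2.
Proof.
move=> e0 /(_ e e0)[d d0 hd]; exists d => // z s s0 sd zw m.
pose A w' := G w - w *: D + w' *: D.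
have -> : square_sum G m z s = square_sum (fun w' => G w' - A w') m z s.
  by rewrite square_sumB square_sum_affine subr0.
have -> : 8 * e * s ^+ 2 = 4 * s * (e * (2 * s)) by ring.
apply: (square_sum_bound hN) => // w' [zw' _].
have dist := in_square_dist zw zw'.
have -> : G w' - A w' = G w' - G w - (w' - w) *: D.
  by rewrite /A scalerBl opprB !opprD opprK !addrA.
apply: le_trans (hd _ (le_trans dist sd)) _.
by rewrite ler_wpM2l// ltW.
Qed.

(** The indicators of the two half-open intervals are each exactly additive under bisection, and
    their sum is at least 1 on the closed interval. *)
Definition edge_weight (a s x : R) : R :=
  (a <= x < a + s)%R%:R + (a < x <= a + s)%R%:R.

Lemma edge_weight_split a s x : 0 < s ->
  edge_weight a s x = edge_weight a (s / 2) x + edge_weight (a + s / 2) (s / 2) x.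
Proof.
move=> s0; rewrite /edge_weight.
have -> : a + s / 2 + s / 2 = a + s by rewrite -addrA -splitr.
set m := a + s / 2; have am : a < m by rewrite /m; lra.
have ms : m < a + s by rewrite /m; lra.
clearbody m.
have e1 : (a <= x < a + s)%R%:R = (a <= x < m)%R%:R + (m <= x < a + s)%R%:R :> R.
  have [h1|h1] := leP a x; have [h2|h2] := ltP x (a + s);
  have [h3|h3] := ltP x m; rewrite /= ?addr0 ?add0r //; exfalso; lra.
have e2 : (a < x <= a + s)%R%:R = (a < x <= m)%R%:R + (m < x <= a + s)%R%:R :> R.
  have [h1|h1] := ltP a x; have [h2|h2] := leP x (a + s);
  have [h3|h3] := leP x m; rewrite /= ?addr0 ?add0r //; exfalso; lra.
by rewrite e1 e2 addrACA.
Qed.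

Lemma edge_weight_ge1 a s x : 0 < s -> a <= x <= a + s -> 1 <= edge_weight a s x.
Proof.
move=> s0 /andP[ax xs]; rewrite /edge_weight ax xs /= andbT.
have [h|h] := ltP x (a + s); first by rewrite lerDl.
have -> : a < x by lra.
by rewrite add0r.
Qed.

Lemma edge_weight_ge0 a s x : 0 <= edge_weight a s x.
Proof. by rewrite addr_ge0. Qed.

Lemma edge_weight_le2 a s x : edge_weight a s x <= 2.
Proof.
have : (a <= x < a + s)%R%:R <= 1 :> R by case: (_ && _).
have : (a < x <= a + s)%R%:R <= 1 :> R by case: (_ && _).
rewrite /edge_weight; lra.
Qed.

(* The singular point [h] may lie on the boundary of up to four dyadic squares
   of each generation; [edge_weight] counts them in an exactly additive way. *)
Definition square_weight h z s : R := 8 * s ^+ 2 +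
  edge_weight (complex.Re z) s (complex.Re h) *
  edge_weight (complex.Im z) s (complex.Im h).

Lemma square_weight_split h z s : 0 < s ->
  square_weight h z s =
    square_weight h z (s / 2) + square_weight h (z + (s / 2)%:C) (s / 2) +
    (square_weight h (z + (s / 2)%:C * 'i) (s / 2) +
     square_weight h (z + (s / 2)%:C + (s / 2)%:C * 'i) (s / 2)).
Proof.
move=> s0; rewrite /square_weight.
have -> : complex.Re (z + (s / 2)%:C) = complex.Re z + s / 2 by case: z.
have -> : complex.Im (z + (s / 2)%:C) = complex.Im z.
  by case: z => a b /=; rewrite addr0.
have -> : complex.Re (z + (s / 2)%:C * 'i) = complex.Re z.
  by case: z => a b /=; ring.
have -> : complex.Im (z + (s / 2)%:C * 'i) = complex.Im z + s / 2.
  by case: z => a b /=; ring.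
have -> : complex.Re (z + (s / 2)%:C + (s / 2)%:C * 'i) = complex.Re z + s / 2.
  by case: z => a b /=; ring.
have -> : complex.Im (z + (s / 2)%:C + (s / 2)%:C * 'i) = complex.Im z + s / 2.
  by case: z => a b /=; ring.
rewrite (edge_weight_split _ _ s0) (edge_weight_split (complex.Im z) _ s0).
by field.
Qed.

Section Bisection.
Variables (G : R[i] -> V) (h : R[i]) (e : R).
Hypothesis e0 : 0 < e.

(** The bound is asked only for large [m], because every bisection consumes one level. *)
Definition good z s := exists m0, forall m, (m0 <= m)%N ->
  N (square_sum G m z s) <= e * square_weight h z s.

Lemma good_split z s : 0 < s -> good z (s / 2) -> good (z + (s / 2)%:C) (s / 2) ->
  good (z + (s / 2)%:C * 'i) (s / 2) ->
  good (z + (s / 2)%:C + (s / 2)%:C * 'i) (s / 2) -> good z s.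
Proof.
move=> s0 [m1 h1] [m2 h2] [m3 h3] [m4 h4].
exists (maxn (maxn m1 m2) (maxn m3 m4)).+1 => -[//|m]; rewrite ltnS !geq_max.
move=> /andP[/andP[i1 i2] /andP[i3 i4]].
rewrite square_sum_split (square_weight_split _ _ s0).
rewrite mulrDr [e * (square_weight h z _ + _)]mulrDr [X in _ <= _ + X]mulrDr.
apply: le_trans (snD hN _ _) _; apply: lerD.
  by apply: le_trans (snD hN _ _) _; apply: lerD; [exact: h1|exact: h2].
by apply: le_trans (snD hN _ _) _; apply: lerD; [exact: h3|exact: h4].
Qed.

(** The fourth square needs no test: if the other three are good and the parent is bad, it is
    bad. *)
Definition bad_child z s : R[i] :=
  if ~~ `[< good z (s / 2) >] then z
  else if ~~ `[< good (z + (s / 2)%:C) (s / 2) >] then z + (s / 2)%:C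
  else if ~~ `[< good (z + (s / 2)%:C * 'i) (s / 2) >] then z + (s / 2)%:C * 'i
  else z + (s / 2)%:C + (s / 2)%:C * 'i.

Lemma bad_childP z s : 0 < s -> ~ good z s -> ~ good (bad_child z s) (s / 2).
Proof.
move=> s0; rewrite /bad_child; apply: contra_not.
case: asboolP => //= g1; case: asboolP => //= g2; case: asboolP => //= g3 g4.
exact: good_split s0 g1 g2 g3 g4.
Qed.

Lemma bad_child_Re z s : 0 <= s ->
  complex.Re z <= complex.Re (bad_child z s) /\
  complex.Re (bad_child z s) + s / 2 <= complex.Re z + s.
Proof.
move=> s0; rewrite /bad_child.
by case: ifP => _; [|case: ifP => _; [|case: ifP => _]]; case: z => a b /=;
  split; lra.
Qed.

Lemma bad_child_Im z s : 0 <= s ->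
  complex.Im z <= complex.Im (bad_child z s) /\
  complex.Im (bad_child z s) + s / 2 <= complex.Im z + s.
Proof.
move=> s0; rewrite /bad_child.
by case: ifP => _; [|case: ifP => _; [|case: ifP => _]]; case: z => a b /=;
  split; lra.
Qed.

Variables (z0 : R[i]) (s0 K d : R).
Hypotheses (s00 : 0 < s0) (d0 : 0 < d) (K0 : 0 <= K).
Hypothesis Gd : forall w, in_square z0 s0 w -> w <> h -> exists D, has_cderiv G w D.
Hypothesis Gb : forall w, normc (w - h) <= d -> N (G w) <= K.

(** Nested bad squares shrink to a point. Where [G] is differentiable, [square_sum_local] is matched
    by the area term [8 * s ^+ 2]. At [h], boundedness gives at most [4 * s * K], eventually below
    [e], while the edge weights contribute at least 1. *)
Lemma all_good : good z0 s0.
Proof.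
apply: contrapT => bad0.
pose sn n : R := s0 / 2 ^+ n.
pose fix zn n := if n is n'.+1 then bad_child (zn n') (sn n') else z0.
have snS n : sn n.+1 = sn n / 2 by rewrite /sn exprS invfM; field; rewrite expf_neq0.
have sn0 n : 0 < sn n by rewrite /sn divr_gt0// exprn_gt0.
have badn n : ~ good (zn n) (sn n).
  elim: n => [|n IH]; first by rewrite /sn expr0 divr1.
  by rewrite snS /=; exact: bad_childP.
have decRe n : complex.Re (zn n.+1) + sn n.+1 <= complex.Re (zn n) + sn n.
  by rewrite snS; exact: (bad_child_Re (zn n) (ltW (sn0 n))).2.
have decIm n : complex.Im (zn n.+1) + sn n.+1 <= complex.Im (zn n) + sn n.
  by rewrite snS; exact: (bad_child_Im (zn n) (ltW (sn0 n))).2.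
have [x hx] := @nested_intervals R (fun n => complex.Re (zn n)) sn
  (fun n => ltW (sn0 n)) (fun n => (bad_child_Re (zn n) (ltW (sn0 n))).1)
  decRe.
have [y hy] := @nested_intervals R (fun n => complex.Im (zn n)) sn
  (fun n => ltW (sn0 n)) (fun n => (bad_child_Im (zn n) (ltW (sn0 n))).1)
  decIm.
pose w : R[i] := x +i* y.
have w_in : in_square z0 s0 w by have := conj (hx 0%N) (hy 0%N); rewrite /sn expr0 divr1.
have hw n : in_square (zn n) (sn n) w by split; [exact: hx|exact: hy].
have small c : 0 < c -> exists n, sn n <= c.
  move=> c0; have /andP[_ hk] := truncn_itv (ltW (divr_gt0 s00 c0)).
  set k := (Num.truncn _).+1 in hk; exists k.
  rewrite /sn ler_pdivrMr ?exprn_gt0// mulrC -ler_pdivrMr//.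
  by apply: le_trans (ltW hk) _; rewrite -natrX ler_nat ltnW// ltn_expl.
have [wh|wh] := pselect (w = h).
  have c0 : 0 < Num.min (d / 2) (e / (4 * K + 1)).
    by rewrite lt_min !divr_gt0// ltr_wpDl// mulr_ge0.
  have [n] := small _ c0; rewrite le_min => /andP[n1 n2].
  apply: (badn n); exists 0%N => m _.
  have s_ge0 := ltW (sn0 n).
  apply: le_trans (square_sum_bound hN m s_ge0 (K := K) _) _.
    move=> w' [hw' _]; apply: Gb; rewrite -wh.
    by apply: le_trans (in_square_dist (hw n) hw') _; lra.
  have : sn n * (4 * K + 1) <= e by rewrite -ler_pdivlMr// ltr_wpDl// mulr_ge0.
  move=> h1; apply: le_trans (_ : e <= _); first lra.
  apply: ler_peMr (ltW e0) _; rewrite /square_weight.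
  have [] := hw n; rewrite wh => hr hi.
  have w1 := edge_weight_ge1 (sn0 n) hr; have w2 := edge_weight_ge1 (sn0 n) hi.
  by apply: le_trans (mulr_ege1 w1 w2) _; rewrite lerDr mulr_ge0// sqr_ge0.
have [D hD] := Gd w_in wh.
have [c c0 hc] := square_sum_local e0 hD.
have c20 : 0 < c / 2 by rewrite divr_gt0.
have [n hn] := small _ c20.
apply: (badn n); exists 0%N => m _.
apply: le_trans (hc _ _ (ltW (sn0 n)) _ (hw n) m) _; first lra.
rewrite -mulrA mulrCA ler_wpM2l ?(ltW e0)// /square_weight lerDl.
by rewrite mulr_ge0// edge_weight_ge0.
Qed.

End Bisection.

Lemma goursat G h z0 s0 K d : 0 < s0 -> 0 < d -> 0 <= K ->
  (forall w, in_square z0 s0 w -> w <> h -> exists D, has_cderiv G w D) ->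
  (forall w, normc (w - h) <= d -> N (G w) <= K) ->
  forall e, 0 < e -> exists m0, forall m, (m0 <= m)%N ->
    N (square_sum G m z0 s0) <= e.
Proof.
move=> s00 d0 K0 Gd Gb e e0.
pose c := 8 * s0 ^+ 2 + 4.
have c0 : 0 < c by rewrite ltr_wpDl// mulr_ge0// sqr_ge0.
have ec : 0 < e / c by rewrite divr_gt0.
have [m0 hm] := all_good ec s00 d0 K0 Gd Gb.
exists m0 => m /hm h1; apply: le_trans h1 _.
rewrite -[leRHS](@divfK _ c) ?gt_eqF// ler_wpM2l ?(ltW ec)//.
rewrite /square_weight /c lerD2l.
have -> : 4 = 2 * 2 :> R by ring.
by apply: ler_pM; rewrite ?edge_weight_ge0 ?edge_weight_le2.
Qed.

(** The quotient rule for [(F z - F h) / (z - h)] at [w] with explicit remainder: [t = z - w],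
    [u = w - h], [H = F w - F h], and [E] is the first-order remainder of [F]. *)
Lemma quotient_remainder (E D H : V) (t u : R[i]) : t + u != 0 -> u != 0 ->
  (t + u)^-1 *: (E + t *: D + H) - u^-1 *: H -
    t *: (u^-1 *: D - u^-1 ^+ 2 *: H) =
  (t + u)^-1 *: E + ((t ^+ 2 / ((t + u) * u ^+ 2)) *: H -
    (t ^+ 2 / ((t + u) * u)) *: D).
Proof.
move=> v0 u0.
have -> : t ^+ 2 / ((t + u) * u ^+ 2) = (t + u)^-1 - u^-1 + t * u^-1 ^+ 2.
  by field; rewrite u0 v0.
have -> : t ^+ 2 / ((t + u) * u) = t * u^-1 - (t + u)^-1 * t.
  by field; rewrite u0 v0.
have shuffle (p q r k l : V) : p + (q + (r + (l + k))) = q + (r + (l + (p + k))).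
  by rewrite !addrA (ACl (2*3*4*1*5)).
rewrite scalerBr opprB !scalerDl !scaleNr opprB !scalerDr !scalerA.
by rewrite -!addrA; congr (_ + _); rewrite shuffle.
Qed.

Lemma has_cderiv_quotient F w D h : w <> h -> has_cderiv F w D ->
  exists D', has_cderiv (fun z => (z - h)^-1 *: (F z - F h)) w D'.
Proof.
move=> wh hD.
have u0 : w - h != 0 by rewrite subr_eq0; apply/eqP.
set u := w - h in u0; set H := F w - F h.
have nu : 0 < normc u by rewrite normc_gt0.
exists (u^-1 *: D - u^-1 ^+ 2 *: H) => e e0.
pose e1 := e * normc u / 4.
have e10 : 0 < e1 by rewrite divr_gt0// mulr_gt0.
have [d1 d10 hd1] := hD _ e10.
pose B := 2 / normc u ^+ 3 * N H + 2 / normc u ^+ 2 * N D.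
have B0 : 0 <= B.
  by rewrite addr_ge0// mulr_ge0 ?(sn_ge0 hN)// divr_ge0// exprn_ge0// ltW.
(* The three terms control [E], keep [t + u] at least [normc u / 2] away from 0, and make the part
   quadratic in [t] at most [e / 2 * normc t]. *)
pose d := Num.min d1 (Num.min (normc u / 2) (e / 2 / (B + 1))).
have d0 : 0 < d by rewrite !lt_min d10 !divr_gt0// ltr_wpDl.
exists d => // z; rewrite !le_min => /andP[zd1 /andP[zu ze]].
set t := z - w in zd1 zu ze *.
have zt : z - h = t + u by rewrite /t /u addrA subrK.
have nv : normc u / 2 <= normc (t + u).
  have := ler_normcBl u (- t); rewrite opprK normcN [u + t]addrC; lra.
have v0 : t + u != 0 by rewrite -normc_gt0; lra.
pose E := F z - F w - t *: D.
have EB : N E <= e1 * normc t by exact: hd1.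
have key : (z - h)^-1 *: (F z - F h) - u^-1 *: H - t *: (u^-1 *: D - u^-1 ^+ 2 *: H)
   = (t + u)^-1 *: E + ((t ^+ 2 / ((t + u) * u ^+ 2)) *: H - (t ^+ 2 / ((t + u) * u)) *: D).
  have -> : F z - F h = E + t *: D + H by rewrite /E /H subrK addrA subrK.
  by rewrite zt; exact: quotient_remainder.
rewrite key.
have iv : normc (t + u)^-1 <= 2 / normc u.
  rewrite normcV -[2 / _]invrK invf_div lef_pV2// ?posrE ?normc_gt0//.
  by rewrite divr_gt0.
have n1 : N ((t + u)^-1 *: E) <= e / 2 * normc t.
  rewrite (snZ hN).
  apply: le_trans (ler_pM (normc_ge0 _) (sn_ge0 hN _) iv EB) _.
  rewrite /e1; apply: le_of_eq.
  by field; rewrite gt_eqF.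
have n2 : N ((t ^+ 2 / ((t + u) * u ^+ 2)) *: H - (t ^+ 2 / ((t + u) * u)) *: D)
    <= normc t ^+ 2 * B.
  have a1 : normc (t ^+ 2 / ((t + u) * u ^+ 2)) <= normc t ^+ 2 * (2 / normc u ^+ 3).
    rewrite normcM normcX ler_wpM2l ?sqr_ge0// invfM normcM.
    apply: le_trans (ler_wpM2r (normc_ge0 _) iv) _.
    rewrite normcV normcX; apply: le_of_eq.
    by field; rewrite gt_eqF.
  have a2 : normc (t ^+ 2 / ((t + u) * u)) <= normc t ^+ 2 * (2 / normc u ^+ 2).
    rewrite normcM normcX ler_wpM2l ?sqr_ge0// invfM normcM.
    apply: le_trans (ler_wpM2r (normc_ge0 _) iv) _.
    rewrite normcV; apply: le_of_eq.
    by field; rewrite gt_eqF.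
  apply: le_trans (snB hN _ _) _; rewrite !(snZ hN).
  apply: le_trans (lerD (ler_wpM2r (sn_ge0 hN H) a1) (ler_wpM2r (sn_ge0 hN D) a2)) _.
  by rewrite /B; apply: le_of_eq; ring.
apply: le_trans (snD hN _ _) _.
have tB : normc t * B <= e / 2.
  have : normc t * (B + 1) <= e / 2 by rewrite -ler_pdivlMr// ltr_wpDl.
  have := normc_ge0 t; lra.
have := ler_wpM2r (normc_ge0 t) tB.
move: n1 n2; rewrite expr2; lra.
Qed.

End Goursat.

(** * Cauchy's estimate from contour sums *)

Section LipschitzEstimate.
Context {R : realType}.

Lemma midsum_Im_ge (P : R[i] -> Prop) (k : R[i] -> R[i]) (c : R) m a b :
  (forall x y, P x -> P y -> P ((x + y) / 2)) -> P a -> P b ->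
  (forall z, P z -> c <= complex.Im ((b - a) * k z)) ->
  c <= complex.Im (@midsum R R[i]^o k m a b).
Proof.
move=> Pm Pa Pb; elim: m a b c Pa Pb => [|m IH] a b c Pa Pb Pk /=.
  by apply: Pk; exact: Pm.
have Pc := Pm _ _ Pa Pb.
have ImD (x y : R[i]) : complex.Im (x + y) = complex.Im x + complex.Im y.
  by case: x y => [? ?] [? ?].
have h1 : c / 2 <= complex.Im (@midsum R R[i]^o k m a ((a + b) / 2)).
  apply: IH => // z /Pk; have -> : ((a + b) / 2 - a) * k z = ((b - a) * k z + 0) / 2 by field.
  by rewrite Im_half [complex.Im 0]/= addr0; lra.
have h2 : c / 2 <= complex.Im (@midsum R R[i]^o k m ((a + b) / 2) b).
  apply: IH => // z /Pk; have -> : (b - (a + b) / 2) * k z = ((b - a) * k z + 0) / 2 by field.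
  by rewrite Im_half [complex.Im 0]/= addr0; lra.
by rewrite ImD; lra.
Qed.

(** The lower left corner of the square of side [2 * c] centred at 0. *)
Definition centered (c : R) : R[i] := (- c) +i* (- c).

Lemma Im_mulrV (a x y : R) :
  complex.Im (a%:C * (x +i* y)^-1) = a * (- y / (x ^+ 2 + y ^+ 2)).
Proof. by rewrite /=; ring. Qed.

Lemma Im_muliV (a x y : R) :
  complex.Im (a%:C * 'i * (x +i* y)^-1) = a * (x / (x ^+ 2 + y ^+ 2)).
Proof. by rewrite /=; ring. Qed.

(** A lower bound takes the place of the value [2 pi i] of the contour integral of [1 / z]: on each
    of the four sides the imaginary part of [(b - a) / z] is at least 1. *)
Lemma square_sum_inv c m : 0 < c ->
  4 <= normc (@square_sum R R[i]^o (fun z => z^-1) m (centered c) (2 * c)).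
Proof.
move=> c0.
have c2 : 0 < c ^+ 2 by rewrite exprn_gt0.
apply: le_trans (_ : complex.Im _ <= _); last first.
  by apply: le_trans (normr_Im _); exact: ler_norm.
have ImD (x y : R[i]) : complex.Im (x + y) = complex.Im x + complex.Im y.
  by case: x y => [? ?] [? ?].
rewrite /square_sum !ImD.
have sq (x : R) : - c <= x <= c -> 1 <= 2 * c * c / (x ^+ 2 + c ^+ 2).
  move=> /andP[x1 x2]; have x0 : 0 <= x ^+ 2 := sqr_ge0 x.
  have xc : x ^+ 2 <= c ^+ 2.
    by rewrite -subr_ge0 subr_sqr mulr_ge0//; lra.
  rewrite ler_pdivlMr ?mul1r; last lra.
  by rewrite -mulrA -expr2; lra.
set p1 := centered c.
have e2 : p1 + (2 * c)%:C = c +i* (- c) by rewrite /p1 /centered; apply: eq_complexP => /=; ring.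
have e3 : p1 + (2 * c)%:C + (2 * c)%:C * 'i = c +i* c.
  by rewrite e2; apply: eq_complexP => /=; ring.
have e4 : p1 + (2 * c)%:C * 'i = (- c) +i* c.
  by rewrite /p1 /centered; apply: eq_complexP => /=; ring.
rewrite e3 e2 e4.
have b1 : 1 <= complex.Im (@midsum R R[i]^o (fun z => z^-1) m p1 (c +i* (- c))).
  apply: (@midsum_Im_ge (fun w => complex.Im w = - c /\ - c <= complex.Re w <= c)).
  - by move=> x y [x1 x2] [y1 y2]; rewrite Re_half Im_half x1 y1; split; lra.
  - by split=> //=; lra.
  - by split=> //=; lra.
  - move=> [x y] [e hx]; have {}e : y = - c := e; have {}hx : - c <= x <= c := hx.
    rewrite e; apply: le_trans (sq _ hx) _.
    rewrite (_ : _ - _ = (2 * c)%:C) ?Im_mulrV; last first.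
      by rewrite /p1 /centered; apply: eq_complexP => /=; ring.
    rewrite sqrrN; apply: le_of_eq; ring.
have b2 : 1 <= complex.Im (@midsum R R[i]^o (fun z => z^-1) m (c +i* (- c)) (c +i* c)).
  apply: (@midsum_Im_ge (fun w => complex.Re w = c /\ - c <= complex.Im w <= c)).
  - by move=> x y [x1 x2] [y1 y2]; rewrite Re_half Im_half x1 y1; split; lra.
  - by split=> //=; lra.
  - by split=> //=; lra.
  - move=> [x y] [e hx]; have {}e : x = c := e; have {}hx : - c <= y <= c := hx.
    rewrite e; apply: le_trans (sq _ hx) _.
    rewrite (_ : _ - _ = (2 * c)%:C * 'i) ?Im_muliV; last first.
      by rewrite /p1 /centered; apply: eq_complexP => /=; ring.
    rewrite [_ ^+ 2 + c ^+ 2]addrC; apply: le_of_eq; ring.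
have b3 : 1 <= complex.Im (@midsum R R[i]^o (fun z => z^-1) m (c +i* c) ((- c) +i* c)).
  apply: (@midsum_Im_ge (fun w => complex.Im w = c /\ - c <= complex.Re w <= c)).
  - by move=> x y [x1 x2] [y1 y2]; rewrite Re_half Im_half x1 y1; split; lra.
  - by split=> //=; lra.
  - by split=> //=; lra.
  - move=> [x y] [e hx]; have {}e : y = c := e; have {}hx : - c <= x <= c := hx.
    rewrite e; apply: le_trans (sq _ hx) _.
    rewrite (_ : _ - _ = (- (2 * c))%:C) ?Im_mulrV; last first.
      by rewrite /p1 /centered; apply: eq_complexP => /=; ring.
    by apply: le_of_eq; ring.
have b4 : 1 <= complex.Im (@midsum R R[i]^o (fun z => z^-1) m ((- c) +i* c) p1).
  apply: (@midsum_Im_ge (fun w => complex.Re w = - c /\ - c <= complex.Im w <= c)).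
  - by move=> x y [x1 x2] [y1 y2]; rewrite Re_half Im_half x1 y1; split; lra.
  - by split=> //=; lra.
  - by split=> //=; lra.
  - move=> [x y] [e hx]; have {}e : x = - c := e; have {}hx : - c <= y <= c := hx.
    rewrite e; apply: le_trans (sq _ hx) _.
    rewrite (_ : _ - _ = (- (2 * c))%:C * 'i) ?Im_muliV; last first.
      by rewrite /p1 /centered; apply: eq_complexP => /=; ring.
    rewrite sqrrN [_ ^+ 2 + c ^+ 2]addrC; apply: le_of_eq; ring.
lra.
Qed.

Lemma normc_boundary c w : 0 < c -> on_boundary (centered c) (2 * c) w ->
  c <= normc w.
Proof.
move=> c0 [_]; rewrite /centered /= (_ : - c + 2 * c = c); last by ring.
by case=> h; [apply: le_trans (normr_Re w)|apply: le_trans (normr_Re w)|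
  apply: le_trans (normr_Im w)|apply: le_trans (normr_Im w)];
  rewrite h ?normrN ger0_norm// ltW.
Qed.

Lemma normc_seminorm : @is_seminorm R R[i]^o (@normc R).
Proof. by split; [exact: normcD|exact: normcM]. Qed.

Context {V : lmodType R[i]} {N : V -> R}.
Hypothesis hN : is_seminorm N.

(** Goursat's lemma for [(F z - F u) / (z - u)], with [u = h] and [u = 0], says that the contour sum
    [S u] of [F z / (z - u)] is nearly [J u *: F u], where [J u] is that of [1 / (z - u)]. Both
    [J 0 - J h] and [S h - S 0] have size [16 * normc h / c], the latter up to the factor [A], and
    [J 0] is at least 4 in modulus; hence [8 = (16 + 16) / 4]. *)
Lemma cauchy_lipschitz (F : R[i] -> V) (c A : R) (h : R[i]) : 0 < c ->
  (forall w, in_square (centered c) (2 * c) w ->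
     exists D, has_cderiv (N := N) F w D) ->
  (forall w, in_square (centered c) (2 * c) w -> N (F w) <= A) ->
  normc h <= c / 2 -> N (F h - F 0) <= 8 * normc h * A / c.
Proof.
move=> c0 FD FA hc.
have c20 : 0 < 2 * c by rewrite mulr_gt0.
have in_sq w : normc w <= c -> in_square (centered c) (2 * c) w.
  move=> wc; have := le_trans (normr_Re w) wc; have := le_trans (normr_Im w) wc.
  rewrite !ler_norml => /andP[h1 h2] /andP[h3 h4].
  by rewrite /in_square /=; split; lra.
have hin : in_square (centered c) (2 * c) h by apply: in_sq; lra.
have oin : in_square (centered c) (2 * c) 0 by apply: in_sq; rewrite normc0; lra.
have A0 : 0 <= A := le_trans (sn_ge0 hN _) (FA _ oin).
pose Gh u z := (z - u)^-1 *: (F z - F u).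
have vanish u : in_square (centered c) (2 * c) u -> forall e, 0 < e ->
    exists m0, forall m, (m0 <= m)%N ->
      N (square_sum (Gh u) m (centered c) (2 * c)) <= e.
  move=> uin; have [D hD] := FD _ uin.
  have [d d0 hd] := hD 1 ltr01.
  apply: (goursat hN (h := u) (K := 1 + N D) (d := d)) => //.
  - by rewrite addr_ge0// sn_ge0.
  - move=> w win wu; have [D' hD'] := FD _ win.
    have [D2 hD2] := has_cderiv_quotient hN wu hD'; by exists D2.
  - move=> w /hd; rewrite mul1r => hw.
    have [->|wu] := eqVneq w u.
      by rewrite /Gh !subrr scaler0 (sn0 hN) addr_ge0// sn_ge0.
    have nw : 0 < normc (w - u) by rewrite normc_gt0 subr_eq0.
    rewrite (snZ hN) normcV mulrC ler_pdivrMr//.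
    apply: le_trans (snBl hN _ ((w - u) *: D)) _.
    rewrite (snZ hN) mulrDl mul1r [N D * _]mulrC; exact: lerD.
rewrite ler_pdivlMr// -[leLHS]mul1r; apply/ler_addgt0Pr => e e0.
have e80 : 0 < 2 * e / c by rewrite divr_gt0// mulr_gt0.
have [m1 hm1] := vanish h hin _ e80; have [m2 hm2] := vanish 0 oin _ e80.
pose m := maxn m1 m2.
have {}hm1 := hm1 m (leq_maxl _ _); have {}hm2 := hm2 m (leq_maxr _ _).
pose k u (z : R[i]) := (z - u)^-1.
pose J u := @square_sum R R[i]^o (k u) m (centered c) (2 * c).
pose S u := square_sum (fun z => k u z *: F z) m (centered c) (2 * c).
have ES u : square_sum (Gh u) m (centered c) (2 * c) = S u - J u *: F u.
  rewrite /S /J -square_sum_scaler -square_sumB; congr square_sum.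
  by apply/funext => z; rewrite /Gh scalerBr.
have J0 : 4 <= normc (J 0).
  rewrite /J; have -> : k 0 = fun z => z^-1 by apply/funext => z; rewrite /k subr0.
  exact: square_sum_inv.
have kb w : on_boundary (centered c) (2 * c) w ->
    normc (k h w - k 0 w) <= 2 * normc h / c ^+ 2.
  move=> wb; have wc := normc_boundary c0 wb.
  have whc : c / 2 <= normc (w - h) by have := ler_normcBl w h; lra.
  have w0 : w != 0 by rewrite -normc_gt0; lra.
  have wh0 : w - h != 0 by rewrite -normc_gt0; lra.
  have -> : k h w - k 0 w = h * (w^-1 * (w - h)^-1).
    by rewrite /k subr0; field; rewrite w0 wh0.
  rewrite !normcM !normcV [2 * _]mulrC -mulrA ler_wpM2l ?normc_ge0//.
  have -> : 2 / c ^+ 2 = c^-1 * (c / 2)^-1 by field; rewrite gt_eqF.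
  by apply: ler_pM; rewrite ?invr_ge0 ?normc_ge0// lef_pV2// posrE; lra.
have Jb : normc (J 0 - J h) <= 16 * normc h / c.
  rewrite normcB /J -square_sumB.
  have := square_sum_bound normc_seminorm m (ltW c20) kb.
  move/le_trans; apply; apply: le_of_eq.
  by field; rewrite gt_eqF.
have Sb : N (S h - S 0) <= 16 * normc h * A / c.
  rewrite /S -square_sumB.
  apply: le_trans (square_sum_bound hN m (ltW c20) (K := 2 * normc h / c ^+ 2 * A) _) _.
    move=> w wb; rewrite -scalerBl (snZ hN); apply: ler_pM; rewrite ?normc_ge0 ?sn_ge0//.
      exact: kb.
    by apply: FA; case: wb.
  apply: le_of_eq.
  by field; rewrite gt_eqF.
have key : J 0 *: (F h - F 0) = (J 0 - J h) *: F h + ((S h - S 0) -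
   ((S h - J h *: F h) - (S 0 - J 0 *: F 0))).
  rewrite scalerBr scalerBl; move: (S h) (S 0) (J h *: _) (J 0 *: F 0) (_ *: _).
  move=> s1 s2 a b c'; rewrite !opprB !addrA.
  by rewrite [RHS](ACl (1*6*(3*8)*(2*7)*(4*5))) /= subrr !addNr !addr0.
have : normc (J 0) * N (F h - F 0) <=
    16 * normc h / c * A + (16 * normc h * A / c + (2 * e / c + 2 * e / c)).
  rewrite -(snZ hN) key; apply: le_trans (snD hN _ _) _; apply: lerD.
    by rewrite (snZ hN); apply: ler_pM; rewrite ?normc_ge0 ?sn_ge0// FA.
  apply: le_trans (snB hN _ _) _; apply: lerD => //.
  by rewrite -!ES; apply: le_trans (snB hN _ _) _; apply: lerD.
have := ler_wpM2r (sn_ge0 hN (F h - F 0)) J0.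
have -> : 16 * normc h / c * A + (16 * normc h * A / c + (2 * e / c + 2 * e / c)) =
   4 * (8 * normc h * A + e) / c by field; rewrite gt_eqF.
move=> h1 h2; have := le_trans h1 h2; rewrite ler_pdivlMr//; lra.
Qed.

End LipschitzEstimate.

(** * The Rademacher norm *)

Section PowerMean.
Context {R : realType} {I : finType}.
Variable p : R.
Hypothesis p1 : 1 <= p.
Hypothesis I0 : (0 < #|I|)%N.
Implicit Types (a b : I -> R) (c : R).

Definition pmean a : R := (#|I|%:R^-1 * \sum_i a i `^ p) `^ p^-1.

Let p0 : 0 < p. Proof. exact: lt_le_trans p1. Qed.

Let cI : 0 < #|I|%:R :> R. Proof. by rewrite ltr0n. Qed.

Let pm_ge0 a : 0 <= #|I|%:R^-1 * \sum_i a i `^ p.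
Proof. by rewrite mulr_ge0 ?invr_ge0 ?ler0n// sumr_ge0// => i _; exact: powR_ge0. Qed.

Lemma pmean_ge0 a : 0 <= pmean a.
Proof. exact: powR_ge0. Qed.

Lemma pmean_le a c : 0 <= c ->
  (pmean a <= c) = (#|I|%:R^-1 * \sum_i a i `^ p <= c `^ p).
Proof.
move=> c0; apply/idP/idP => h.
  have := ge0_ler_powR (ltW p0) (pmean_ge0 a : _ \is Num.nneg) (c0 : _ \is Num.nneg) h.
  by rewrite /pmean -powRrM mulVf ?gt_eqF// powRr1.
have pV0 : 0 <= p^-1 by rewrite invr_ge0 ltW.
have := ge0_ler_powR pV0 (pm_ge0 a : _ \is Num.nneg) (powR_ge0 c p : _ \is Num.nneg) h.
by rewrite -powRrM mulfV ?gt_eqF// powRr1.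
Qed.

Lemma pmean_mono a b : (forall i, 0 <= a i <= b i) -> pmean a <= pmean b.
Proof.
move=> ab; rewrite pmean_le ?pmean_ge0// /pmean -powRrM mulVf ?gt_eqF// powRr1//.
rewrite ler_wpM2l ?invr_ge0 ?ler0n//; apply: ler_sum => i _.
have /andP[a0 le] := ab i.
by apply: (ge0_ler_powR (ltW p0)) => //; rewrite nnegrE // (le_trans a0).
Qed.

Lemma pmean_cst c : 0 <= c -> pmean (fun=> c) = c.
Proof.
move=> c0; rewrite /pmean sumr_const -[X in _ * X]mulr_natl mulrA mulVf ?gt_eqF//.
by rewrite mul1r -powRrM mulfV ?gt_eqF// powRr1.
Qed.

Lemma pmeanZ c a : 0 <= c -> (forall i, 0 <= a i) ->
  pmean (fun i => c * a i) = c * pmean a.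
Proof.
move=> c0 a0; rewrite /pmean.
under eq_bigr => i _ do rewrite powRM//.
rewrite -mulr_sumr mulrCA powRM ?powR_ge0// -powRrM mulfV ?gt_eqF//.
by rewrite powRr1.
Qed.

Lemma convex_powR_ineq (t x y : R) : 0 <= t <= 1 -> 0 <= x -> 0 <= y ->
  (t * x + (1 - t) * y) `^ p <= t * x `^ p + (1 - t) * y `^ p.
Proof.
move=> /andP[t0 t1] x0 y0.
by apply: (convex_powR p1 (Itv01 t0 t1)); rewrite inE /= in_itv /= andbT.
Qed.

(** Minkowski's inequality from the convexity of the power function: [a + b] is [(u + v)] times the
    convex combination of [a / u] and [b / v] with weight [u / (u + v)]. Positive upper bounds [u],
    [v] of the means cover the case of vanishing means. *)
Lemma pmeanD a b : (forall i, 0 <= a i) -> (forall i, 0 <= b i) ->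
  pmean (fun i => a i + b i) <= pmean a + pmean b.
Proof.
move=> a0 b0.
suff main (u v : R) : 0 < u -> 0 < v -> pmean a <= u -> pmean b <= v ->
    pmean (fun i => a i + b i) <= u + v.
  apply/ler_addgt0Pr => e e0; have e2 : 0 < e / 2 by rewrite divr_gt0.
  have h1 := pmean_ge0 a; have h2 := pmean_ge0 b.
  have l1 : pmean a <= pmean a + e / 2 by rewrite lerDl ltW.
  have l2 : pmean b <= pmean b + e / 2 by rewrite lerDl ltW.
  apply: le_trans (main _ _ (ltr_wpDl h1 e2) (ltr_wpDl h2 e2) l1 l2) _.
  by rewrite addrACA -splitr.
move=> u0 v0 au bv; have uv0 : 0 < u + v by rewrite addr_gt0.
rewrite pmean_le; last exact: ltW.
rewrite pmean_le in au; last exact: ltW.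
rewrite pmean_le in bv; last exact: ltW.
pose t := u / (u + v).
have t0 : 0 <= t by rewrite divr_ge0 ?ltW.
have t1 : t <= 1 by rewrite ler_pdivrMr// mul1r lerDl ltW.
have et : 1 - t = v / (u + v) by rewrite /t; field; rewrite gt_eqF.
have up : 0 < u `^ p by exact: powR_gt0.
have vp : 0 < v `^ p by exact: powR_gt0.
have un : u != 0 by rewrite gt_eqF.
have vn : v != 0 by rewrite gt_eqF.
have step i : (a i + b i) `^ p <=
    (u + v) `^ p * (t * (a i `^ p / u `^ p) + (1 - t) * (b i `^ p / v `^ p)).
  have -> : a i + b i = (u + v) * (t * (a i / u) + (1 - t) * (b i / v)).
    by rewrite et /t; field; rewrite !gt_eqF.
  have ai : 0 <= a i / u by rewrite divr_ge0// ltW.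
  have bi : 0 <= b i / v by rewrite divr_ge0// ltW.
  rewrite powRM ?(ltW uv0)//; last first.
    by rewrite addr_ge0// mulr_ge0// subr_ge0.
  rewrite ler_wpM2l ?powR_ge0//.
  have h := @convex_powR_ineq t (a i / u) (b i / v).
  have e1 : (a i / u) `^ p = a i `^ p / u `^ p.
    by rewrite -[in RHS](divfK un (a i)) [in RHS]powRM ?(ltW u0)// mulfK ?gt_eqF.
  have e2 : (b i / v) `^ p = b i `^ p / v `^ p.
    by rewrite -[in RHS](divfK vn (b i)) [in RHS]powRM ?(ltW v0)// mulfK ?gt_eqF.
  by rewrite -e1 -e2; apply: h => //; rewrite t0 t1.
apply: le_trans (_ : (u + v) `^ p * (t * ((#|I|%:R^-1 * \sum_i a i `^ p) / u `^ p) +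
   (1 - t) * ((#|I|%:R^-1 * \sum_i b i `^ p) / v `^ p)) <= _).
  have -> : (u + v) `^ p * (t * ((#|I|%:R^-1 * \sum_i a i `^ p) / u `^ p) +
     (1 - t) * ((#|I|%:R^-1 * \sum_i b i `^ p) / v `^ p)) =
     #|I|%:R^-1 * \sum_i ((u + v) `^ p * (t * (a i `^ p / u `^ p) + (1 - t) * (b i `^ p / v `^ p))).
    rewrite -mulr_sumr big_split /= -!mulr_sumr -!mulr_suml; ring.
  by rewrite ler_wpM2l ?invr_ge0 ?ler0n//; apply: ler_sum => i _; exact: step.
rewrite ler_piMr ?powR_ge0//.
have h1 : (#|I|%:R^-1 * \sum_i a i `^ p) / u `^ p <= 1 by rewrite ler_pdivrMr// mul1r.
have h2 : (#|I|%:R^-1 * \sum_i b i `^ p) / v `^ p <= 1 by rewrite ler_pdivrMr// mul1r.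
have := ler_wpM2l t0 h1.
have t1' : 0 <= 1 - t by rewrite subr_ge0.
have := ler_wpM2l t1' h2; lra.
Qed.

Lemma pmean_reindex (s : I -> I) a : involutive s -> pmean (a \o s) = pmean a.
Proof.
move=> sK; rewrite /pmean; congr ((_ * _) `^ _).
by rewrite [RHS](reindex_inj (inv_inj sK)).
Qed.

End PowerMean.

Section StepIntegral.
Context {R : realType}.
Local Notation mu := (@lebesgue_measure R).

(** Values at the breakpoints are left free, since Rademacher sums may take other values there; they
    form a null set. *)
Lemma step_integral (f : R -> R) (c : nat -> R) (h : R) M : 0 < h ->
  (forall t, 0 <= f t) ->
  (forall m t, (m < M)%N -> m%:R * h < t < m.+1%:R * h -> f t = c m) ->
  measurable_fun (`]0%R, (M%:R * h)] : set R) f /\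
  (\int[mu]_(t in `]0%R, (M%:R * h)%R]) (f t)%:E)%E = (\sum_(m < M) c m * h)%:E.
Proof.
move=> h0 f0; elim: M => [|M IH] fc.
  rewrite mul0r set_itvoc0; split; first exact: measurable_fun_set0.
  by rewrite integral_set0 big_ord0.
have [m t mM ht|IHm IHi] := IH; first by apply: fc => //; exact: ltnW.
have Mh : M%:R * h < M.+1%:R * h by rewrite ltr_pM2r// ltr_nat.
have Mh0 : 0 <= M%:R * h by rewrite mulr_ge0// ltW.
have eqf : {in (`](M%:R * h), (M.+1%:R * h)[%classic : set R), cst (c M) =1 f}.
  by move=> t; rewrite inE /= in_itv /= => ht; rewrite (fc M).
have mo : measurable_fun (`](M%:R * h), (M.+1%:R * h)[ : set R) f.
  exact: eq_measurable_fun eqf (measurable_cst _).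
have mc : measurable_fun (`](M%:R * h), (M.+1%:R * h)] : set R) f.
  rewrite -(setUitv1 true) ?bnd_simp//; apply/measurable_funU => //.
  by split=> //; exact: measurable_fun_set1.
have E : `]0%R, (M.+1%:R * h)]%classic =
    `]0%R, (M%:R * h)] `|` `](M%:R * h), (M.+1%:R * h)] :> set R.
  by rewrite -itv_bndbnd_setU// bnd_simp// ltW.
have mU : measurable_fun (`]0%R, (M%:R * h)] `|` `](M%:R * h), (M.+1%:R * h)] : set R) f.
  by apply/measurable_funU.
split; first by rewrite E.
rewrite E ge0_integral_setU//=; last 3 first.
- exact/measurable_EFinP.
- by move=> t _; rewrite lee_fin.
- apply/disj_set2P; rewrite -subset0 => t /= []; rewrite !in_itv /=.
  by move=> /andP[_ a] /andP[b _]; move: (lt_le_trans b a); rewrite ltxx.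
rewrite IHi -integral_itv_bndo_bndc; last exact/measurable_EFinP.
rewrite (eq_integral (cst (c M)%:E)); last by move=> t ht; rewrite -(eqf t ht).
rewrite integral_cst//= lebesgue_measure_itv /= lte_fin Mh -EFinB -EFinM -EFinD.
by rewrite big_ord_recr /= -natr1; congr (_ + _)%:E; ring.
Qed.

End StepIntegral.

Section RademacherValues.
Context {R : realType}.

Lemma sin_addn_pi (x : R) j : sin (x + j%:R * pi) = (-1) ^+ j * sin x.
Proof.
elim: j => [|j IH]; first by rewrite mul0r addr0 expr0 mul1r.
by rewrite -natr1 mulrDl mul1r addrA sinDpi IH exprS; ring.
Qed.

(** On the [m]-th dyadic interval of length [2 ^- n] the integer part of [2 ^+ k * t] is
    [m %/ 2 ^ (n - k)], and the sign of the sine alternates with it: the sign is a binary digit of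
    [m]. *)
Lemma rademacher_dyadic n k m (t : R) : (k <= n)%N ->
  m%:R * 2 ^- n < t < m.+1%:R * 2 ^- n ->
  rademacher k t = (-1) ^+ odd (m %/ 2 ^ (n - k)).
Proof.
move=> kn /andP[t1 t2].
set j := (m %/ 2 ^ (n - k))%N.
have N0 : (0 < 2 ^ (n - k))%N by rewrite expn_gt0.
have e : 2 ^+ n = 2 ^+ k * (2 ^ (n - k))%:R :> R.
  by rewrite natrX -exprD subnKC.
have k0 : 0 < 2 ^+ k :> R by rewrite exprn_gt0.
have n0 : 0 < 2 ^+ n :> R by rewrite exprn_gt0.
have Nr : 0 < (2 ^ (n - k))%:R :> R by rewrite ltr0n.
rewrite ltr_pdivrMr// in t1; rewrite ltr_pdivlMr// in t2.
have eN : 2 ^+ k * t * (2 ^ (n - k))%:R = t * 2 ^+ n by rewrite e; ring.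
have j1 : j%:R < 2 ^+ k * t.
  rewrite -(ltr_pM2r Nr) eN; apply: le_lt_trans t1.
  by rewrite -natrM ler_nat leq_trunc_div.
have j2 : 2 ^+ k * t < j%:R + 1.
  rewrite -(ltr_pM2r Nr) eN; apply: lt_le_trans t2 _.
  by rewrite natr1 -natrM ler_nat ltn_ceil.
rewrite /rademacher.
have -> : 2 ^+ k * pi * t = pi * (2 ^+ k * t - j%:R) + j%:R * pi by ring.
rewrite sin_addn_pi sgrM.
have p0 := pi_gt0 R.
have -> : Num.sg (sin (pi * (2 ^+ k * t - j%:R))) = 1.
  apply: gtr0_sg; apply: sin_gt0_pi; rewrite mulr_gt0// ?subr_gt0//=.
  by rewrite gtr_pMr//; lra.
by rewrite mulr1 sgrX sgrN sgr1 signr_odd.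
Qed.

Lemma bits_inj n (a b : nat) : (a < 2 ^ n)%N -> (b < 2 ^ n)%N ->
  (forall c, (c < n)%N -> odd (a %/ 2 ^ c) = odd (b %/ 2 ^ c)) -> a = b.
Proof.
elim: n a b => [|n IH] a b; first by rewrite expn0 !ltnS !leqn0 => /eqP -> /eqP ->.
move=> an bn H.
have h0 := H 0%N isT; rewrite expn0 !divn1 in h0.
rewrite -(odd_double_half a) -(odd_double_half b) h0; congr (_ + _.*2)%N.
apply: IH.
- by rewrite -divn2 ltn_divLR// -expnSr.
- by rewrite -divn2 ltn_divLR// -expnSr.
- by move=> c cn; rewrite -!divn2 -!divnMA -expnS; exact: H.
Qed.

(** Independence of the Rademacher functions: the digits of [m < 2 ^ n] run through every sign
    pattern exactly once. *)
Lemma sum_bits n (G : {ffun 'I_n -> bool} -> R) :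
  \sum_(m < 2 ^ n) G [ffun k : 'I_n => odd (m %/ 2 ^ (n - k.+1))] = \sum_e G e.
Proof.
pose f (m : 'I_(2 ^ n)) := [ffun k : 'I_n => odd (m %/ 2 ^ (n - k.+1))].
have f_inj : injective f.
  move=> a b ab; apply: val_inj; apply: bits_inj (ltn_ord a) (ltn_ord b) _ => c cn.
  have kn : (n - c.+1 < n)%N by rewrite ltn_subrL (leq_ltn_trans _ cn).
  have := congr1 (fun g : {ffun 'I_n -> bool} => g (Ordinal kn)) ab.
  by rewrite !ffunE /= -subSn// subSS subKn// ltnW.
have f_bij : bijective f.
  by apply: inj_card_bij f_inj _; rewrite card_ffun card_bool !card_ord.
by rewrite [RHS](reindex f) //; exact: onW_bij.
Qed.

End RademacherValues.

Section RademacherNorm.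
Context {R : realType} {X : completeNormedModType R[i]}.
Variable p : R.
Hypothesis p1 : 1 <= p.
Local Notation mu := (@lebesgue_measure R).

Let p0 : 0 < p. Proof. exact: lt_le_trans p1. Qed.

Lemma rnormE (x : X) : `|x| = (rnorm x)%:C.
Proof. by rewrite /rnorm RRe_real// ger0_real. Qed.

Lemma rnorm_ge0 (x : X) : 0 <= rnorm x.
Proof. by rewrite -ler0c -rnormE. Qed.

Lemma rnorm_seminorm : is_seminorm (@rnorm R X).
Proof.
split=> [x y|a x]; first by rewrite -lecR rmorphD /= -!rnormE ler_normD.
by apply: complexI; rewrite rmorphM /= -!rnormE -normcE normrZ.
Qed.

Definition signed_sum n (x : 'I_n -> X) (e : {ffun 'I_n -> bool}) : X :=
  \sum_k ((-1) ^+ e k) *: x k.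

(** The [L^p] norm of the Rademacher sum as a finite average over sign patterns;
    [Lp_norm01_rademacher] identifies the two. *)
Definition rad_norm n (x : 'I_n -> X) : R :=
  pmean p (fun e => rnorm (signed_sum x e)).

Lemma Lp_norm01_rademacher n (x : 'I_n -> X) :
  Lp_norm01 p (rademacher_sum x) = (rad_norm x)%:E.
Proof.
rewrite /Lp_norm01 unlock /Lnorm.
pose f (t : R) := rnorm (rademacher_sum x t) `^ p.
have -> : (\int[mu]_t (`|((fun t : measurableTypeR R => (rnorm (rademacher_sum x t))%:E) \_ `[0%R, 1%R]) t| `^ p))%E
   = (\int[mu]_(t in `[0%R, 1%R]) (f t)%:E)%E.
  rewrite [RHS]integral_mkcond; apply: eq_integral => t _.
  rewrite /patch; case: ifP => _; last by rewrite abse0 poweR0r ?gt_eqF.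
  by rewrite gee0_abs ?lee_fin ?rnorm_ge0// poweR_EFin.
have h0 : 0 < 2 ^- n :> R by rewrite invr_gt0 exprn_gt0.
pose c m := rnorm (signed_sum x [ffun k : 'I_n => odd (m %/ 2 ^ (n - k.+1))]) `^ p.
have fc m t : (m < 2 ^ n)%N -> m%:R * 2 ^- n < t < m.+1%:R * 2 ^- n -> f t = c m.
  move=> _ ht; rewrite /f /c; congr (rnorm _ `^ _); apply: eq_bigr => k _.
  rewrite (@rademacher_dyadic _ n _ m)// ffunE; congr (_ *: _).
  by rewrite rmorphXn /= rmorphN1.
have [mf If] := step_integral h0 (fun t => powR_ge0 _ _) fc.
have e1 : (2 ^ n)%:R * 2 ^- n = 1 :> R by rewrite natrX mulfV// expf_neq0.
rewrite e1 in mf If.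
rewrite -integral_itv_obnd_cbnd; last exact/measurable_EFinP.
rewrite If poweR_EFin; congr (_ `^ _)%:E.
rewrite -mulr_suml mulrC card_ffun card_bool card_ord natrX; congr (_ * _).
exact: (sum_bits (fun e => rnorm (signed_sum x e) `^ p)).
Qed.

End RademacherNorm.

Section RademacherSeminorm.
Context {R : realType} {X : completeNormedModType R[i]}.
Variable p : R.
Hypothesis p1 : 1 <= p.
Let sX := @rnorm_seminorm R X.
Local Notation N := (rad_norm p).

Let p0 : 0 < p. Proof. exact: lt_le_trans p1. Qed.

Let cardS n : (0 < #|{ffun 'I_n -> bool}|)%N.
Proof. by rewrite card_ffun card_bool expn_gt0. Qed.

Lemma rad_norm_seminorm n : @is_seminorm R ('I_n -> X)%type (@rad_norm R X p n).
Proof.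
split=> [x y|a x].
  have H := pmeanD p1 (fun e => rnorm_ge0 (signed_sum x e))
    (fun e => rnorm_ge0 (signed_sum y e)).
  apply: le_trans H.
  apply: (pmean_mono p1) => e; rewrite rnorm_ge0 /=.
  have -> : signed_sum (x + y) e = signed_sum x e + signed_sum y e.
    by rewrite /signed_sum -big_split; apply: eq_bigr => k _ /=; rewrite -scalerDr.
  exact: (snD sX).
rewrite -[RHS](pmeanZ p1 (normc_ge0 a) (fun e => rnorm_ge0 (signed_sum x e))).
congr pmean; apply/funext => e; rewrite -(snZ sX); congr rnorm.
rewrite /signed_sum scaler_sumr; apply: eq_bigr => k _.
by rewrite !scalerA mulrC.
Qed.

Lemma rad_norm_le_sum n (x : 'I_n -> X) : N x <= \sum_k rnorm (x k).
Proof.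
have s0 : 0 <= \sum_k rnorm (x k) by apply: sumr_ge0 => k _; exact: rnorm_ge0.
rewrite -[leRHS](pmean_cst p1 (cardS n) s0).
apply: (pmean_mono p1) => e; rewrite rnorm_ge0 /=.
apply: le_trans (sn_sum sX _ _ _) _; apply: ler_sum => k _.
by rewrite (snZ sX) normcX normcN normc1 expr1n mul1r.
Qed.

Lemma rad_norm_ord1 (x : 'I_1 -> X) : N x = rnorm (x ord0).
Proof.
rewrite -[RHS](pmean_cst p1 (cardS 1) (rnorm_ge0 _)).
congr pmean; apply/funext => e.
rewrite /signed_sum big_ord_recl big_ord0 addr0 (snZ sX) normcX normcN normc1.
by rewrite expr1n mul1r.
Qed.

Definition flip n (j : 'I_n) (x : 'I_n -> X) : 'I_n -> X :=
  fun k => if k == j then - x k else x k.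

Lemma rad_norm_flip n (j : 'I_n) (x : 'I_n -> X) : N (flip j x) = N x.
Proof.
pose s (e : {ffun 'I_n -> bool}) := [ffun k => (k == j) (+) e k].
have sK : involutive s by move=> e; apply/ffunP => k; rewrite !ffunE addKb.
rewrite -[RHS](pmean_reindex _ _ sK); congr pmean; apply/funext => e /=.
congr rnorm; apply: eq_bigr => k _; rewrite ffunE /flip; case: eqP => // _.
by rewrite scalerN; case: (e k); rewrite /= !expr1 ?expr0 ?scaleN1r ?scale1r ?opprK.
Qed.

Definition scale_at n (j : 'I_n) (a : R) (x : 'I_n -> X) : 'I_n -> X :=
  fun k => if k == j then a%:C *: x k else x k.

(** A scalar in [-1, 1] is a convex combination of 1 and -1, so the scaled vector is one of [x] and
    [flip j x], which have the same norm. *)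
Lemma rad_norm_scale_at n (j : 'I_n) a (x : 'I_n -> X) : `|a| <= 1 ->
  N (scale_at j a x) <= N x.
Proof.
rewrite ler_norml => /andP[a1 a2].
have sV := rad_norm_seminorm n.
have -> : scale_at j a x =
    ((1 + a) / 2)%:C *: (x : ('I_n -> X)%type) + ((1 - a) / 2)%:C *: (flip j x : ('I_n -> X)%type).
  apply/funext => k; rewrite /scale_at /flip.
  rewrite -[RHS]/(((1 + a) / 2)%:C *: x k + ((1 - a) / 2)%:C *: (if k == j then - x k else x k)).
  case: eqP => _.
    by rewrite scalerN -scalerBl -rmorphB /=; congr (_%:C *: _); field.
  rewrite -scalerDl -rmorphD /= -[LHS]scale1r; congr (_ *: _).
  by apply/eqP; rewrite eq_complex /= eqxx andbT; apply/eqP; field.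
apply: le_trans (snD sV _ _) _; rewrite !(snZR sV).
- by rewrite rad_norm_flip; lra.
- by rewrite divr_ge0// subr_ge0.
- by rewrite divr_ge0//; lra.
Qed.

(* Kahane's contraction principle for real scalars. *)
Lemma rad_norm_contraction n (a : 'I_n -> R) (x : 'I_n -> X) :
  (forall k, `|a k| <= 1) -> N (fun k => (a k)%:C *: x k) <= N x.
Proof.
move=> a1.
pose y j : 'I_n -> X := fun k => if (k < j)%N then (a k)%:C *: x k else x k.
have -> : (fun k => (a k)%:C *: x k) = y n.
  by apply/funext => k; rewrite /y ltn_ord.
suff H j : (j <= n)%N -> N (y j) <= N x by exact: H.
elim: j => [|j IH] jn; first by rewrite (_ : y 0%N = x)//; apply/funext.
apply: le_trans (IH (ltnW jn)).
have -> : y j.+1 = scale_at (Ordinal jn) (a (Ordinal jn)) (y j).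
  apply/funext => k; rewrite /scale_at /y -val_eqE /= ltnS leq_eqVlt.
  have [e|] := eqVneq (k : nat) j => //=.
  by rewrite e ltnn; have -> : k = Ordinal jn by apply: val_inj.
exact: rad_norm_scale_at.
Qed.

Lemma R_bounded_byP (TT : set (X -> X)) C : R_bounded_by p TT C <->
  (forall n (S : 'I_n -> X -> X) (x : 'I_n -> X), (forall k, TT (S k)) ->
    N (fun k => S k (x k)) <= C * N x).
Proof.
split=> H n S x /(H n S x).
  by rewrite !Lp_norm01_rademacher// -EFinM lee_fin.
by rewrite !Lp_norm01_rademacher// -EFinM lee_fin.
Qed.

Lemma R_bound_lt (TT : set (X -> X)) (c : \bar R) : (R_bound p TT < c)%E ->
  exists C, [/\ 0 <= C, (C%:E < c)%E & R_bounded_by p TT C].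
Proof. by move=> /ereal_inf_lt[_ [C [C0 hC] <-] Cc]; exists C. Qed.

Lemma R_bound_le (TT : set (X -> X)) C : 0 <= C -> R_bounded_by p TT C ->
  (R_bound p TT <= C%:E)%E.
Proof. by move=> C0 hC; apply: ereal_inf_lbound; exists C. Qed.

Lemma R_bound_mono (TT TT' : set (X -> X)) : TT `<=` TT' ->
  (R_bound p TT <= R_bound p TT')%E.
Proof.
move=> sub; apply: le_ereal_inf => _ [C [C0 hC] <-]; exists C => //; split=> //.
by move=> n S x hS; apply: hC => k; exact: sub.
Qed.

Section Limit.
Variable F : R -> X -> X.
Let g (eps : R) := R_bound p [set F t | t in `]0%R, eps[].

(** Monotonicity in [eps] makes the one-sided limit exist, so that [lim] is a genuine limit, namely
    the infimum. *)
Let g_mono : {in `]0%R, 1%R[ &, {homo g : a b / a <= b >-> (a <= b)%E}}.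
Proof.
move=> a b _ _ ab; apply: R_bound_mono => _ [t + <-].
rewrite /= in_itv /= => /andP[t0 ta]; exists t => //.
by rewrite /= in_itv /= t0 (lt_le_trans ta).
Qed.

Let g_lim : lim (g eps @[eps --> 0^'+]) = ereal_inf [set g x | x in `]0%R, 1%R[].
Proof.
by apply: cvg_lim => //; apply: nondecreasing_at_right_cvge => //; rewrite bnd_simp.
Qed.

Lemma lim_R_bound_lt (c : R) : (lim (g eps @[eps --> 0^'+]) < c%:E)%E ->
  exists eps C, [/\ 0 < eps, 0 <= C, C < c &
    R_bounded_by p [set F t | t in `]0%R, eps[] C].
Proof.
rewrite g_lim => /ereal_inf_lt[_ [eps + <-]].
rewrite /= in_itv /= => /andP[e0 _] /R_bound_lt[C [C0 Cc hC]].
by exists eps, C; split => //; rewrite lte_fin in Cc.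
Qed.

Lemma lim_R_bound_le eps C : 0 < eps -> eps < 1 -> 0 <= C ->
  R_bounded_by p [set F t | t in `]0%R, eps[] C ->
  (lim (g eps @[eps --> 0^'+]) <= C%:E)%E.
Proof.
move=> e0 e1 C0 hC; rewrite g_lim; apply: le_trans (R_bound_le C0 hC).
by apply: ereal_inf_lbound; exists eps => //; rewrite /= in_itv /= e0.
Qed.

End Limit.
End RademacherSeminorm.

(** * Sectors, operator norms, and the polynomial of an R-analytic semigroup *)

Lemma choice2 (A B : Type) (P Q : A -> B -> Prop) :
  (forall x, exists2 y, P x y & Q x y) ->
  exists2 f : A -> B, forall x, P x (f x) & forall x, Q x (f x).
Proof.
move=> H; have [f hf] := @boolp.choice A B (fun x y => P x y /\ Q x y)
  (fun x => let: ex_intro2 y Py Qy := H x in ex_intro _ y (conj Py Qy)).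
by exists f => x; case: (hf x).
Qed.

Section Sector.
Context {R : realType}.
Implicit Types z w : R[i].

Lemma normc_le1 z : (`|z| <= 1) = (normc z <= 1).
Proof. by rewrite normcE -[1 in LHS]/(1%:C) lecR. Qed.

Lemma ratio_itv z : z != 0 -> -1 <= complex.Re z / normc z <= 1.
Proof.
rewrite -normc_gt0 => z0; rewrite ler_pdivlMr// ler_pdivrMr// mul1r mulN1r.
by have := normr_Re z; rewrite ler_norml.
Qed.

Lemma normr_carg z : z != 0 -> `|carg z| = acos (complex.Re z / normc z).
Proof.
move=> z0; have a0 := acos_ge0 (ratio_itv z0).
by rewrite /carg -normc_Re; case: ifP => _; rewrite ?normrN ger0_norm.
Qed.

Lemma sectorP (delta : R) z : 0 < delta <= pi -> z != 0 ->
  cos delta < complex.Re z / normc z -> sector delta z.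
Proof.
move=> /andP[d0 dpi] z0 h; split=> //; rewrite normr_carg// ltNge.
apply/negP => le.
have /andP[a0 api] : 0 <= acos (complex.Re z / normc z) <= pi.
  by rewrite acos_ge0 ?acos_lepi ?ratio_itv.
have e : cos (acos (complex.Re z / normc z)) = complex.Re z / normc z.
  by apply: acosK; rewrite in_itv /= ratio_itv.
move: h; rewrite -e; apply/negP; rewrite ltr_cos -?leNgt// in_itv /=.
- by rewrite (le_trans (ltW d0)).
- by rewrite (ltW d0).
Qed.

Lemma sector_mono (d d' : R) : d <= d' -> sector d `<=` @sector R d'.
Proof. by move=> dd z [z0 zd]; split=> //; exact: lt_le_trans zd dd. Qed.

(** With [k] the cosine of the angle and [c = (1 - k) / 4], [complex.Re (1 + w) >= 1 - c > k * (1 +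
    c) >= k * normc (1 + w)] when [k > 0]; for [k <= 0] a positive real part is enough. The sector
    condition does not see the factor [s]. *)
Lemma sector_neighborhood (delta : R) : 0 < delta ->
  exists2 c : R, 0 < c <= 1 / 2 &
    forall w s, normc w <= c -> 0 < s -> sector delta (s%:C * (1 + w)).
Proof.
move=> d0; have p0 := pi_gt0 R.
(* The cosine decreases only on [0, pi]. *)
pose d := Num.min delta pi.
have dpos : 0 < d by rewrite lt_min d0.
have dpi : d <= pi by rewrite ge_min lexx orbT.
set k := cos d.
have d_in : d \in `[0, pi] by rewrite in_itv /= (ltW dpos).
have z_in : 0 \in `[0, pi : R] by rewrite in_itv /= lexx ltW.
have k1 : k < 1 by rewrite /k -(cos0 R) ltr_cos.
have k1' : -1 <= k by exact: cos_geN1.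
exists ((1 - k) / 4); first by apply/andP; split; lra.
move=> w s wc s0; apply: (@sector_mono d); first by rewrite ge_min lexx.
have nw : normc (1 + w) <= 1 + (1 - k) / 4.
  by apply: le_trans (normcD _ _) _; rewrite normc1 lerD2l.
have rw : 1 - (1 - k) / 4 <= complex.Re (1 + w).
  have := normr_Re w; rewrite ler_norml => /andP[h _].
  have -> : complex.Re (1 + w) = 1 + complex.Re w by case: (w).
  lra.
have nz : 0 < normc (1 + w).
  by apply: lt_le_trans (le_trans rw (le_trans (ler_norm _) (normr_Re _))); lra.
have e : complex.Re (s%:C * (1 + w)) = s * complex.Re (1 + w).
  by case: (1 + w) => a b /=; ring.
apply: sectorP; rewrite ?dpos//.
- by rewrite -normc_gt0 normcM normcR mulr_gt0// normr_gt0 gt_eqF.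
rewrite e normcM normcR gtr0_norm// -mulf_div divff ?gt_eqF// mul1r -/k.
rewrite ltr_pdivlMr//.
have [k0|k0] := leP k 0.
  have : k * normc (1 + w) <= 0 by rewrite mulr_le0_ge0// ltW.
  lra.
apply: lt_le_trans rw.
apply: le_lt_trans (ler_wpM2l (ltW k0) nw) _; nra.
Qed.

End Sector.

Section OperatorNorm.
Context {R : realType} {X : completeNormedModType R[i]}.
Local Notation sX := (@rnorm_seminorm R X).

Lemma rnorm0_eq0 (x : X) : rnorm x = 0 -> x = 0.
Proof. by move=> h; apply/normr0_eq0; rewrite rnormE h. Qed.

Lemma rnorm_opnorm (S : X -> X) (e : R) x : linear S ->
  (opnorm S <= e%:E)%E -> rnorm (S x) <= e * rnorm x.
Proof.
move=> lS Se; have [x0|x0] := eqVneq (rnorm x) 0.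
  by rewrite (rnorm0_eq0 x0) (linear0_op lS) (sn0 sX) mulr0.
have r0 : 0 < rnorm x by rewrite lt_def x0 rnorm_ge0.
pose y := (rnorm x)^-1%:C *: x.
have y1 : rnorm y = 1 by rewrite (snZR sX) ?invr_ge0 ?rnorm_ge0// mulVf.
have : ((rnorm (S y))%:E <= e%:E)%E.
  apply: le_trans Se; apply: ereal_sup_ubound; exists y => //=.
  by rewrite y1.
rewrite lee_fin (linearZ_op _ _ lS) (snZR sX) ?invr_ge0 ?rnorm_ge0//.
by rewrite mulrC ler_pdivrMr.
Qed.

Lemma opnorm_le (S : X -> X) (e : R) : 0 <= e ->
  (forall x, rnorm (S x) <= e * rnorm x) -> (opnorm S <= e%:E)%E.
Proof.
move=> e0 H; apply: ge_ereal_sup => _ [x x1 <-]; rewrite lee_fin.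
by apply: le_trans (H x) _; rewrite ler_piMr.
Qed.

Lemma linear_sub_op (f g : X -> X) : linear f -> linear g ->
  linear (fun x => f x - g x).
Proof.
by move=> lf lg a u v; rewrite lf lg scalerBr opprD addrACA.
Qed.

Lemma linear_scale_op (f : X -> X) (c : R[i]) : linear f ->
  linear (fun x => c *: f x).
Proof. by move=> lf a u v; rewrite lf scalerDr !scalerA mulrC. Qed.

Lemma dnbhs_normcP (P : R[i] -> Prop) :
  (\forall h \near (0 : R[i]^o)^', P h) <->
  exists2 d : R, 0 < d & forall h, 0 < normc h -> normc h < d -> P h.
Proof.
split.
  move=> [e /= e0 he].
  have ce : e = (complex.Re e)%:C by rewrite RRe_real// ger0_real// ltW.
  exists (complex.Re e).
    by move: e0; rewrite ce ltcR.
  move=> h h0 hd; apply: he => /=.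
    by rewrite sub0r normrN normcE ce ltcR.
  by rewrite -normc_gt0.
move=> [d d0 hd]; exists d%:C => /=; first by rewrite ltcR.
move=> h /=; rewrite sub0r normrN normcE ltcR => h1 h0.
by apply: hd => //; rewrite normc_gt0.
Qed.

(** [opnorm] is a supremum over the unit ball, so homogeneity turns its limit into an estimate
    uniform in [x]. Linearity of [F (z + h)] is a hypothesis because it will be known only inside
    the sector. *)
Lemma holomorphic_on_deriv (U : set R[i]) (F : R[i] -> X -> X) z :
  holomorphic_on U F -> U z -> linear (F z) ->
  exists2 D : X -> X, bounded_operator D &
  forall e, 0 < e -> exists2 d : R, 0 < d & forall h, normc h <= d ->
    linear (F (z + h)) -> forall x,
    rnorm (F (z + h) x - F z x - h *: D x) <= e * normc h * rnorm x.
Proof.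
move=> hF Uz lz; have [D [bD cvgD]] := hF z Uz; exists D => // e e0.
have : \forall y \near (0%R : \bar R)%E, (y < e%:E)%E.
  by apply: open_nbhs_nbhs; split; [exact: open_ereal_lt_ereal|rewrite /= lte_fin].
move=> /cvgD /dnbhs_normcP[d d0 hd].
exists (d / 2); first by rewrite divr_gt0.
move=> h hd2 lh x; have [->|h0] := eqVneq h 0.
  by rewrite addr0 subrr scale0r subrr (sn0 sX) normc0 mulr0 mul0r.
have nh : 0 < normc h by rewrite normc_gt0.
have lD : linear D by case: bD.
have hd1 : normc h < d by lra.
have lS : linear (fun x => h^-1 *: (F (z + h) x - F z x) - D x).
  by apply: linear_sub_op => //; apply: linear_scale_op; exact: linear_sub_op.
have H := rnorm_opnorm x lS (ltW (hd h nh hd1)).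
have -> : F (z + h) x - F z x - h *: D x =
    h *: (h^-1 *: (F (z + h) x - F z x) - D x).
  by rewrite scalerBr scalerA mulfV// scale1r.
have -> : e * normc h * rnorm x = normc h * (e * rnorm x) by ring.
by rewrite (snZ sX) ler_wpM2l ?normc_ge0.
Qed.

End OperatorNorm.

(** * From R-analyticity to a polynomial *)

Section Forward.
Context {R : realType} {X : completeNormedModType R[i]}.
Variables (p : R) (T : R -> X -> X).
Hypothesis p1 : 1 <= p.
Hypothesis hT : C0_semigroup T.
Local Notation sX := (@rnorm_seminorm R X).

(** The radius is [1 / (1 + \sum_k 1 / d k)], which lies below every [d k] and is also meaningful
    for [n = 0]. *)
Lemma uniform_radius n (P : 'I_n -> R -> Prop) :
  (forall k, exists2 d, 0 < d & forall e, e <= d -> P k e) ->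
  exists2 d, 0 < d & forall k e, e <= d -> P k e.
Proof.
move=> /choice2[d d0 hd].
have s0 : 0 <= \sum_k (d k)^-1 by apply: sumr_ge0 => k _; rewrite invr_ge0 ltW.
exists (1 + \sum_k (d k)^-1)^-1; first by rewrite invr_gt0 ltr_pwDl.
move=> k e he; apply: hd; apply: le_trans he _.
rewrite -[leRHS]invrK lef_pV2 ?posrE ?invr_gt0 ?ltr_pwDl//.
rewrite (bigD1 k)//= addrCA lerDl addr_ge0//.
by apply: sumr_ge0 => j _; rewrite invr_ge0 ltW.
Qed.

(* Cauchy's estimate for [w |-> T(s_k (1 + w)) x_k] with [s_k = m t_k], used at
   [w = 1 / m]. *)
Lemma R_analytic_differences : R_analytic p T -> exists (C : R) (m0 : nat),
  0 <= C /\ forall (m : nat) n (t : 'I_n -> R) (x : 'I_n -> X), (m0 <= m)%N ->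
    (forall k, 0 < t k /\ m%:R * t k <= 1 / 2) ->
    rad_norm p (fun k => T (m.+1%:R * t k) (x k) - T (m%:R * t k) (x k)) <=
      C / m%:R * rad_norm p x.
Proof.
move=> [delta [d0 [Tc [TcT Tcb Tch Rb]]]].
have [C [C0 _ /(R_bounded_byP p1) hC]] := R_bound_lt Rb.
have [c0 /andP[c00 c0h] hc0] := sector_neighborhood d0.
(* The square of half-side [c] lies in the ball of radius [2 * c = c0 / 2]; the other [c0 / 2] is
   room for increments at its points. *)
pose c := c0 / 4.
have cp : 0 < c by rewrite divr_gt0.
have c2 : 0 < c / 2 by rewrite divr_gt0.
have c2V : 0 <= (c / 2)^-1 by rewrite invr_ge0 ltW.
exists (8 * C / c), (Num.truncn (c / 2)^-1).+1.
split; first by rewrite divr_ge0 ?mulr_ge0// ltW.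
move=> m n t x mm ht.
have m0 : (0 < m)%N by apply: leq_trans mm.
have mr : 0 < m%:R :> R by rewrite ltr0n.
have mV : m%:R^-1 <= c / 2.
  rewrite -[leRHS]invrK lef_pV2 ?posrE ?invr_gt0//.
  have /andP[_ /ltW h] := truncn_itv c2V; apply: le_trans h _.
  by rewrite ler_nat.
pose s k := m%:R * t k.
have s0 k : 0 < s k by rewrite /s mulr_gt0//; case: (ht k).
have s1 k : s k <= 1 / 2 by case: (ht k).
pose F (w : R[i]) : 'I_n -> X := fun k => Tc ((s k)%:C * (1 + w)) (x k).
have sec w k : normc w <= c0 -> sector delta ((s k)%:C * (1 + w)).
  by move=> wc; exact: hc0.
have sq w : in_square (centered c) (2 * c) w -> normc w <= c0 / 2.
  move=> [/= h1 h2]; apply: le_trans (normc_le _) _.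
  have e : - c + 2 * c = c by ring.
  rewrite e in h1 h2; rewrite -!ler_norml in h1 h2.
  have : c0 / 2 = c + c by rewrite /c; field.
  lra.
have Flin w k : normc w <= c0 -> linear (Tc ((s k)%:C * (1 + w))).
  by move=> wc; case: (Tcb _ (sec w k wc)).
have sV := rad_norm_seminorm (X := X) p1 n.
(* Differentiability is purely qualitative: its rate may depend on [n] and [x], so [rad_norm_le_sum]
   is good enough. Only the bound [FA] has to be uniform. *)
have FD w : in_square (centered c) (2 * c) w ->
    exists D : 'I_n -> X, has_cderiv (N := @rad_norm R X p n) (F : R[i] -> ('I_n -> X)%type) w D.
  move=> /sq wc; have wc0 : normc w <= c0 by lra.
  have /choice2[D Db hD] : forall k, exists2 D : X -> X, bounded_operator D &
    forall e, 0 < e -> exists2 d : R, 0 < d & forall h, normc h <= d ->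
      linear (Tc ((s k)%:C * (1 + w) + h)) -> forall x,
      rnorm (Tc ((s k)%:C * (1 + w) + h) x - Tc ((s k)%:C * (1 + w)) x - h *: D x) <=
        e * normc h * rnorm x.
    by move=> k; apply: holomorphic_on_deriv Tch (sec w k wc0) (Flin w k wc0).
  exists (fun k => (s k)%:C *: D k (x k)) => e e0.
  pose Sx := \sum_k rnorm (x k).
  have Sx0 : 0 <= Sx by apply: sumr_ge0 => k _; exact: rnorm_ge0.
  have e'0 : 0 < e / (1 + Sx) by rewrite divr_gt0// ltr_pwDl.
  have UR k : exists2 d : R, 0 < d & forall r, r <= d -> forall h, normc h <= r ->
      linear (Tc ((s k)%:C * (1 + w) + h)) ->
      rnorm (Tc ((s k)%:C * (1 + w) + h) (x k) - Tc ((s k)%:C * (1 + w)) (x k) -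
        h *: D k (x k)) <= e / (1 + Sx) * normc h * rnorm (x k).
    have [d dp hd] := hD k _ e'0; exists d => // r rd h hr lh.
    exact: hd (le_trans hr rd) lh _.
  have [d dp hd] := uniform_radius UR.
  exists (Num.min d (c0 / 2)); first by rewrite lt_min dp divr_gt0.
  move=> w'; rewrite le_min => /andP[w1 w2].
  have w'c : normc w' <= c0.
    have := normcD (w' - w) w; rewrite subrK; lra.
  apply: le_trans (rad_norm_le_sum p1 _) _.
  apply: le_trans (_ : \sum_k e / (1 + Sx) * normc (w' - w) * rnorm (x k) <= _).
    apply: ler_sum => k _.
    have zh : (s k)%:C * (1 + w) + (s k)%:C * (w' - w) = (s k)%:C * (1 + w').
      by ring.
    have nh : normc ((s k)%:C * (w' - w)) <= normc (w' - w).
      rewrite normcM normcR gtr0_norm// ler_piMl ?normc_ge0//.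
      by have := s1 k; lra.
    have := hd k _ w1 ((s k)%:C * (w' - w)) nh.
    rewrite zh => /(_ (Flin w' k w'c)) h1.
    rewrite -[X in rnorm X]/(F w' k - F w k - (w' - w) *: ((s k)%:C *: D k (x k))).
    rewrite scalerA [(w' - w) * _]mulrC; apply: le_trans h1 _.
    by rewrite ler_wpM2r ?rnorm_ge0// ler_wpM2l// ltW.
  rewrite -mulr_sumr -/Sx mulrAC ler_wpM2r ?normc_ge0//.
  by rewrite mulrAC ler_pdivrMr ?ltr_pwDl// ler_wpM2l ?(ltW e0)// lerDr.
have FA w : in_square (centered c) (2 * c) w -> rad_norm p (F w) <= C * rad_norm p x.
  move=> /sq wc; apply: (hC n (fun k => Tc ((s k)%:C * (1 + w))) x) => k.
  exists ((s k)%:C * (1 + w)) => //; split; first by apply: sec; lra.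
  (* The R-bound is available for [normc z <= 1] only, which is why [s k <= 1 / 2] is required. *)
  rewrite normc_le1 normcM normcR gtr0_norm//.
  have h1 : normc (1 + w) <= 2.
    by apply: le_trans (normcD _ _) _; rewrite normc1; lra.
  have := ler_wpM2l (ltW (s0 k)) h1; have := s1 k; lra.
have hn : normc (m%:R^-1%:C : R[i]) = m%:R^-1 by rewrite normcR ger0_norm// invr_ge0.
have := @cauchy_lipschitz R _ _ sV F c (C * rad_norm p x) (m%:R^-1)%:C cp FD FA.
rewrite hn => /(_ mV).
have -> : 8 * m%:R^-1 * (C * rad_norm p x) / c = 8 * C / c / m%:R * rad_norm p x.
  by ring.
suff -> : (F (m%:R^-1)%:C : ('I_n -> X)%type) - F 0 =
    (fun k => T (m.+1%:R * t k) (x k) - T (m%:R * t k) (x k)) by [].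
apply/funext => k.
rewrite -[LHS]/(F (m%:R^-1)%:C k - F 0 k) /F.
have t0 : 0 < t k by case: (ht k).
have -> : (s k)%:C * (1 + (m%:R^-1)%:C) = (m.+1%:R * t k)%:C :> R[i].
  rewrite -(rmorph1 (real_complex R)) -rmorphD -rmorphM; congr (_%:C).
  by rewrite /s -natr1; field; rewrite gt_eqF.
by rewrite addr0 mulr1 !TcT// mulr_gt0.
Qed.

Lemma poly_op_pev (f : {poly R[i]}) (S : X -> X) x : poly_op f S x = pev f S x.
Proof. by []. Qed.

(** The bound [K] ensures that [sup] is a true supremum and not a default value. *)
Lemma le_disk_norm (f : {poly R[i]}) (K : R) z : normc z <= 1 ->
  (forall w, normc w <= 1 -> normc f.[w] <= K) -> normc f.[z] <= disk_norm f.
Proof.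
move=> z1 hK; rewrite /disk_norm; apply: ub_le_sup.
  by exists K => _ [w w1 <-]; rewrite -normc_Re; apply: hK; rewrite -normc_le1.
by exists z; [rewrite /= normc_le1|rewrite normc_Re].
Qed.

Lemma forward : R_analytic p T -> exists f : {poly R[i]},
  (lim (R_bound p [set poly_op f (T t) | t in `]0%R, eps[] @[eps --> 0^'+])
    < (disk_norm f)%:E)%E.
Proof.
move=> /R_analytic_differences[C [m0 [C0 hC]]].
pose m := (maxn m0 (Num.truncn C).+1).
have mp : (0 < m)%N by rewrite leq_max orbT.
have mr : 0 < m%:R :> R by rewrite ltr0n.
exists ('X^(m.+1) - 'X^m).
apply: (@le_lt_trans _ _ 1%:E); last first.
  rewrite lte_fin; apply: (@lt_le_trans _ _ 2); first by rewrite ltr1n.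
  have <- : normc ('X^(m.+1) - 'X^m : {poly R[i]}).[-1] = 2.
    rewrite hornerD hornerN !hornerXn exprS.
    have -> : -1 * (-1) ^+ m - (-1) ^+ m = - (2%:R * (-1) ^+ m) :> R[i] by ring.
    by rewrite normcN normcM normc_nat normcX normcN normc1 expr1n mulr1.
  apply: (@le_disk_norm _ 2); first by rewrite normcN normc1.
  move=> w w1; rewrite hornerD hornerN !hornerXn; apply: le_trans (normcD _ _) _.
  rewrite normcN !normcX -[2]/(1 + 1); apply: lerD; exact: exprn_ile1 (normc_ge0 _) w1.
(* Below this time [m * t <= 1 / 2] holds, as [R_analytic_differences] requires. *)
have e0 : 0 < (2 * m.+1%:R)^-1 :> R by rewrite invr_gt0 mulr_gt0.
apply: (lim_R_bound_le e0) => //.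
  by rewrite invf_lt1 ?mulr_gt0// -natrM ltr1n; lia.
apply/R_bounded_byP => // n S x hS; rewrite mul1r.
have /choice2[t ht hSt] : forall k, exists2 t, 0 < t < (2 * m.+1%:R)^-1 &
    poly_op ('X^(m.+1) - 'X^m) (T t) = S k.
  by move=> k; have [t + <-] := hS k; rewrite /= in_itv /= => ?; exists t.
have t0 k : 0 < t k by have /andP[] := ht k.
have e k : S k (x k) = T (m.+1%:R * t k) (x k) - T (m%:R * t k) (x k).
  have it := iter_semigroup (sg_0 hT) (fun s t x => @sg_D _ _ _ hT s t x).
  by rewrite -hSt poly_op_pev pevB !pevXn !it// ltW.
have -> : (fun k => S k (x k)) = (fun k => T (m.+1%:R * t k) (x k) - T (m%:R * t k) (x k)).
  by apply/funext.
apply: le_trans (hC m n t x (leq_maxl _ _) _) _.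
  move=> k; split => //; have /andP[_ h] := ht k.
  have M0 : 0 < 2 * m.+1%:R :> R by rewrite mulr_gt0.
  move: h; rewrite -[_^-1]mul1r ltr_pdivlMr// -[m.+1%:R]natr1.
  have := mulr_gt0 mr (t0 k); have := t0 k; lra.
rewrite ler_piMl ?(sn_ge0 (rad_norm_seminorm p1 n))//.
rewrite ler_pdivrMr// mul1r.
have /andP[_ /ltW h] := truncn_itv C0; apply: le_trans h _.
by rewrite ler_nat leq_maxr.
Qed.

End Forward.

(** * The R-Lipschitz estimate *)

Section Backward.
Context {R : realType} {X : completeNormedModType R[i]}.
Variables (p : R) (T : R -> X -> X).
Hypothesis p1 : 1 <= p.
Hypothesis hT : C0_semigroup T.
Local Notation sX := (@rnorm_seminorm R X).
Local Notation N := (rad_norm p).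

Lemma sg_linear s : 0 <= s -> linear (T s).
Proof. by move=> s0; case: (sg_bounded hT s0). Qed.

Lemma sg_add (s t : R) x : 0 <= s -> 0 <= t -> T (s + t) x = T s (T t x).
Proof. exact: (sg_D hT). Qed.

Lemma sg_right_continuous x (e : R) : 0 < e ->
  exists2 d : R, 0 < d & forall s, 0 <= s <= d -> rnorm (T s x - x) <= e.
Proof.
move=> e0.
have /subspace_continuousP/(_ 0) := @sg_cont _ _ _ hT x.
rewrite /= in_itv /= lexx => /(_ isT).
move=> /cvgrPdist_le/(_ e%:C); rewrite ltcR => /(_ e0).
rewrite near_withinE => /nbhs_ballP[d /= d0 hd].
exists (d / 2); first by rewrite divr_gt0.
move=> s /andP[s0 sd].
have := hd s; rewrite /ball /= sub0r normrN ger0_norm// in_itv /= s0.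
have sd' : s < d by lra.
move=> /(_ sd' isT) H; have {H} : `|T 0 x - T s x| <= e%:C := H.
by rewrite (sg_0 hT) distrC rnormE lecR.
Qed.

(** The residue 0 is represented by [n], because [freq_exists] needs a positive numerator to obtain
    a positive power. *)
Lemma cis_period (j n : nat) : (0 < n)%N -> exists2 a : nat, (0 < a <= n)%N &
  cis (j%:R / n%:R) = cis (a%:R / n%:R) :> R[i].
Proof.
move=> n0; have nr : n%:R != 0 :> R by rewrite pnatr_eq0 -lt0n.
have E a q : j = (q * n + a)%N -> cis (j%:R / n%:R) = cis (a%:R / n%:R) :> R[i].
  move=> ->; rewrite natrD natrM.
  have -> : (q%:R * n%:R + a%:R) / n%:R = q%:R + a%:R / n%:R :> R by field.
  by rewrite cisD cis_nat mul1r.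
have Ej := divn_eq j n.
have [r0|r0] := posnP (j %% n)%N.
  exists n; first by rewrite n0 leqnn.
  have := E 0%N (j %/ n)%N; rewrite addn0 mul0r cis0 divff// cis1; apply.
  by rewrite {1}Ej r0 addn0.
by exists (j %% n)%N; [rewrite r0 ltnW// ltn_mod|exact: E Ej].
Qed.

Lemma disk_norm_root_of_unity (f : {poly R[i]}) (rho : R) : rho < disk_norm f ->
  exists a b : nat, (0 < a <= b)%N /\ rho < normc f.[cis (a%:R / b%:R)].
Proof.
move=> rf; apply: contrapT => H.
have K : forall n j : nat, (0 < n)%N -> normc f.[cis (j%:R / n%:R)] <= rho.
  move=> n j n0; have [a an ->] := cis_period j n0.
  by rewrite leNgt; apply/negP => h; apply: H; exists a, n.
have D := maximum_modulus K.
move: rf; apply/negP; rewrite -leNgt /disk_norm; apply: ge_sup.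
  by exists (complex.Re `|f.[0]|), 0; rewrite //= normr0.
by move=> _ [z z1 <-]; rewrite -normc_Re; apply: D; rewrite -normc_le1.
Qed.

Lemma pev_pointwise n (g : {poly R[i]}) (S : 'I_n -> X -> X) (x : 'I_n -> X) :
  pev g (fun y : ('I_n -> X)%type => fun k => S k (y k)) (x : ('I_n -> X)%type) =
  fun k => pev g (S k) (x k).
Proof.
apply/funext => k; rewrite /pev fct_sumE; apply: eq_bigr => i _.
rewrite -[LHS]/(g`_i *: (iter i (fun y : 'I_n -> X => fun k => S k (y k)) x k)).
by congr (_ *: _); elim: (i : nat) => // j IH; rewrite !iterS -IH.
Qed.

Section RLipschitz.
Variables (M : R).
Hypothesis M1 : 1 <= M.
Hypothesis hM : forall n (t : 'I_n -> R) (x : 'I_n -> X),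
  (forall k, 0 < t k < 1) -> N (fun k => T (t k) (x k)) <= M * N x.

Let M0 : 0 <= M. Proof. exact: le_trans M1. Qed.

(** The hypothesis excludes the time 1; halving all times reaches it at the price of a square. *)
Lemma semigroup_R_bound n (t : 'I_n -> R) (x : 'I_n -> X) :
  (forall k, 0 < t k <= 1) -> N (fun k => T (t k) (x k)) <= M ^+ 2 * N x.
Proof.
move=> ht.
have h2 k : 0 < t k / 2 < 1 by have := ht k; lra.
have h2' k : 0 <= t k / 2 by have := ht k; lra.
have -> : (fun k => T (t k) (x k)) = (fun k => T (t k / 2) (T (t k / 2) (x k))).
  by apply/funext => k; rewrite -sg_add// -splitr.
rewrite expr2 -mulrA; apply: le_trans (hM _ h2) _.
by rewrite ler_wpM2l// hM.
Qed.

(* The difference quotient [g] of [f] at [zeta] turns the bounds of [f(S)] and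
   [g(S)] into a lower bound of [zeta - S]: f(zeta) - f(S) = g(S) (zeta - S). *)
Lemma R_lipschitz (f : {poly R[i]}) (eps rho : R) : 0 < eps -> 0 <= rho ->
  rho < disk_norm f -> R_bounded_by p [set poly_op f (T t) | t in `]0%R, eps[] rho ->
  exists2 C : R, 0 <= C & forall n (t : 'I_n -> R) (x : 'I_n -> X) u,
    (forall k, 0 < t k <= 1) -> 0 <= u <= 1 ->
    N (fun k => T ((1 + u) * t k) (x k) - T (t k) (x k)) <= C * u * N x.
Proof.
move=> e0 rho0 rf /(R_bounded_byP p1) hf.
have [a [b [ab fz]]] := disk_norm_root_of_unity rf.
set zeta := cis (a%:R / b%:R) in fz.
have [g Eg] : exists g, f.[zeta]%:P - f = g * (zeta%:P - 'X).
  have : root (f - f.[zeta]%:P) zeta by rewrite rootE !hornerE subrr.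
  move=> /factor_theorem[g Eg]; exists g.
  by rewrite -opprB Eg -mulrN opprB.
pose G := \sum_(i < size g) normc g`_i.
have G0 : 0 <= G by apply: sumr_ge0 => i _; exact: normc_ge0.
pose B := G * M / (normc f.[zeta] - rho).
have B0 : 0 <= B by rewrite divr_ge0 ?mulr_ge0// subr_ge0 ltW.
(* Times are shrunk by [la] for two reasons: below [eps] the bound [rho] of [f(S)] applies, and
   below [1 / (size g + 2)] all powers of [S] occurring in [g(S)] are values of [T] at times less
   than 1. *)
pose la := Num.min (eps / 2) ((size g).+2%:R^-1).
have la0 : 0 < la by rewrite lt_min divr_gt0// invr_gt0 ltr0n.
have lae : la < eps by rewrite gt_min; apply/orP; left; lra.
have lag : la <= (size g).+2%:R^-1 by rewrite ge_min lexx orbT.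
have la1 : la < 1.
  by apply: le_lt_trans lag _; rewrite invf_lt1// ltr1n.
pose L := lipschitz_const M B.
have L0 : 0 <= L := lipschitz_const_ge0 M1 B0.
have key n (t : 'I_n -> R) (x : 'I_n -> X) u : (forall k, 0 < t k <= 1) -> 0 <= u <= 1 ->
    N (fun k => T ((1 + u) * (la / 6 * t k)) (x k) - T (la / 6 * t k) (x k)) <= L * u * N x.
  move=> ht hu.
  have t0 k : 0 < t k by case/andP: (ht k).
  have t1 k : t k <= 1 by case/andP: (ht k).
  (* A semigroup on [X ^ n] whose components run at the speeds [la * t k]; its constants [M] and [B]
     depend neither on [n] nor on [t]. *)
  pose Tv (s : R) (y : 'I_n -> X) : 'I_n -> X := fun k => T (la * s * t k) (y k).
  have st s k : 0 <= s -> 0 <= la * s * t k by move=> s0; rewrite !mulr_ge0// ltW.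
  have st' s k : 0 < s -> 0 < la * s * t k by move=> s0; rewrite !mulr_gt0.
  have stl s k : 0 <= s <= 1 -> la * s * t k <= la.
    move=> /andP[s0 s1]; rewrite -mulrA ler_piMr ?(ltW la0)//.
    exact: mulr_ile1 s0 (ltW (t0 k)) s1 (t1 k).
  have sV := rad_norm_seminorm (X := X) p1 n.
  have lin s : 0 <= s -> linear (Tv s : ('I_n -> X)%type -> ('I_n -> X)%type).
    move=> s0 c v w; apply/funext => k.
    exact: (sg_linear (st s k s0)).
  have Tv0 y : Tv 0 y = y by apply/funext => k; rewrite /Tv mulr0 mul0r (sg_0 hT).
  have TvD s s' y : 0 <= s -> 0 <= s' -> Tv (s + s') y = Tv s (Tv s' y).
    move=> s0 s'0; apply/funext => k; rewrite /Tv -sg_add ?st//.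
    by congr (T _ _); ring.
  have TvM s y : 0 <= s <= 1 -> N (Tv s y) <= M * N y.
    move=> /andP[]; rewrite le_eqVlt => /predU1P[<- _|s0 s1].
      by rewrite Tv0 ler_peMl// (sn_ge0 sV).
    apply: hM => k; rewrite st'//=; apply: le_lt_trans la1.
    by apply: stl; rewrite ltW.
  have Tvc y e : 0 < e -> exists2 d, 0 < d & forall s, 0 <= s <= d -> N (Tv s y - y) <= e.
    move=> ep.
    have en : 0 < e / n.+1%:R by rewrite divr_gt0.
    have UR k : exists2 d : R, 0 < d & forall r, r <= d -> 0 <= r -> rnorm (T r (y k) - y k) <= e / n.+1%:R.
      have [d d0 hd] := sg_right_continuous (y k) en; exists d => // r rd r0.
      by apply: hd; rewrite r0.
    have [d d0 hd] := uniform_radius UR; exists d => // s /andP[s0 sd].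
    apply: le_trans (rad_norm_le_sum p1 _) _.
    apply: le_trans (_ : \sum_(k < n) e / n.+1%:R <= _).
      apply: ler_sum => k _; apply: (hd k (la * s * t k)); last exact: st.
      apply: le_trans sd; rewrite mulrAC -[leRHS]mul1r ler_wpM2r//.
      exact: mulr_ile1 (ltW la0) (ltW (t0 k)) (ltW la1) (t1 k).
    rewrite sumr_const card_ord -[_ *+ n]mulr_natr mulrAC ler_pdivrMr//.
    by rewrite ler_wpM2l ?(ltW ep)// ler_nat.
  have TvB s y : 0 < s <= 1 -> N y <= B * N (zeta *: (y : ('I_n -> X)%type) - Tv s y).
    move=> /andP[s0 s1].
    set z := _ - Tv s y.
    have s01 : 0 <= s <= 1 by rewrite ltW.
    have fS : N (pev f (Tv s : ('I_n -> X)%type -> ('I_n -> X)%type) y) <= rho * N y.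
      have -> : pev f (Tv s : ('I_n -> X)%type -> ('I_n -> X)%type) y =
          (fun k => pev f (T (la * s * t k)) (y k)).
        exact: (pev_pointwise f (fun k => T (la * s * t k)) y).
      apply: (hf n (fun k => poly_op f (T (la * s * t k))) y) => k.
      exists (la * s * t k) => //; rewrite /= in_itv /= st'//=.
      exact: le_lt_trans (stl s k s01) lae.
    have gS : N (pev g (Tv s : ('I_n -> X)%type -> ('I_n -> X)%type) z) <= G * M * N z.
      apply: le_trans (sn_sum sV _ _ _) _; rewrite /G !mulr_suml; apply: ler_sum => i _.
      apply: le_trans (_ : normc g`_i * N (iter i (Tv s) z) <= _).
        by have := snZ sV g`_i (iter i (Tv s) z); rewrite le_eqVlt => ->; rewrite eqxx.
      rewrite -mulrA; apply: (ler_wpM2l (normc_ge0 _)).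
      have [i0|i0] := posnP i; first by rewrite i0 /= ler_peMl// (sn_ge0 sV).
      have -> : iter i (Tv s) z = (fun k => T (i%:R * (la * s * t k)) (z k)).
        apply/funext => k; elim: (i : nat) => [|j IH]; first by rewrite mul0r (sg_0 hT).
        rewrite iterS {1}/Tv IH -sg_add ?st ?(ltW s0)//.
          by congr (T _ _); rewrite -natr1; ring.
        by rewrite mulr_ge0 ?st ?(ltW s0).
      apply: hM => k.
      rewrite mulr_gt0 ?st' ?ltr0n//=.
      apply: (@le_lt_trans _ _ ((size g)%:R * la)).
        apply: ler_pM; rewrite ?ler0n ?st ?ler_nat ?(ltW s0) ?(ltnW (ltn_ord i))//.
        exact: stl.
      apply: le_lt_trans (ler_wpM2l _ lag) _ => //.
      by rewrite ltr_pdivrMr// mul1r ltr_nat.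
    have Ez : pev g (Tv s : ('I_n -> X)%type -> ('I_n -> X)%type) z =
        f.[zeta] *: (y : ('I_n -> X)%type) - pev f (Tv s : ('I_n -> X)%type -> ('I_n -> X)%type) y.
      have -> : z = pev (zeta%:P - 'X) (Tv s : ('I_n -> X)%type -> ('I_n -> X)%type) y.
        by rewrite pevB pevC pevX.
      by rewrite -(pevM _ _ _ (lin s (ltW s0))) -Eg pevB pevC.
    have alg (a' b' c' d : R) : 0 < d -> d * a' <= c' * b' -> a' <= c' / d * b'.
      by move=> d0 h; rewrite mulrAC ler_pdivlMr// mulrC.
    have d0 : 0 < normc f.[zeta] - rho by rewrite subr_gt0.
    apply: (alg _ _ _ _ d0); rewrite mulrBl lerBlDr; apply: le_trans (lerD gS fS).
    have -> : normc f.[zeta] * N y = N (f.[zeta] *: (y : ('I_n -> X)%type)).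
      exact: esym (snZ sV f.[zeta] y).
    by rewrite Ez; exact: (snBl sV).
  have := semigroup_lipschitz sV M1 B0 ab lin Tv0 TvD TvM Tvc TvB x hu.
  rewrite -/L; apply: le_trans; apply: le_of_eq.
  congr N; apply/funext => k.
  have hu0 : 0 <= u by case/andP: hu.
  rewrite -[RHS]/(T (la * (1 / 6) * t k) (T (la * (u / 6) * t k) (x k)) - T (la * (1 / 6) * t k) (x k)).
  rewrite -sg_add ?st ?divr_ge0//; congr (T _ _ - T _ _); by field.
pose la' := la / 6.
have la'0 : 0 < la' by rewrite divr_gt0.
have la'1 : la' < 1 by rewrite /la'; lra.
exists ((M * L + M ^+ 4 + M ^+ 2) / la').
  by rewrite divr_ge0 ?(ltW la'0)// !addr_ge0 ?exprn_ge0// mulr_ge0.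
move=> n t x u ht /andP[u0 u1].
have sV := rad_norm_seminorm (X := X) p1 n.
have t0 k : 0 < t k by case/andP: (ht k).
have t0' k : 0 <= t k by exact: ltW.
have t1 k : t k <= 1 by case/andP: (ht k).
have c1 : M * L * (u / la') * N x + (M ^+ 4 + M ^+ 2) * (u / la') * N x =
    (M * L + M ^+ 4 + M ^+ 2) / la' * u * N x by ring.
have ul0 : 0 <= u / la' by rewrite divr_ge0 ?(ltW la'0).
have N0 : 0 <= N x by exact: sn_ge0 sV _.
(* [key] concerns the times [la' * t k]. For [u <= la'] it is transported to [t k] by
   [T ((1 - la') * t k)], the relative increment becoming [u / la']. For larger [u] the triangle
   inequality suffices, as [u / la' >= 1]. *)
rewrite -c1; have [ule|uge] := leP u la'.
  have ul1 : 0 <= u / la' <= 1 by rewrite ul0 ler_pdivrMr// mul1r.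
  have -> : (fun k => T ((1 + u) * t k) (x k) - T (t k) (x k)) =
      (fun k => T ((1 - la') * t k) (T ((1 + u / la') * (la' * t k)) (x k) - T (la' * t k) (x k))).
    apply/funext => k.
    have a0 : 0 <= (1 - la') * t k by rewrite mulr_ge0// subr_ge0 ltW.
    have a1 : 0 <= la' * t k by rewrite mulr_ge0// ltW.
    have a2 : 0 <= (1 + u / la') * (la' * t k) by rewrite mulr_ge0// addr_ge0.
    rewrite (linearB_op _ _ (sg_linear a0)) -!sg_add//.
    by congr (T _ _ - T _ _); [field; exact: lt0r_neq0|ring].
  apply: le_trans (hM _ _) _.
    move=> k; rewrite mulr_gt0 ?subr_gt0//=.
    apply: (@le_lt_trans _ _ (1 - la')); first by rewrite ler_piMr// subr_ge0 ltW.
    by rewrite ltrBlDr ltrDl.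
  apply: le_trans (ler_wpM2l M0 (key n t x _ ht ul1)) _.
  have W0 : 0 <= (M ^+ 4 + M ^+ 2) * (u / la') * N x.
    by rewrite mulr_ge0// mulr_ge0// addr_ge0// exprn_ge0.
  by apply: le_trans (_ : M * L * (u / la') * N x <= _); [rewrite !mulrA|rewrite lerDl].
have ul1 : 1 <= u / la' by rewrite ler_pdivlMr// mul1r ltW.
have up : 0 < u by exact: lt_trans uge.
apply: le_trans (snB sV _ _) _.
have h1 : N (fun k => T ((1 + u) * t k) (x k)) <= M ^+ 4 * N x.
  have -> : (fun k => T ((1 + u) * t k) (x k)) = (fun k => T (t k) (T (u * t k) (x k))).
    by apply/funext => k; rewrite -sg_add ?mulr_ge0//; congr (T _ _); ring.
  apply: le_trans (semigroup_R_bound _ ht) _.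
  have -> : M ^+ 4 * N x = M ^+ 2 * (M ^+ 2 * N x) by ring.
  rewrite ler_wpM2l ?exprn_ge0// semigroup_R_bound// => k.
  by rewrite mulr_gt0//=; exact: mulr_ile1 u0 (t0' k) u1 (t1 k).
apply: le_trans (lerD h1 (semigroup_R_bound _ ht)) _.
rewrite -mulrDl; apply: le_trans (_ : (M ^+ 4 + M ^+ 2) * (u / la') * N x <= _).
  by rewrite ler_wpM2r// ler_peMr// addr_ge0// exprn_ge0.
by rewrite lerDr; apply: mulr_ge0 N0; apply: mulr_ge0 ul0; exact: mulr_ge0.
Qed.

End RLipschitz.
End Backward.

(** * The generator *)

Section RnormLimit.
Context {R : realType} {X : completeNormedModType R[i]}.
Local Notation sX := (@rnorm_seminorm R X).
Implicit Types (u v : nat -> X) (l : X).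

Definition rcvg u l := forall e : R, 0 < e ->
  exists i0, forall i, (i0 <= i)%N -> rnorm (u i - l) <= e.

Lemma half_pow_small (c e : R) : 0 < e ->
  exists i0, forall i, (i0 <= i)%N -> c / 2 ^+ i <= e.
Proof.
move=> e0; exists (Num.truncn (`|c| / e)).+1 => i hi.
have p2 : 0 < 2 ^+ i :> R by rewrite exprn_gt0.
rewrite ler_pdivrMr//; apply: le_trans (ler_norm c) _.
rewrite -ler_pdivrMl// mulrC.
have ce : 0 <= `|c| / e by rewrite divr_ge0// ltW.
have /andP[_ /ltW h] := truncn_itv ce; apply: le_trans h _.
by rewrite -natrX ler_nat; apply: leq_trans hi _; rewrite ltnW// ltn_expl.
Qed.

Lemma le_eps (a b c : R) : (forall e, 0 < e -> a <= b + c * e) -> a <= b.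
Proof.
move=> H; rewrite leNgt; apply/negP => ba.
have c1 : 0 < 1 + `|c| by rewrite ltr_pwDl.
have e0 : 0 < (a - b) / (2 * (1 + `|c|)) by rewrite divr_gt0 ?subr_gt0// mulr_gt0.
have := H _ e0; set e := (a - b) / _ => h.
have E : e * (2 * (1 + `|c|)) = a - b by rewrite /e divfK// gt_eqF// mulr_gt0.
have : c * e <= `|c| * e by rewrite ler_wpM2r ?(ltW e0)// ler_norm.
have : 0 < e by []; nra.
Qed.

Lemma rcvg_unique u l l' : rcvg u l -> rcvg u l' -> l = l'.
Proof.
move=> ul ul'; apply/eqP; rewrite -subr_eq0; apply/eqP/rnorm0_eq0/eqP.
rewrite eq_le rnorm_ge0 andbT; apply: (@le_eps _ _ 2) => e e0.
have [i0 h0] := ul e e0; have [i1 h1] := ul' e e0.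
have := h0 (maxn i0 i1) (leq_maxl _ _); have := h1 (maxn i0 i1) (leq_maxr _ _).
have := sn_triangle sX (u (maxn i0 i1)) l l'.
rewrite (snBC sX l (u _)) add0r; lra.
Qed.

Lemma rcvg_shift u l : rcvg u l -> rcvg (fun i => u i.+1) l.
Proof.
by move=> ul e e0; have [i0 h] := ul e e0; exists i0 => i hi; apply/h/leqW.
Qed.

Lemma rcvgD u v l l' : rcvg u l -> rcvg v l' -> rcvg (fun i => u i + v i) (l + l').
Proof.
move=> ul vl e e0; have e2 : 0 < e / 2 by rewrite divr_gt0.
have [i0 h0] := ul _ e2; have [i1 h1] := vl _ e2.
exists (maxn i0 i1) => i; rewrite geq_max => /andP[/h0 + /h1].
rewrite opprD addrACA.
by have := snD sX (u i - l) (v i - l'); lra.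
Qed.

Lemma rcvg_op u l (S : X -> X) (B : R) : linear S ->
  (forall x, rnorm (S x) <= B * rnorm x) -> rcvg u l -> rcvg (fun i => S (u i)) (S l).
Proof.
move=> lS hB ul e e0.
have B1 : 0 < 1 + `|B| by rewrite ltr_pwDl.
have e1 : 0 < e / (1 + `|B|) by rewrite divr_gt0.
have [i0 h0] := ul _ e1; exists i0 => i /h0.
rewrite -(linearB_op _ _ lS) ler_pdivlMr// => h.
apply: le_trans (hB _) _; have := ler_norm B; have := rnorm_ge0 (u i - l); nra.
Qed.

Lemma rcvgZ u l (a : R[i]) : rcvg u l -> rcvg (fun i => a *: u i) (a *: l).
Proof.
apply: (rcvg_op (S := fun x => a *: x) (B := normc a)).
  by move=> b x y; rewrite scalerDr !scalerA mulrC.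
by move=> x; rewrite (snZ sX).
Qed.

Lemma rcvg_le u l (c : R) : rcvg u l -> (forall i, rnorm (u i) <= c) -> rnorm l <= c.
Proof.
move=> ul h; apply: (@le_eps _ _ 1) => e e0; have [i0 h0] := ul e e0.
have := h0 i0 (leqnn _); have := h i0; have := snBl sX l (u i0).
by rewrite (snBC sX l) mul1r; lra.
Qed.

Lemma rcvg_linear (U : nat -> X -> X) (S : X -> X) : (forall i, linear (U i)) ->
  (forall x, rcvg (U^~ x) (S x)) -> linear S.
Proof.
move=> lU US a x y; apply: rcvg_unique (US _) _.
have := rcvgD (rcvgZ a (US x)) (US y).
by congr rcvg; apply/funext => i; rewrite (lU i).
Qed.

(** Completeness of [X] enters through this lemma, for the generator and for the power series
    alike. *)
Lemma geometric_cvg u (c : R) : (forall i, rnorm (u i.+1 - u i) <= c / 2 ^+ i) ->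
  exists2 l, rcvg u l & forall i, rnorm (u i - l) <= 2 * c / 2 ^+ i.
Proof.
move=> h.
have c0 : 0 <= c.
  by have := le_trans (rnorm_ge0 _) (h 0%N); rewrite expr0 divr1.
have K i k : rnorm (u (i + k)%N - u i) <= 2 * c / 2 ^+ i - 2 * c / 2 ^+ (i + k).
  elim: k => [|k IH]; first by rewrite addn0 !subrr (sn0 sX).
  rewrite addnS; apply: le_trans (sn_triangle sX (u (i + k)%N) _ _) _.
  have := h (i + k)%N.
  have -> : c / 2 ^+ (i + k) = 2 * c / 2 ^+ (i + k) - 2 * c / 2 ^+ (i + k).+1.
    by rewrite exprS; field; rewrite expf_neq0.
  by move: IH; lra.
have K2 i k : (i <= k)%N -> rnorm (u k - u i) <= 2 * c / 2 ^+ i.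
  move=> ik; rewrite -(subnKC ik); apply: le_trans (K _ _) _.
  by rewrite lerBlDr lerDl divr_ge0 ?exprn_ge0// mulr_ge0.
have cu : cauchy (u @ \oo).
  apply: cauchy_exP => e e0.
  have ce : e = (complex.Re e)%:C by rewrite RRe_real// ger0_real// ltW.
  have e'0 : 0 < complex.Re e / 2 by move: e0; rewrite {1}ce ltcR => ?; rewrite divr_gt0.
  have [i0 h0] := half_pow_small (2 * c) e'0.
  exists (u i0); exists i0 => // k /= ik; rewrite -ball_normE /=.
  rewrite distrC rnormE ce ltcR; apply: le_lt_trans (K2 _ _ ik) _.
  by apply: le_lt_trans (h0 _ (leqnn _)) _; lra.
pose l := lim (u @ \oo).
have ul : u @ \oo --> l by exact: cauchy_cvg cu.
move: ul => /cvgrPdist_le ul.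
have rl : rcvg u l.
  move=> e e0; have := ul e%:C; rewrite ltcR => /(_ e0)[i0 _ hi0].
  by exists i0 => i /hi0 /=; rewrite distrC rnormE lecR.
exists l => // i; apply: (@le_eps _ _ 1) => e e0; have [i0 h0] := rl e e0.
have := h0 (maxn i i0) (leq_maxr _ _); have := K2 _ _ (leq_maxl i i0).
have := sn_triangle sX (u (maxn i i0)) (u i) l.
by rewrite (snBC sX (u i) (u _)) mul1r; lra.
Qed.

Lemma bounded_continuous (S : X -> X) (B : R) : linear S ->
  (forall x, rnorm (S x) <= B * rnorm x) -> bounded_operator S.
Proof.
move=> lS hB; split=> // x; apply/cvgrPdist_le => e e0.
have ce : e = (complex.Re e)%:C by rewrite RRe_real// ger0_real// ltW.
have e'0 : 0 < complex.Re e by move: e0; rewrite {1}ce ltcR.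
have B1 : 0 < 1 + `|B| by rewrite ltr_pwDl.
apply/nbhs_ballP; exists (complex.Re e / (1 + `|B|))%:C => /=; first by rewrite ltcR divr_gt0.
move=> y; rewrite -ball_normE /= rnormE ltcR ltr_pdivlMr// => h.
rewrite -(linearB_op _ _ lS) rnormE ce lecR.
apply: le_trans (hB _) _; have := ler_norm B; have := rnorm_ge0 (x - y); nra.
Qed.

End RnormLimit.

(** With [e = min c 1] and [k = 1 - e ^ 2 / 4] one has [k ^ 2 * (1 + e ^ 2) >= 1], so
    [complex.Re z > k * normc z] forces the imaginary part below [e * complex.Re z]. *)
Lemma sector_cone (R : realType) (c : R) : 0 < c -> exists2 delta : R, 0 < delta &
  forall z : R[i], sector delta z -> 0 < complex.Re z /\ `|complex.Im z| <= c * complex.Re z.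
Proof.
move=> c0; pose e := Num.min c 1.
have e0 : 0 < e by rewrite lt_min c0 ltr01.
have ec : e <= c by rewrite ge_min lexx.
have e1 : e <= 1 by rewrite ge_min lexx orbT.
pose k := 1 - e ^+ 2 / 4.
have k0 : 0 < k by rewrite /k; nra.
have k1 : k < 1 by rewrite /k; nra.
have kitv : -1 <= k <= 1 by apply/andP; split; lra.
have kk : 1 <= k ^+ 2 * (1 + e ^+ 2).
  have : e ^+ 2 <= 1 by rewrite exprn_ile1// ltW.
  have : 0 <= e ^+ 2 by rewrite exprn_ge0// ltW.
  rewrite /k; move: (e ^+ 2) => w w0 w1; nra.
have ck : cos (acos k) = k by apply: acosK; rewrite in_itv.
have d0 : 0 < acos k.
  rewrite lt_def acos_ge0// andbT; apply/eqP => h.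
  by move: ck; rewrite h cos0 => h1; move: k1; rewrite -h1 ltxx.
exists (acos k) => // z [z0]; rewrite normr_carg// => h.
have nz : 0 < normc z by rewrite normc_gt0.
have r_itv := ratio_itv z0.
have {h} : k < complex.Re z / normc z.
  have e' : cos (acos (complex.Re z / normc z)) = complex.Re z / normc z.
    by apply: acosK; rewrite in_itv.
  by rewrite -e' -{1}ck ltr_cos// in_itv /= ?acos_ge0 ?acos_lepi.
rewrite ltr_pdivlMr// => h.
have kn : 0 < k * normc z by rewrite mulr_gt0.
have Re0 : 0 < complex.Re z by exact: lt_trans h.
split=> //; apply: (@le_trans _ _ (e * complex.Re z)); last by rewrite ler_wpM2r// ltW.
rewrite -ler_sqr ?nnegrE// ?mulr_ge0 ?(ltW e0) ?(ltW Re0)//.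
rewrite real_normK ?num_real// exprMn.
have h2 : (k * normc z) ^+ 2 <= complex.Re z ^+ 2 by rewrite lerXn2r ?nnegrE ?ltW.
move: h2; rewrite exprMn sqr_normcE; have := sqr_ge0 (complex.Im z).
have := sqr_ge0 e; have := sqr_ge0 (complex.Re z).
move: kk; move: (e ^+ 2) (k ^+ 2) (complex.Re z ^+ 2) (complex.Im z ^+ 2) => E K r i.
nra.
Qed.

(** * Power series with geometrically bounded coefficients *)

Section PowerSeries.
Context {R : realType} {X : completeNormedModType R[i]}.
Local Notation sX := (@rnorm_seminorm R X).
Variables (b : nat -> X) (K kappa rho : R).
Hypotheses (K0 : 0 <= K) (kappa0 : 0 <= kappa) (rho0 : 0 < rho) (rk : rho * kappa <= 1 / 4).
Hypothesis hb : forall n, rnorm (b n) <= K * kappa ^+ n.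

(** The ratio [2 * rho * kappa] is at most [1 / 2]. Allowing [(2 * rho) ^+ n] instead of [rho ^+ n]
    makes room for the factor [n] of derivatives and for Taylor remainders. *)
Lemma series_rcvg (c : nat -> R[i]) (al : R) : 0 <= al ->
  (forall n, normc (c n) <= al * (2 * rho) ^+ n) ->
  exists2 l, rcvg (fun m => \sum_(n < m) c n *: b n) l & rnorm l <= 2 * al * K.
Proof.
move=> al0 hc.
have [i|l hl el] := @geometric_cvg _ _ (fun m => \sum_(n < m) c n *: b n) (al * K).
  rewrite big_ord_recr /= addrAC subrr add0r (snZ sX).
  apply: le_trans (ler_pM (normc_ge0 _) (rnorm_ge0 _) (hc i) (hb i)) _.
  have -> : al * (2 * rho) ^+ i * (K * kappa ^+ i) = al * K * (2 * (rho * kappa)) ^+ i.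
    by rewrite !exprMn; ring.
  apply: ler_wpM2l; first exact: mulr_ge0.
  rewrite -exprVn; apply: lerXn2r; rewrite ?nnegrE ?invr_ge0 ?mulr_ge0 ?(ltW rho0)//.
  by rewrite -div1r; move: rk; lra.
exists l => //; have := el 0%N.
by rewrite big_ord0 sub0r (snN sX) expr0 divr1 mulrA.
Qed.

Lemma power_bound (y : R[i]) n : normc y <= rho -> normc (y ^+ n) <= 1 * (2 * rho) ^+ n.
Proof.
move=> yr; rewrite mul1r normcX lerXn2r ?nnegrE ?normc_ge0//.
  by rewrite mulr_ge0// ltW.
by apply: le_trans yr _; move: rho0; lra.
Qed.

Lemma power_derivative_bound (y : R[i]) n : normc y <= rho ->
  normc (n%:R * y ^+ n.-1) <= rho^-1 * (2 * rho) ^+ n.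
Proof.
move=> yr; rewrite normcM normcX normc_nat.
case: n => [|n]; first by rewrite mul0r expr0 mulr1 invr_ge0 ltW.
have -> : rho^-1 * (2 * rho) ^+ n.+1 = 2 ^+ n.+1 * rho ^+ n.
  by rewrite exprMn [rho ^+ n.+1]exprS; field; exact: lt0r_neq0.
apply: ler_pM => //; first by rewrite exprn_ge0// normc_ge0.
  by rewrite -natrX ler_nat ltnW// ltn_expl.
by rewrite lerXn2r ?nnegrE ?normc_ge0// ltW.
Qed.

(** One step of the induction multiplies the old remainder by [y + h] and adds [h ^+ 2] times a
    derivative; both parts obey the same bound, whence the base [2 * rho]. *)
Lemma power_taylor_bound (y h : R[i]) n : normc y <= rho -> normc (y + h) <= rho ->
  normc ((y + h) ^+ n - y ^+ n - h * (n%:R * y ^+ n.-1)) <=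
  normc h ^+ 2 / rho ^+ 2 * (2 * rho) ^+ n.
Proof.
move=> yr yhr; have h0 := normc_ge0 h.
have r2 : 0 < rho ^+ 2 by rewrite exprn_gt0.
elim: n => [|n IH].
  rewrite !expr0 mul0r mulr0 subr0 subrr normc0 mulr1.
  by rewrite divr_ge0 ?exprn_ge0// ltW.
have -> : (y + h) ^+ n.+1 - y ^+ n.+1 - h * (n.+1%:R * y ^+ n.+1.-1) =
    (y + h) * ((y + h) ^+ n - y ^+ n - h * (n%:R * y ^+ n.-1)) +
    h ^+ 2 * (n%:R * y ^+ n.-1).
  case: n {IH} => [|n] /=; first by rewrite !expr0; ring.
  by rewrite [(y + h) ^+ n.+2]exprS [y ^+ n.+2]exprS [y ^+ n.+1]exprS -[n.+2%:R]natr1; ring.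
apply: le_trans (normcD _ _) _; rewrite normcM [normc (h ^+ 2 * _)]normcM normcX.
apply: le_trans (lerD (ler_pM (normc_ge0 _) (normc_ge0 _) yhr IH)
  (ler_wpM2l (exprn_ge0 2 h0) (power_derivative_bound n yr))) _.
have r0' : rho != 0 by rewrite gt_eqF.
have -> : normc h ^+ 2 / rho ^+ 2 * (2 * rho) ^+ n.+1 =
    rho * (normc h ^+ 2 / rho ^+ 2 * (2 * rho) ^+ n) + normc h ^+ 2 * (rho^-1 * (2 * rho) ^+ n).
  by rewrite [(2 * rho) ^+ n.+1]exprS; field.
by [].
Qed.

End PowerSeries.

Lemma iter_bound (R : realType) (V : lmodType R[i]) (N : V -> R) (S : V -> V) (B : R) n x :
  0 <= B -> (forall y, N (S y) <= B * N y) -> N (iter n S x) <= B ^+ n * N x.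
Proof.
move=> B0 h; elim: n => [|n IH]; first by rewrite expr0 mul1r.
rewrite iterS exprS -mulrA; apply: le_trans (h _) _.
by rewrite ler_wpM2l.
Qed.

(** * Difference quotients, the generator and its powers *)

Section Generator.
Context {R : realType} {X : completeNormedModType R[i]}.
Variables (p : R) (T : R -> X -> X).
Hypothesis p1 : 1 <= p.
Hypothesis hT : C0_semigroup T.
Local Notation sX := (@rnorm_seminorm R X).
Local Notation N := (rad_norm p).
Variables (M C : R).
Hypothesis M1 : 1 <= M.
Hypothesis hM : forall n (t : 'I_n -> R) (x : 'I_n -> X),
  (forall k, 0 < t k < 1) -> N (fun k => T (t k) (x k)) <= M * N x.
Hypothesis C1 : 1 <= C.
Hypothesis hC : forall n (t : 'I_n -> R) (x : 'I_n -> X) u,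
  (forall k, 0 < t k <= 1) -> 0 <= u <= 1 ->
  N (fun k => T ((1 + u) * t k) (x k) - T (t k) (x k)) <= C * u * N x.

Let M0 : 0 <= M. Proof. exact: le_trans M1. Qed.
Let C0 : 0 <= C. Proof. exact: le_trans C1. Qed.
Let lT := @sg_linear _ _ _ hT.
Let TD := @sg_add _ _ _ hT.

Lemma semigroup_bound (tau : R) : exists2 B : R, 0 <= B &
  forall s x, 0 <= s <= tau -> rnorm (T s x) <= B * rnorm x.
Proof.
pose m := (Num.truncn `|tau|).+1; have m0 : 0 < m%:R :> R by rewrite ltr0n.
exists (M ^+ m); first by rewrite exprn_ge0.
move=> s x /andP[]; rewrite le_eqVlt => /predU1P[<- _|s0 st].
  by rewrite (sg_0 hT) ler_peMl ?rnorm_ge0// exprn_ege1.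
have sm0 : 0 < s / m%:R by rewrite divr_gt0.
have sm1 : s / m%:R < 1.
  rewrite ltr_pdivrMr// mul1r; apply: le_lt_trans st _.
  by apply: le_lt_trans (ler_norm _) _; have /andP[] := truncn_itv (normr_ge0 tau).
have h y : rnorm (T (s / m%:R) y) <= M * rnorm y.
  have := hM (t := fun _ : 'I_1 => s / m%:R) (fun=> y).
  by rewrite !(rad_norm_ord1 p1); apply; rewrite sm0.
have -> : T s x = iter m (T (s / m%:R)) x.
  have it := iter_semigroup (sg_0 hT) (fun s t x => @sg_D _ _ _ hT s t x).
  by rewrite it ?(ltW sm0)//; congr (T _ x); field; rewrite gt_eqF.
exact: iter_bound.
Qed.

(** [hC] with one component measures increments relative to a time [r <= 1]; [T (t - r)] carries the
    estimate from [r = min t 1] to [t], and increments beyond [r] are covered by the triangle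
    inequality. *)
Lemma semigroup_lip t : 0 < t -> exists2 L : R, 0 <= L &
  forall d x, 0 <= d <= 1 -> rnorm (T (t + d) x - T t x) <= L * d * rnorm x.
Proof.
move=> t0; have [B B0 hB] := semigroup_bound (t + 1).
pose r := Num.min t 1.
have r0 : 0 < r by rewrite lt_min t0 ltr01.
have rt : r <= t by rewrite ge_min lexx.
have r1 : r <= 1 by rewrite ge_min lexx orbT.
exists ((B * C + 2 * B) / r); first by rewrite divr_ge0 ?(ltW r0)// addr_ge0 ?mulr_ge0.
move=> d x /andP[d0 d1]; have rx := rnorm_ge0 x.
have -> : (B * C + 2 * B) / r * d * rnorm x = B * (C * (d / r) * rnorm x) + 2 * B * (d / r) * rnorm x.
  by ring.
have dr0 : 0 <= d / r by rewrite divr_ge0 ?(ltW r0).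
have h1 : 0 <= B * (C * (d / r) * rnorm x).
  exact: mulr_ge0 B0 (mulr_ge0 (mulr_ge0 C0 dr0) rx).
have h2 : 0 <= 2 * B * (d / r) * rnorm x.
  exact: mulr_ge0 (mulr_ge0 (mulr_ge0 (ler0n _ 2) B0) dr0) rx.
have [dr|rd] := leP d r.
  have tr0 : 0 <= t - r by rewrite subr_ge0.
  have -> : T (t + d) x - T t x = T (t - r) (T ((1 + d / r) * r) x - T r x).
    have a0 : 0 <= (1 + d / r) * r by rewrite mulr_ge0 ?(ltW r0)// addr_ge0.
    rewrite (linearB_op _ _ (lT tr0)) -!TD ?(ltW r0)//.
    by congr (T _ _ - T _ _); [field; exact: lt0r_neq0|ring].
  apply: le_trans (hB _ _ _) _; first by rewrite tr0 lerBlDr -addrA lerDl addr_ge0 ?(ltW r0).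
  rewrite -[leLHS]addr0; apply: lerD => //; apply: ler_wpM2l => //.
  have := hC (t := fun _ : 'I_1 => r) (fun=> x) (u := d / r).
  rewrite !(rad_norm_ord1 p1); apply; first by rewrite r0.
  by rewrite dr0 ler_pdivrMr// mul1r.
have : 1 <= d / r by rewrite ler_pdivlMr// mul1r ltW.
have := hB (t + d) x; have := hB t x.
rewrite (ltW t0) lerDl ler01 => /(_ isT) e1.
rewrite addr_ge0 ?(ltW t0)// lerD2l d1 => /(_ isT) e2 h3.
have := snB sX (T (t + d) x) (T t x).
have : 2 * B * rnorm x <= 2 * B * (d / r) * rnorm x.
  by rewrite ler_wpM2r// ler_peMr// mulr_ge0.
by lra.
Qed.

(** The second difference factors as [(T (t / 2 + d) - T (t / 2)) (T (t / 2 + e) - T (t / 2))], a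
    product of two Lipschitz bounds. *)
Lemma second_difference t : 0 < t -> exists2 K : R, 0 <= K &
  forall d e x, 0 <= d <= 1 -> 0 <= e <= 1 ->
  rnorm (T (t + d + e) x - T (t + d) x - (T (t + e) x - T t x)) <= K * d * e * rnorm x.
Proof.
move=> t0; have t2 : 0 < t / 2 by rewrite divr_gt0.
have [L L0 hL] := semigroup_lip t2.
exists (L * L); first exact: mulr_ge0.
move=> d e x hd he; have /andP[d0 _] := hd; have /andP[e0 _] := he.
set y := T (t / 2 + e) x - T (t / 2) x.
have te0 : 0 <= t / 2 + e by rewrite addr_ge0 ?(ltW t2).
have td0 : 0 <= t / 2 + d by rewrite addr_ge0 ?(ltW t2).
have -> : T (t + d + e) x - T (t + d) x - (T (t + e) x - T t x) =
    T (t / 2 + d) y - T (t / 2) y.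
  rewrite /y !(linearB_op _ _ (lT _)) ?(ltW t2)// -!TD ?(ltW t2)//.
  by congr (T _ _ - T _ _ - (T _ _ - T _ _)); field.
apply: le_trans (hL d y hd) _.
have -> : L * L * d * e * rnorm x = L * d * (L * e * rnorm x) by ring.
by rewrite ler_wpM2l ?mulr_ge0// hL.
Qed.

Definition quotient (i : nat) (x : X) : X := (2 ^+ i)%:C *: (T (2 ^+ i)^-1 x - x).

(* Where the dyadic difference quotients diverge the value is the junk 0; they
   converge on the range of every [T t] with [0 < t]. *)
Definition generator (x : X) : X := xget 0 [set l | rcvg (fun i => quotient i x) l].

Local Notation q := quotient.
Local Notation A := generator.

Lemma generatorE x l : rcvg (fun i => q i x) l -> A x = l.
Proof. by move=> h; apply: xget_unique => // l' h'; exact: rcvg_unique h' h. Qed.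

Let half_itv (i : nat) : 0 <= (2 ^+ i : R)^-1 <= 1.
Proof. by rewrite invr_ge0 exprn_ge0//= invf_le1 ?exprn_gt0// exprn_ege1// ler1n. Qed.

Let pow2_gt0 (i : nat) : 0 < 2 ^+ i :> R. Proof. exact: exprn_gt0. Qed.

Lemma quotientE i t x : 0 <= t ->
  q i (T t x) = (2 ^+ i)%:C *: (T (t + (2 ^+ i)^-1) x - T t x).
Proof.
by move=> t0; rewrite [t + _]addrC TD//; case/andP: (half_itv i).
Qed.

Lemma second_difference_scale (c : R[i]) (u v w : X) :
  (c + c) *: (u - w) - c *: (v - w) = - c *: (v - u - (u - w)).
Proof.
rewrite -[v - w](subrKA u) scaleNr -scalerN opprB [RHS]scalerBr scalerDl.
by rewrite [v - u + _]addrC [c *: (u - w + _)]scalerDr addrKA.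
Qed.

(* [q i.+1 - q i] is [- 2 ^ i (T d - 1) ^ 2] with [d = 2 ^ - (i + 1)]. *)
Lemma generator_rcvg t x : 0 < t -> rcvg (fun i => q i (T t x)) (A (T t x)).
Proof.
move=> t0; have [K K0 hK] := second_difference t0.
suff [l hl _] : exists2 l, rcvg (fun i => q i (T t x)) l &
    forall i, rnorm (q i (T t x) - l) <= 2 * (K * rnorm x) / 2 ^+ i.
  by rewrite (generatorE hl).
apply: geometric_cvg => i.
pose d : R := (2 ^+ i.+1)^-1.
have d2 : (2 ^+ i)^-1 = d + d :> R.
  by rewrite /d exprS; field; rewrite expf_neq0.
have hd : 0 <= d <= 1 := half_itv i.+1.
have := hK d d x hd hd.
rewrite !quotientE ?(ltW t0)// -/d d2.
have -> : (2 ^+ i.+1)%:C *: (T (t + d) x - T t x) - (2 ^+ i)%:C *: (T (t + (d + d)) x - T t x)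
   = (- (2 ^+ i)%:C) *: (T (t + d + d) x - T (t + d) x - (T (t + d) x - T t x)).
  by rewrite exprS mulr_natl rmorphMn mulr2n [t + (d + d)]addrA second_difference_scale.
rewrite (snZ sX) normcN normcR gtr0_norm// => h.
apply: le_trans (ler_wpM2l (ltW (pow2_gt0 i)) h) _.
have -> : 2 ^+ i * (K * d * d * rnorm x) = K * rnorm x * (d + d) * (1 / 4).
  by rewrite /d exprS; field; rewrite expf_neq0.
have W : 0 <= K * rnorm x * (d + d).
  by rewrite -d2; exact: divr_ge0 (mulr_ge0 K0 (rnorm_ge0 x)) (ltW (pow2_gt0 i)).
lra.
Qed.

Lemma quotient_linear i t : 0 <= t -> linear (fun x => q i (T t x)).
Proof.
move=> t0; have /andP[h0 _] := half_itv i.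
apply: linear_scale_op; apply: (linear_sub_op (f := fun x => T _ (T t x))); last exact: lT.
by move=> a x y; rewrite (lT t0) (lT h0).
Qed.

(** Because of the default value, [generator] alone need not be linear; only its compositions with
    [T t] are used as linear maps. *)
Lemma generator_linear t : 0 < t -> linear (fun x => A (T t x)).
Proof.
move=> t0; apply: (rcvg_linear (U := fun i x => q i (T t x))).
  by move=> i; exact/quotient_linear/ltW.
by move=> x; exact: generator_rcvg.
Qed.

Lemma generator_bound t : 0 < t -> exists2 L : R, 0 <= L &
  forall x, (forall i, rnorm (q i (T t x)) <= L * rnorm x) /\ rnorm (A (T t x)) <= L * rnorm x.
Proof.
move=> t0; have [L L0 hL] := semigroup_lip t0; exists L => // x.
suff H i : rnorm (q i (T t x)) <= L * rnorm x.
  by split=> //; apply: rcvg_le (generator_rcvg x t0) _.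
rewrite quotientE ?(ltW t0)// (snZR sX) ?(ltW (pow2_gt0 i))//.
apply: le_trans (ler_wpM2l (ltW (pow2_gt0 i)) (hL _ x (half_itv i))) _.
by rewrite mulrA mulrCA mulfV ?gt_eqF// mulr1.
Qed.

Lemma generator_commute s t x : 0 <= s -> 0 < t -> A (T s (T t x)) = T s (A (T t x)).
Proof.
move=> s0 t0; apply: generatorE; have [B B0 hB] := semigroup_bound s.
have := rcvg_op (lT s0) (B := B) _ (generator_rcvg x t0).
have -> : (fun i => T s (q i (T t x))) = (fun i => q i (T s (T t x))).
  apply/funext => i; have /andP[h0 _] := half_itv i.
  rewrite /quotient (linearZ_op _ _ (lT s0)) (linearB_op _ _ (lT s0)).
  by rewrite -!TD ?addr_ge0 ?(ltW t0)//; congr (_ *: (T _ _ - _)); ring.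
by apply => y; apply: hB; rewrite s0 lexx.
Qed.

(** The quotients converge along dyadic steps only. A real [a] is approximated by a multiple [m d]
    of [d = 2 ^ - i]; summing second differences gives [T (t + m d) - T t = m (T (t + d) - T t)] up
    to [K * (m d) ^ 2], and all other errors vanish as [i] grows. *)
Lemma generator_taylor t : 0 < t -> exists2 K : R, 0 <= K & forall a x, 0 <= a <= 1 ->
  rnorm (T (t + a) x - T t x - a%:C *: A (T t x)) <= K * a ^+ 2 * rnorm x.
Proof.
move=> t0; have [K K0 hK] := second_difference t0; exists K => // a x /andP[a0 a1].
have [L L0 hL] := semigroup_lip t0; have [B B0 hB] := semigroup_bound 1.
have [L' L'0 hL'] := generator_bound t0; have [hq _] := hL' x.
have rx := rnorm_ge0 x.
have mult d m : 0 <= d -> m%:R * d <= 1 ->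
    rnorm (T (t + m%:R * d) x - T t x - m%:R%:C *: (T (t + d) x - T t x)) <=
    K * (m%:R * d) ^+ 2 * rnorm x.
  move=> d0; elim: m => [|m IH].
    by rewrite mul0r addr0 subrr scale0r subrr (sn0 sX) expr0n mulr0 mul0r.
  rewrite -natr1 mulrDl mul1r => md.
  have md0 : 0 <= m%:R * d by rewrite mulr_ge0.
  have h1 : 0 <= m%:R * d <= 1 by rewrite md0; lra.
  have h2 : 0 <= d <= 1 by rewrite d0; lra.
  have := hK _ _ x h1 h2; have := IH ltac:(lra).
  have -> : T (t + (m%:R * d + d)) x - T t x - (m%:R + 1)%:C *: (T (t + d) x - T t x) =
     (T (t + m%:R * d) x - T t x - m%:R%:C *: (T (t + d) x - T t x)) +
     (T (t + m%:R * d + d) x - T (t + m%:R * d) x - (T (t + d) x - T t x)).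
    rewrite rmorphD /= scalerDl scale1r [t + (_ + d)]addrA opprD addrA.
    rewrite [RHS]addrA; congr (_ - _).
    by rewrite addrAC [RHS]addrC [_ + (_ - _ - _)]addrA [_ + (_ - T t x)]addrA subrK.
  move=> e1 e2; apply: le_trans (snD sX _ _) _.
  have := mulr_ge0 (mulr_ge0 K0 (mulr_ge0 md0 d0)) rx.
  have := mulr_ge0 (mulr_ge0 K0 (mulr_ge0 d0 d0)) rx.
  by rewrite !expr2; lra.
apply: (@le_eps _ _ _ ((B * L + L') * rnorm x + 1)) => e e0.
have [i0 h0] := generator_rcvg x t0 e0.
have [i1 h1] := half_pow_small 1 e0.
pose i := maxn i0 i1; have {h0} h0 := h0 i (leq_maxl _ _).
have {h1} := h1 i (leq_maxr _ _); rewrite mul1r.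
set d := (2 ^+ i)^-1 => h1.
have hd : 0 <= d <= 1 := half_itv i; have /andP[d0 d1] := hd.
have a2 : 0 <= a * 2 ^+ i by rewrite mulr_ge0// ltW.
have /andP[m1 m2] := truncn_itv a2; set m := Num.truncn _ in m1 m2.
have e2 : a = a * 2 ^+ i * d by rewrite /d mulfK// gt_eqF.
have ma : m%:R * d <= a by rewrite [leRHS]e2 ler_wpM2r.
have am : a - m%:R * d <= d.
  rewrite lerBlDl; have -> : m%:R * d + d = m.+1%:R * d by rewrite -natr1 mulrDl mul1r.
  by rewrite [leLHS]e2 ler_wpM2r// ltW.
have md0 : 0 <= m%:R * d by rewrite mulr_ge0.
have := mult d m d0 (le_trans ma a1).
have -> : m%:R%:C *: (T (t + d) x - T t x) = (m%:R * d)%:C *: q i (T t x).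
  rewrite quotientE ?(ltW t0)// scalerA -rmorphM /= -/d.
  by rewrite -mulrA mulVf ?mulr1// gt_eqF.
set qi := q i (T t x) in h0 *; move=> h2.
have h3 : rnorm (T (t + a) x - T (t + m%:R * d) x) <= B * (L * d * rnorm x).
  have r0 : 0 <= a - m%:R * d by rewrite subr_ge0.
  have -> : T (t + a) x - T (t + m%:R * d) x =
      T (m%:R * d) (T (t + (a - m%:R * d)) x - T t x).
    rewrite (linearB_op _ _ (lT md0)) -!TD ?(ltW t0)// ?(addr_ge0 (ltW t0) r0)//.
    by congr (T _ _ - T _ _); ring.
  apply: le_trans (hB _ _ _) _; first by rewrite md0 (le_trans ma).
  rewrite ler_wpM2l//; apply: le_trans (hL _ _ _) _.
    by rewrite r0 (le_trans am).
  by rewrite ler_wpM2r// ler_wpM2l.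
have h4 : rnorm ((m%:R * d)%:C *: qi - a%:C *: A (T t x)) <= d * (L' * rnorm x) + e.
  have -> : (m%:R * d)%:C *: qi - a%:C *: A (T t x) =
     a%:C *: (qi - A (T t x)) - (a - m%:R * d)%:C *: qi.
    by rewrite scalerBr rmorphB /= scalerBl opprB [RHS]addrC subrKA.
  have r0 : 0 <= a - m%:R * d by rewrite subr_ge0.
  apply: le_trans (snB sX _ _) _.
  rewrite (snZR sX (qi - A (T t x)) a0) (snZR sX qi r0) addrC; apply: lerD.
    by apply: ler_pM => //; [exact: rnorm_ge0|exact: hq].
  by apply: le_trans (ler_piMl _ a1) h0; exact: rnorm_ge0.
have -> : T (t + a) x - T t x - a%:C *: A (T t x) =
   (T (t + a) x - T (t + m%:R * d) x) +
   ((T (t + m%:R * d) x - T t x - (m%:R * d)%:C *: qi) +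
   ((m%:R * d)%:C *: qi - a%:C *: A (T t x))).
  by rewrite subrKA addrA subrKA.
apply: le_trans (snD sX _ _) _.
apply: le_trans (lerD h3 (le_trans (snD sX _ _) (lerD h2 h4))) _.
have h5 : K * (m%:R * d) ^+ 2 * rnorm x <= K * a ^+ 2 * rnorm x.
  by rewrite ler_wpM2r// ler_wpM2l// lerXn2r ?nnegrE.
have h6 : d * ((B * L + L') * rnorm x) <= e * ((B * L + L') * rnorm x).
  by rewrite ler_wpM2r// mulr_ge0// addr_ge0// mulr_ge0.
lra.
Qed.


Lemma semigroup_operator_bound t : 0 <= t -> exists2 B : R, 0 <= B &
  forall x, rnorm (T t x) <= B * rnorm x.
Proof.
move=> t0; have [B B0 hB] := semigroup_bound t; exists B => // x.
by apply: hB; rewrite t0 lexx.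
Qed.

Definition derivative_n n t (x : X) : X := iter n A (T t x).
Local Notation D := derivative_n.

Lemma derivative_nD n s t x : 0 <= s -> 0 < t -> D n (s + t) x = T s (D n t x).
Proof.
elim: n s t x => [|n IH] s t x s0 t0; first by rewrite /D /= TD// ltW.
have t2 : 0 < t / 2 by rewrite divr_gt0.
have -> : D n.+1 (s + t) x = A (D n (s + t) x) by [].
have -> : D n.+1 t x = A (D n t x) by [].
rewrite IH//; have -> : D n t x = T (t / 2) (D n (t / 2) x).
  by rewrite -IH -?splitr// ltW.
exact: generator_commute.
Qed.

Lemma generator_derivative_n n a b x : 0 < a -> 0 < b ->
  A (T a (D n b x)) = D n.+1 (a + b) x.
Proof. by move=> a0 b0; rewrite -derivative_nD// ltW. Qed.

Lemma derivative_n_iter n a b x : 0 < a -> 0 < b ->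
  D n (n%:R * a + b) x = iter n (fun y => A (T a y)) (T b x).
Proof.
move=> a0 b0; elim: n => [|n IH]; first by rewrite mul0r add0r.
rewrite iterS -IH generator_derivative_n//.
  by rewrite -natr1 mulrDl mul1r addrAC addrC addrA.
by rewrite ltr_wpDl// mulr_ge0// ltW.
Qed.

Lemma derivative_n_linear n t : 0 < t -> linear (D n t).
Proof.
elim: n t => [|n IH] t t0; first exact/lT/ltW.
have t2 : 0 < t / 2 by rewrite divr_gt0.
move=> a x y; rewrite {1}[t]splitr -!generator_derivative_n// (IH _ t2).
by rewrite (generator_linear t2) !generator_derivative_n// -splitr.
Qed.

Lemma derivative_n_bounded n t : 0 < t -> exists2 B : R, 0 <= B &
  forall x, rnorm (D n t x) <= B * rnorm x.
Proof.
elim: n t => [|n IH] t t0; first exact/semigroup_operator_bound/ltW.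
have t2 : 0 < t / 2 by rewrite divr_gt0.
have [L L0 hL] := generator_bound t2; have [B B0 hB] := IH _ t2.
exists (L * B); first exact: mulr_ge0.
move=> x; rewrite {1}[t]splitr -generator_derivative_n//.
apply: le_trans (hL _).2 _; rewrite -mulrA ler_wpM2l//.
Qed.

(** Divide [hC] by [u] and let [u] tend to 0. The Taylor errors depend on [t] and [x] but are
    quadratic in [u], so they disappear. *)
Lemma R_generator_bound n (t : 'I_n -> R) (x : 'I_n -> X) : (forall k, 0 < t k <= 1) ->
  N (fun k => (t k)%:C *: A (T (t k) (x k))) <= C * N x.
Proof.
move=> ht; have sV := rad_norm_seminorm (X := X) p1 n.
have t0 k : 0 < t k by case/andP: (ht k).
have /choice2[K K0 hK] : forall k, exists2 K : R, 0 <= K & forall a x, 0 <= a <= 1 ->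
    rnorm (T (t k + a) x - T (t k) x - a%:C *: A (T (t k) x)) <= K * a ^+ 2 * rnorm x.
  by move=> k; exact: generator_taylor.
apply: (@le_eps _ _ _ (\sum_k K k * rnorm (x k))) => e e0.
pose u := Num.min e 1.
have u0 : 0 < u by rewrite lt_min e0 ltr01.
have ue : u <= e by rewrite ge_min lexx.
have u1 : u <= 1 by rewrite ge_min lexx orbT.
pose y : 'I_n -> X := fun k => (t k)%:C *: A (T (t k) (x k)).
pose z : 'I_n -> X := fun k => T ((1 + u) * t k) (x k) - T (t k) (x k).
have S0 : 0 <= \sum_k K k * rnorm (x k).
  by apply: sumr_ge0 => k _; rewrite mulr_ge0 ?rnorm_ge0.
have h1 : N z <= C * u * N x by apply: hC => //; rewrite (ltW u0).
have h2 : N (u%:C *: (y : ('I_n -> X)%type)) <= N (fun k => z k - u%:C *: y k) + N z.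
  have := snBl sV (u%:C *: (y : ('I_n -> X)%type)) z.
  by rewrite (snBC sV).
have h3 : N (fun k => z k - u%:C *: y k) <= u ^+ 2 * \sum_k K k * rnorm (x k).
  apply: le_trans (rad_norm_le_sum p1 _) _; rewrite mulr_sumr; apply: ler_sum => k _.
  have /andP[_ tk1] := ht k; have tk0 := t0 k.
  have ut : 0 <= u * t k <= 1.
    by rewrite mulr_ge0 ?(ltW u0) ?(ltW tk0)//=; exact: mulr_ile1 (ltW u0) (ltW tk0) u1 tk1.
  have := hK k _ (x k) ut; rewrite rmorphM /= -scalerA.
  have -> : t k + u * t k = (1 + u) * t k by ring.
  move=> h; apply: le_trans h _.
  have -> : K k * (u * t k) ^+ 2 * rnorm (x k) = u ^+ 2 * (K k * rnorm (x k)) * (t k ^+ 2) by ring.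
  rewrite ler_piMr ?exprn_ile1 ?(ltW tk0)//.
  by rewrite mulr_ge0 ?exprn_ge0 ?(ltW u0)// mulr_ge0 ?rnorm_ge0.
rewrite (snZR sV _ (ltW u0)) in h2.
rewrite -(ler_pM2l u0) -/y.
apply: le_trans h2 _; apply: le_trans (lerD h3 h1) _.
move: S0; set S := \sum_k _ => S0.
have -> : u * (C * N x + S * e) = u * (e * S) + C * u * N x by ring.
by rewrite lerD2r expr2 -mulrA ler_pM2l// ler_wpM2r.
Qed.

Definition growth : R := C * expR 1.

Lemma growth_gt0 : 0 < growth.
Proof. by rewrite mulr_gt0 ?expR_gt0// (lt_le_trans ltr01). Qed.

(** A crude form of Stirling's formula, from the single term of degree [n + 1] of the exponential
    series at [n + 1]. *)
Lemma expn_le_fact (n : nat) : n.+1%:R ^+ n <= expR 1 ^+ n.+1 * n`!%:R :> R.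
Proof.
have := expR_ge1Dxn n (ler0n R n.+1); rewrite -[X in expR X]mulr1 expRM_natl => h.
have f0 : 0 < n.+1`!%:R :> R by rewrite ltr0n fact_gt0.
have : n.+1%:R ^+ n.+1 / n.+1`!%:R <= expR 1 ^+ n.+1 :> R.
  by apply: le_trans h; rewrite lerDr.
rewrite ler_pdivrMr// exprS factS natrM mulrCA ler_pM2l ?ltr0n//.
Qed.

(* [A^n T(t) = (A T(s))^n T(s)] with [s = t / (n + 1)]. *)
Lemma R_derivative_n_bound n m (t : 'I_m -> R) (x : 'I_m -> X) :
  (forall k, 0 < t k <= 1) ->
  N (fun k => (t k ^+ n / n`!%:R)%:C *: D n (t k) (x k)) <= M ^+ 2 * expR 1 * growth ^+ n * N x.
Proof.
move=> ht; have sV := rad_norm_seminorm (X := X) p1 m.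
have nr : 0 < n.+1%:R :> R by rewrite ltr0n.
have t0 k : 0 < t k by case/andP: (ht k).
pose s k := t k / n.+1%:R.
have s0 k : 0 < s k by rewrite divr_gt0.
have s1 k : s k <= 1.
  rewrite ler_pdivrMr// mul1r; case/andP: (ht k) => _ h; apply: le_trans h _.
  by rewrite ler1n.
have hs k : 0 < s k <= 1 by rewrite s0 s1.
pose S (y : ('I_m -> X)%type) : ('I_m -> X)%type := fun k => (s k)%:C *: A (T (s k) (y k)).
have hS y : N (S y) <= C * N y by exact: R_generator_bound.
pose y : ('I_m -> X)%type := fun k => T (s k) (x k).
have E j : iter j S y = (fun k => (s k ^+ j)%:C *: iter j (fun w => A (T (s k) w)) (y k)).
  elim: j => [|j IH].
    by apply/funext => k; rewrite /= expr0 scale1r.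
  rewrite iterS IH; apply/funext => k; rewrite /S.
  have lA : linear (fun w => A (T (s k) w)) by exact: generator_linear.
  by rewrite (linearZ_op _ _ lA) scalerA -rmorphM -exprS.
have -> : (fun k => (t k ^+ n / n`!%:R)%:C *: D n (t k) (x k)) =
    (n.+1%:R ^+ n / n`!%:R)%:C *: (iter n S y : ('I_m -> X)%type).
  rewrite E; apply/funext => k.
  rewrite -[RHS]/((n.+1%:R ^+ n / n`!%:R)%:C *: ((s k ^+ n)%:C *: iter n (fun w => A (T (s k) w)) (y k))).
  rewrite -derivative_n_iter// scalerA -rmorphM; congr (_%:C *: D _ _ _).
    rewrite mulrAC -exprMn /s; congr (_ ^+ _ / _); field; exact: lt0r_neq0.
  by rewrite /s; field; exact: lt0r_neq0.
have f0 : 0 < n`!%:R :> R by rewrite ltr0n fact_gt0.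
have c0 : 0 <= n.+1%:R ^+ n / n`!%:R :> R by rewrite divr_ge0 ?exprn_ge0 ?(ltW f0).
rewrite (snZR sV _ c0).
have h1 : N (iter n S y) <= C ^+ n * (M ^+ 2 * N x).
  apply: le_trans (iter_bound n y C0 hS) _; apply: ler_wpM2l; first exact: exprn_ge0.
  exact: (semigroup_R_bound hT M1 hM).
apply: le_trans (ler_wpM2l c0 h1) _.
have -> : M ^+ 2 * expR 1 * growth ^+ n * N x = (expR 1 ^+ n.+1) * (C ^+ n * (M ^+ 2 * N x)).
  by rewrite /growth exprMn [expR 1 ^+ n.+1]exprS; ring.
rewrite ler_wpM2r ?ler_pdivrMr ?expn_le_fact//.
by rewrite mulr_ge0 ?exprn_ge0// mulr_ge0 ?exprn_ge0// (sn_ge0 sV).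
Qed.

(* The finitely many [n] with [t / (n + 1) > 1] only enlarge [K]. *)
Lemma derivative_n_growth t : 0 < t -> exists2 K : R, 0 <= K & forall n x,
  rnorm ((n`!%:R^-1)%:C *: D n t x) <= K * (growth / t) ^+ n * rnorm x.
Proof.
Proof.
move=> t0; have g0 := growth_gt0; have gt0 : 0 < growth / t by rewrite divr_gt0.
have /choice2[B B0 hB] : forall n, exists2 B : R, 0 <= B &
  forall x, rnorm (D n t x) <= B * rnorm x by move=> n; exact: derivative_n_bounded.
pose m := (Num.truncn t).+1.
have M20 : 0 <= M ^+ 2 by rewrite exprn_ge0.
pose b (n : 'I_m) := B n / (growth / t) ^+ n.
have b0 n : 0 <= b n by rewrite divr_ge0 ?exprn_ge0 ?(ltW gt0).
have sb0 : 0 <= \sum_n b n by exact: sumr_ge0.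
have E0 : 0 <= M ^+ 2 * expR 1 by rewrite mulr_ge0 ?expR_ge0.
exists (M ^+ 2 * expR 1 + \sum_n b n); first exact: addr_ge0.
move=> n x; have f0 : 0 < n`!%:R :> R by rewrite ltr0n fact_gt0.
have rx := rnorm_ge0 x.
have gn0 : 0 < (growth / t) ^+ n by rewrite exprn_gt0.
rewrite (snZR sX) ?invr_ge0 ?(ltW f0)// mulrDl mulrDl.
have [nm|mn] := ltnP n m.
  rewrite -[leLHS]add0r; apply: lerD.
    by apply: mulr_ge0 rx; apply: mulr_ge0 E0 (ltW gn0).
  apply: le_trans (_ : 1 * (B n * rnorm x) <= _).
    by apply: ler_pM; rewrite ?rnorm_ge0 ?invr_ge0 ?(ltW f0)// invf_le1// ler1n fact_gt0.
  rewrite mul1r ler_wpM2r// -ler_pdivrMr// (bigD1 (Ordinal nm))//= lerDl.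
  by apply: sumr_ge0.
have nr : 0 < n.+1%:R :> R by rewrite ltr0n.
pose s := t / n.+1%:R.
have s0 : 0 < s by rewrite divr_gt0.
have s1 : s <= 1.
  rewrite ler_pdivrMr// mul1r; have /andP[_ /ltW h] := truncn_itv (ltW t0).
  by apply: le_trans h _; rewrite ler_nat ltnW.
have hs : 0 < s <= 1 by rewrite s0.
have hA y : rnorm (A (T s y)) <= C / s * rnorm y.
  have := R_generator_bound (t := fun _ : 'I_1 => s) (fun=> y) (fun=> hs).
  rewrite !(rad_norm_ord1 p1) (snZR sX _ (ltW s0)) => h.
  by rewrite mulrAC ler_pdivlMr// mulrC.
have hTs : rnorm (T s x) <= M ^+ 2 * rnorm x.
  have := semigroup_R_bound hT M1 hM (t := fun _ : 'I_1 => s) (fun=> x) (fun=> hs).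
  by rewrite !(rad_norm_ord1 p1).
have -> : D n t x = iter n (fun w => A (T s w)) (T s x).
  by rewrite -derivative_n_iter//; congr D; rewrite /s; field; exact: lt0r_neq0.
have Cs0 : 0 <= C / s by rewrite divr_ge0 ?(ltW s0).
have h1 := iter_bound n (T s x) Cs0 hA.
have {h1 hTs} h1 := le_trans h1 (ler_wpM2l (exprn_ge0 n Cs0) hTs).
rewrite -[leLHS]addr0; apply: lerD; last first.
  by apply: mulr_ge0 rx; apply: mulr_ge0 sb0 (ltW gn0).
rewrite mulrC ler_pdivrMr//; apply: le_trans h1 _.
have -> : M ^+ 2 * expR 1 * (growth / t) ^+ n * rnorm x * n`!%:R =
    (C / t) ^+ n * (M ^+ 2 * rnorm x) * (expR 1 ^+ n.+1 * n`!%:R).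
  by rewrite /growth [expR 1 ^+ n.+1]exprS !exprMn; ring.
have -> : (C / s) ^+ n * (M ^+ 2 * rnorm x) = (C / t) ^+ n * (M ^+ 2 * rnorm x) * n.+1%:R ^+ n.
  rewrite [RHS]mulrAC -exprMn; congr (_ ^+ _ * _); rewrite /s.
  by field; rewrite !lt0r_neq0.
rewrite ler_wpM2l ?expn_le_fact//.
by rewrite mulr_ge0 ?exprn_ge0 ?divr_ge0 ?(ltW t0)// mulr_ge0.
Qed.


(** Negative [a] occur as real parts of complex increments. With [s = r / 4] and [a = - u], the
    identity [T r - T (r - u) = T (3 s - u) (T (s + u) - T s)] reduces them to forward increments at
    the time [s]. *)
Lemma generator_taylor_two_sided r : 0 < r -> exists2 K : R, 0 <= K &
  exists2 d : R, 0 < d & forall a x, `|a| <= d ->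
  [/\ 0 <= r + a, rnorm (T (r + a) x - T r x) <= K * `|a| * rnorm x &
   rnorm (T (r + a) x - T r x - a%:C *: A (T r x)) <= K * `|a| ^+ 2 * rnorm x].
Proof.
move=> r0; pose s := r / 4; have s0 : 0 < s by rewrite divr_gt0.
have sr : r = s *+ 4 by rewrite /s -mulr_natr divfK.
have [K1 K10 h1] := generator_taylor r0; have [L1 L10 l1] := semigroup_lip r0.
have [K2 K20 h2] := generator_taylor s0; have [L2 L20 l2] := semigroup_lip s0.
have [B B0 hB] := semigroup_bound r; have [G G0 hG] := generator_bound s0.
pose K := K1 + L1 + (B * K2 + B * (L2 * G)) + B * L2.
have BL : 0 <= B * L2 by exact: mulr_ge0.
have BK : 0 <= B * K2 + B * (L2 * G) by rewrite addr_ge0// ?mulr_ge0// mulr_ge0.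
exists K; first exact: addr_ge0 (addr_ge0 (addr_ge0 K10 L10) BK) BL.
exists (Num.min s 1); first by rewrite lt_min s0 ltr01.
move=> a x; rewrite le_min => /andP[as1 a1]; have rx := rnorm_ge0 x.
have aa : 0 <= `|a| by [].
have KL1 : L1 <= K by rewrite /K; lra.
have KK1 : K1 <= K by rewrite /K; lra.
have KBL : B * L2 <= K by rewrite /K; lra.
have KBK : B * K2 + B * (L2 * G) <= K by rewrite /K; lra.
have mon k y : k <= K -> 0 <= y -> k * y * rnorm x <= K * y * rnorm x.
  by move=> kK y0; rewrite ler_wpM2r// ler_wpM2r.
have [a0|a0] := leP 0 a.
  move: as1 a1; rewrite ger0_norm// => as1 a1.
  have ha : 0 <= a <= 1 by rewrite a0.
  split; first by rewrite addr_ge0// ltW.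
    exact: le_trans (l1 _ _ ha) (mon _ _ KL1 a0).
  exact: le_trans (h1 _ _ ha) (mon _ _ KK1 (exprn_ge0 2 a0)).
move: aa as1 a1; rewrite ltr0_norm//; set u := - a => u0 us u1.
have au : a = - u by rewrite /u opprK.
clearbody u.
have hu : 0 <= u <= 1 by rewrite u0.
have s30 : 0 <= s *+ 3 - u by rewrite sr in r0 *; lra.
have s20 : 0 <= s *+ 2 - u by lra.
have r3 : 0 <= s *+ 3 - u <= r by rewrite s30 sr; lra.
have r2 : 0 <= s *+ 2 - u <= r by rewrite s20 sr; lra.
have su0 : 0 <= s + u by lra.
have s3 : 0 <= s *+ 3 by lra.
have E1 : T (r + a) x - T r x = - T (s *+ 3 - u) (T (s + u) x - T s x).
  rewrite (linearB_op _ _ (lT s30)) opprB -!TD ?(ltW s0)//.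
  by rewrite sr au; congr (T _ _ - T _ _); ring.
have tr : rnorm (T (s *+ 3 - u) (T (s + u) x - T s x)) <= B * (L2 * u * rnorm x).
  by apply: le_trans (hB _ _ r3) _; rewrite ler_wpM2l// l2.
split.
- by rewrite sr au; lra.
- rewrite E1 (snN sX); apply: le_trans tr _; rewrite mulrA mulrA; exact: mon.
set v := A (T s x).
have E2 : A (T r x) = T (s *+ 2 - u) (T (s + u) v).
  rewrite -TD// (_ : s *+ 2 - u + (s + u) = s *+ 3); last by ring.
  rewrite -generator_commute// -TD ?(ltW s0)//.
  by congr (A (T _ _)); rewrite sr; ring.
have E3 : T (s *+ 3 - u) v = T (s *+ 2 - u) (T s v).
  by rewrite -TD ?(ltW s0)//; congr (T _ _); ring.
have -> : T (r + a) x - T r x - a%:C *: A (T r x) =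
    - T (s *+ 3 - u) (T (s + u) x - T s x - u%:C *: v) +
    u%:C *: T (s *+ 2 - u) (T (s + u) v - T s v).
  rewrite E1 E2 (linearB_op _ _ (lT s20)); set w := T (s + u) x - T s x.
  have -> : T (s *+ 3 - u) (w - u%:C *: v) = T (s *+ 3 - u) w - u%:C *: T (s *+ 3 - u) v.
    by rewrite (linearB_op _ _ (lT s30)) (linearZ_op _ _ (lT s30)).
  rewrite E3 au rmorphN scaleNr opprK opprB scalerBr.
  by rewrite [RHS]addrC subrKA addrC.
apply: le_trans (snD sX _ _) _; rewrite (snN sX) (snZR sX _ u0).
apply: le_trans (_ : B * (K2 * u ^+ 2 * rnorm x) + u * (B * (L2 * u * (G * rnorm x))) <= _).
  apply: lerD.
    by apply: le_trans (hB _ _ r3) _; rewrite ler_wpM2l// h2.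
  apply: ler_wpM2l => //; apply: le_trans (hB _ _ r2) _; rewrite ler_wpM2l//.
  by apply: le_trans (l2 _ _ hu) _; rewrite ler_wpM2l ?mulr_ge0//; exact: (hG x).2.
have -> : B * (K2 * u ^+ 2 * rnorm x) + u * (B * (L2 * u * (G * rnorm x))) =
  (B * K2 + B * (L2 * G)) * u ^+ 2 * rnorm x by ring.
by apply: mon => //; exact: exprn_ge0.
Qed.


(** * The holomorphic extension *)

Definition coefficient t (x : X) n : X := (n`!%:R^-1)%:C *: D n t x.

Definition coefficient_sum (c : nat -> R[i]) t x m : X := \sum_(n < m) c n *: coefficient t x n.

(** The default value 0 is excluded by [sum_of_bound] for all coefficient sequences considered
    below. *)
Definition sum_of (c : nat -> R[i]) t x : X := xget 0 [set l | rcvg (coefficient_sum c t x) l].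

Lemma sum_ofE c t x l : rcvg (coefficient_sum c t x) l -> sum_of c t x = l.
Proof. by move=> h; apply: xget_unique => // l' h'; exact: rcvg_unique h' h. Qed.

Lemma coefficientD r s x n : 0 <= r -> 0 < s ->
  coefficient (r + s) x n = T r (coefficient s x n).
Proof. by move=> r0 s0; rewrite (linearZ_op _ _ (lT r0)) -derivative_nD. Qed.

Lemma coefficient_generator r s x n : 0 < r -> 0 < s ->
  A (T r (coefficient s x n)) = n.+1%:R *: T r (coefficient s x n.+1).
Proof.
move=> r0 s0; have lA : linear (fun w => A (T r w)) by exact: generator_linear.
rewrite (linearZ_op _ _ lA) generator_derivative_n// (linearZ_op _ _ (lT (ltW r0))).
rewrite -derivative_nD ?(ltW r0)// scalerA; congr (_ *: _).
have -> : n.+1%:R = n.+1%:R%:C :> R[i] by rewrite rmorph_nat.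
rewrite -rmorphM; congr (_%:C).
by rewrite factS natrM invfM mulVKf// pnatr_eq0.
Qed.

Lemma coefficient_sum_linear c t m : 0 < t -> linear (fun x => coefficient_sum c t x m).
Proof.
move=> t0 a x y; rewrite /coefficient_sum scaler_sumr -big_split; apply: eq_bigr => n _ /=.
rewrite /coefficient (derivative_n_linear n t0) scalerDr scalerDr !scalerA.
by congr (_ *: _ + _); ring.
Qed.

Lemma coefficient_sum_op (S : X -> X) c t x m : linear S ->
  S (coefficient_sum c t x m) = \sum_(n < m) c n *: S (coefficient t x n).
Proof.
move=> lS; rewrite /coefficient_sum (linear_sum_op _ _ _ lS); apply: eq_bigr => n _.
exact: linearZ_op.
Qed.

(** Chosen so that [radius t * (growth / t)] is [1 / 4], the hypothesis on [rho * kappa] in the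
    section on power series. *)
Definition radius t : R := t / (4 * growth).

Lemma radius_gt0 t : 0 < t -> 0 < radius t.
Proof. by move=> t0; rewrite divr_gt0// mulr_gt0// growth_gt0. Qed.

(** The derivative of [y ^+ n] in [y]; for [n = 0] the factor [n%:R] cancels the truncated
    exponent. *)
Definition taylor_coefficient (y : R[i]) n : R[i] := n%:R * y ^+ n.-1.

Local Notation power y := (fun n => y ^+ n).

Lemma sum_of_bound t : 0 < t -> exists2 K : R, 0 <= K & forall c al x, 0 <= al ->
  (forall n, normc (c n) <= al * (2 * radius t) ^+ n) ->
  rcvg (coefficient_sum c t x) (sum_of c t x) /\ rnorm (sum_of c t x) <= al * K * rnorm x.
Proof.
move=> t0; have [K K0 hK] := derivative_n_growth t0; exists (2 * K); first exact: mulr_ge0.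
move=> c al x al0 hc; have g0 := growth_gt0.
have rx : 0 <= K * rnorm x by rewrite mulr_ge0 ?rnorm_ge0.
have gt0 : 0 <= growth / t by rewrite divr_ge0 ?ltW.
have rk : radius t * (growth / t) <= 1 / 4.
  by apply: le_of_eq; rewrite /radius; field; rewrite !gt_eqF.
have hb n : rnorm (coefficient t x n) <= K * rnorm x * (growth / t) ^+ n.
  by rewrite mulrAC; exact: hK.
have [l hl el] := series_rcvg rx gt0 (radius_gt0 t0) rk hb al0 hc.
rewrite (sum_ofE hl); split=> //; apply: le_trans el _.
by apply: le_of_eq; ring.
Qed.

Lemma sum_of_operator c al t : 0 < t -> 0 <= al ->
  (forall n, normc (c n) <= al * (2 * radius t) ^+ n) ->
  linear (sum_of c t) /\ exists2 K, 0 <= K & forall x, rnorm (sum_of c t x) <= K * rnorm x.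
Proof.
move=> t0 al0 hc; have [K K0 hK] := sum_of_bound t0; split.
  apply: (rcvg_linear (U := fun m x => coefficient_sum c t x m)) => [m|x].
    exact: coefficient_sum_linear.
  exact: (hK c al x al0 hc).1.
exists (al * K); first exact: mulr_ge0.
by move=> x; exact: (hK c al x al0 hc).2.
Qed.

Lemma sum_ofD c al r s x : 0 <= r -> 0 < s -> 0 <= al ->
  (forall n, normc (c n) <= al * (2 * radius s) ^+ n) ->
  sum_of c (r + s) x = T r (sum_of c s x).
Proof.
move=> r0 s0 al0 hc; apply: sum_ofE; have [K K0 hK] := sum_of_bound s0.
have [B B0 hB] := semigroup_operator_bound r0.
have := rcvg_op (lT r0) hB (hK c al x al0 hc).1.
congr rcvg; apply/funext => m; rewrite coefficient_sum_op; last exact: lT.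
by apply: eq_bigr => n _; rewrite coefficientD.
Qed.

Lemma power_coefficient y t : 0 < t -> normc y <= radius t ->
  forall n, normc (y ^+ n) <= 1 * (2 * radius t) ^+ n.
Proof. by move=> t0 yt n; have := power_bound (radius_gt0 t0) n yt. Qed.

Lemma taylor_coefficientP y t : 0 < t -> normc y <= radius t ->
  forall n, normc (taylor_coefficient y n) <= (radius t)^-1 * (2 * radius t) ^+ n.
Proof. by move=> t0 yt n; have := power_derivative_bound (radius_gt0 t0) n yt. Qed.

(** The generator shifts the coefficients, with factor [n + 1], and so differentiates the series in
    [y]: this is the Cauchy-Riemann equation. [T r] makes the generator bounded, so that it may be
    applied term by term. *)
Lemma generator_sum_of y r s x : 0 < r -> 0 < s -> normc y <= radius s ->
  A (T r (sum_of (power y) s x)) = T r (sum_of (taylor_coefficient y) s x).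
Proof.
move=> r0 s0 ys; have [K K0 hK] := sum_of_bound s0.
have rs0 : 0 <= (radius s)^-1 by rewrite invr_ge0 ltW ?radius_gt0.
have [h1 _] := hK (power y) 1 x ler01 (power_coefficient s0 ys).
have [h2 _] := hK (taylor_coefficient y) _ x rs0 (taylor_coefficientP s0 ys).
have [B B0 hB] := semigroup_operator_bound (ltW r0).
have [G G0 hG] := generator_bound r0.
have lA : linear (fun w => A (T r w)) by exact: generator_linear.
apply: rcvg_unique (rcvg_op lA (fun x => (hG x).2) h1) _.
have := rcvg_shift (rcvg_op (lT (ltW r0)) hB h2).
congr rcvg; apply/funext => m.
rewrite coefficient_sum_op; last exact/lT/ltW.
rewrite (coefficient_sum_op _ _ _ _ lA) big_ord_recl {1}/taylor_coefficient mul0r scale0r add0r.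
apply: eq_bigr => n _; rewrite coefficient_generator// scalerA.
by rewrite /taylor_coefficient /= /bump /= add1n mulrC.
Qed.

Lemma sum_of_taylor s : 0 < s -> exists2 K : R, 0 <= K & forall y h x,
  normc y <= radius s -> normc (y + h) <= radius s ->
  [/\ rnorm (sum_of (power y) s x) <= K * rnorm x,
   rnorm (sum_of (taylor_coefficient y) s x) <= K * rnorm x &
   rnorm (sum_of (power (y + h)) s x - sum_of (power y) s x -
     h *: sum_of (taylor_coefficient y) s x) <= K * normc h ^+ 2 * rnorm x].
Proof.
move=> s0; have [K K0 hK] := sum_of_bound s0; have rs0 := radius_gt0 s0.
have rV0 : 0 <= (radius s)^-1 by rewrite invr_ge0 ltW.
have rV20 : 0 <= (radius s ^+ 2)^-1 by rewrite invr_ge0 exprn_ge0 ?ltW.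
pose k := 1 + (radius s)^-1 + (radius s ^+ 2)^-1.
have k0 : 0 <= k by rewrite !addr_ge0.
exists (k * K); first exact: mulr_ge0.
move=> y h x ys yhs; have Kx : 0 <= K * rnorm x by rewrite mulr_ge0 ?rnorm_ge0.
have mon a : a <= k -> a * K * rnorm x <= k * K * rnorm x.
  by move=> ak; rewrite -!mulrA ler_wpM2r.
have [h1 e1] := hK (power y) 1 x ler01 (power_coefficient s0 ys).
have [h1' _] := hK (power (y + h)) 1 x ler01 (power_coefficient s0 yhs).
have [h2 e2] := hK (taylor_coefficient y) _ x rV0 (taylor_coefficientP s0 ys).
split.
- by apply: le_trans e1 (mon _ _); rewrite /k; lra.
- by apply: le_trans e2 (mon _ _); rewrite /k; lra.
have hh : 0 <= normc h ^+ 2 / radius s ^+ 2 by rewrite mulr_ge0 ?exprn_ge0 ?normc_ge0.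
have [h3 e3] := hK _ _ x hh (fun n => power_taylor_bound rs0 n ys yhs).
have <- : sum_of (fun n => (y + h) ^+ n - y ^+ n - h * (n%:R * y ^+ n.-1)) s x =
   sum_of (power (y + h)) s x - sum_of (power y) s x - h *: sum_of (taylor_coefficient y) s x.
  apply: rcvg_unique h3 _.
  have := rcvgD (rcvgD h1' (rcvgZ (-1) h1)) (rcvgZ (- h) h2).
  rewrite scaleN1r scaleNr; congr rcvg; apply/funext => m.
  rewrite /coefficient_sum !scaler_sumr -!big_split; apply: eq_bigr => n _ /=.
  by rewrite !scalerA -!scalerDl; congr (_ *: _); rewrite mulN1r mulNr.
apply: le_trans e3 _.
have -> : normc h ^+ 2 / radius s ^+ 2 * K * rnorm x = normc h ^+ 2 * ((radius s ^+ 2)^-1 * K * rnorm x).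
  by ring.
have -> : k * K * normc h ^+ 2 * rnorm x = normc h ^+ 2 * (k * K * rnorm x) by ring.
by rewrite ler_wpM2l ?exprn_ge0 ?normc_ge0//; apply: mon; rewrite /k; lra.
Qed.


Definition imaginary_part (z : R[i]) : R[i] := Complex 0 (complex.Im z).

(* T(t + i y) = sum_n (i y)^n A^n T(t) / n! *)
Definition extension (z : R[i]) : X -> X := sum_of (power (imaginary_part z)) (complex.Re z).

(** 16 is [4 * 2 * 2]: on the cone the imaginary part stays within half of
    [radius (complex.Re z / 2)], and the other half is left for increments. *)
Definition aperture : R := (16 * growth)^-1.

Definition cone (z : R[i]) : Prop :=
  0 < complex.Re z /\ `|complex.Im z| <= aperture * complex.Re z.

Lemma normc_imaginary_part z : normc (imaginary_part z) = `|complex.Im z|.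
Proof. by rewrite /normc /= expr0n add0r sqrtr_sqr. Qed.

Lemma split_complex z : z = (complex.Re z)%:C + imaginary_part z.
Proof. by case: z => a b; apply/eqP; rewrite eq_complex /= addr0 add0r !eqxx. Qed.

Lemma cone_radius z : cone z -> normc (imaginary_part z) <= radius (complex.Re z / 2) / 2 /\
  normc (imaginary_part z) <= radius (complex.Re z).
Proof.
move=> [z0 zc]; rewrite normc_imaginary_part; have g0 := growth_gt0.
have e : aperture * complex.Re z = radius (complex.Re z / 2) / 2.
  by rewrite /aperture /radius; field; rewrite gt_eqF.
have e' : radius (complex.Re z) = 2 * radius (complex.Re z / 2).
  by rewrite /radius; field; rewrite gt_eqF.
have := radius_gt0 (divr_gt0 z0 (ltr0n R 2)).
by rewrite e' -e; split=> //; move: zc; rewrite e; lra.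
Qed.

Lemma extension_real t : 0 < t -> extension t%:C = T t.
Proof.
move=> t0; apply/funext => x; apply: sum_ofE => e e0; exists 1%N => -[//|m] _.
rewrite /coefficient_sum big_ord_recl expr0 scale1r big1 => [|n _]; last first.
  rewrite (_ : imaginary_part _ = 0) ?expr0n ?scale0r//.
rewrite addr0 /coefficient fact0 invr1 scale1r subrr (sn0 sX).
exact: ltW.
Qed.

Lemma extension_bounded_operator z : cone z -> bounded_operator (extension z).
Proof.
move=> cz; have [z0 _] := cz; have [_ h] := cone_radius cz.
have [l [K K0 hK]] := sum_of_operator z0 ler01 (power_coefficient z0 h).
exact: bounded_continuous hK.
Qed.

(* Near [z], [T(z + h) = T(s + Re h) G(Im (z + h))] with [s = Re z / 2] and [G]
   the power series with coefficients [A^n T(s) / n!]; both factors have a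
   second-order Taylor expansion. *)
Lemma extension_taylor z : cone z -> exists2 L : X -> X, bounded_operator L &
  exists2 K : R, 0 <= K & exists2 d : R, 0 < d & forall h x, normc h <= d ->
  rnorm (extension (z + h) x - extension z x - h *: L x) <= K * normc h ^+ 2 * rnorm x.
Proof.
move=> cz; have [z0 _] := cz; have [hz _] := cone_radius cz.
pose s := complex.Re z / 2; have s0 : 0 < s by rewrite divr_gt0.
pose y := imaginary_part z; have rs := radius_gt0 s0.
have ys : normc y <= radius s / 2 by [].
have ys1 : normc y <= radius s by apply: le_trans ys _; lra.
have [lG [KG KG0 hG]] := sum_of_operator s0 ler01 (power_coefficient s0 ys1).
have [KA KA0 hA] := generator_bound s0.
exists (fun x => A (T s (sum_of (power y) s x))).
  apply: (bounded_continuous (B := KA * KG)).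
    by move=> a u v; rewrite lG (generator_linear s0).
  by move=> x; apply: le_trans (hA _).2 _; rewrite -mulrA ler_wpM2l.
have [K1 K10 [d d0 h1]] := generator_taylor_two_sided s0.
have [K2 K20 h2] := sum_of_taylor s0.
have [B B0 hB] := semigroup_bound (s + d).
exists (B * K2 + K1 * K2 + K1 * K2).
  by rewrite !addr_ge0 ?mulr_ge0.
exists (Num.min d (radius s / 2)); first by rewrite lt_min d0 divr_gt0.
move=> h x; rewrite le_min => /andP[hd hr]; have rx := rnorm_ge0 x.
pose a := complex.Re h; pose eta := imaginary_part h.
have ah : `|a| <= normc h := normr_Re h.
have eh : normc eta <= normc h by rewrite normc_imaginary_part; exact: normr_Im.
have yes : normc (y + eta) <= radius s.
  by apply: le_trans (normcD _ _) _; lra.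
have [sa0 h3 h4] : [/\ 0 <= s + a, forall w, rnorm (T (s + a) w - T s w) <= K1 * `|a| * rnorm w &
    forall w, rnorm (T (s + a) w - T s w - a%:C *: A (T s w)) <= K1 * `|a| ^+ 2 * rnorm w].
  have had := le_trans ah hd.
  by split=> [|w|w]; [case: (h1 a x had)|case: (h1 a w had)|case: (h1 a w had)].
have [g1 g2 g3] := h2 y eta x ys1 yes.
set w := sum_of (power y) s x in g1 g3 *; set w' := sum_of (taylor_coefficient y) s x in g2 g3.
have E1 : extension z x = T s w.
  rewrite /extension -/y [in complex.Re z](_ : complex.Re z = s + s); last by rewrite /s -splitr.
  by rewrite (sum_ofD _ (ltW s0) s0 ler01 (power_coefficient s0 ys1)).
have E2 : extension (z + h) x = T (s + a) (sum_of (power (y + eta)) s x).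
  rewrite /extension (_ : imaginary_part (z + h) = y + eta); last first.
    by apply/eqP; rewrite eq_complex /= addr0 eqxx /=; case: (z) (h) => ? ? [].
  rewrite (_ : complex.Re (z + h) = s + a + s); last first.
    rewrite addrAC -splitr /a; by case: (z) (h) => ? ? [].
  by rewrite (sum_ofD _ sa0 s0 ler01 (power_coefficient s0 yes)).
have E3 : A (T s w) = T s w' by exact: generator_sum_of.
rewrite E1 E2.
have -> : h *: A (T s w) = a%:C *: A (T s w) + eta *: T s w'.
  by rewrite -E3 -scalerDl -split_complex.
set W := sum_of (power (y + eta)) s x in g3 *.
have -> : T (s + a) W - T s w - (a%:C *: A (T s w) + eta *: T s w') =
   T (s + a) (W - w - eta *: w') + eta *: (T (s + a) w' - T s w') +
   (T (s + a) w - T s w - a%:C *: A (T s w)).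
  rewrite !(linearB_op _ _ (lT sa0)) (linearZ_op _ _ (lT sa0)) scalerBr.
  rewrite [_ - eta *: T (s + a) w' + _]addrA subrK [RHS]addrAC.
  by rewrite !addrA subrK opprD !addrA.
apply: le_trans (snD sX _ _) _; apply: le_trans (lerD (snD sX _ _) (lexx _)) _.
have nh := normc_ge0 h; have ne := normc_ge0 eta.
have sad : 0 <= s + a <= s + d.
  by rewrite sa0 lerD2l (le_trans (ler_norm a))// (le_trans ah).
rewrite (snZ sX) !mulrDl; apply: lerD; first apply: lerD.
- apply: le_trans (hB _ _ sad) _.
  have -> : B * K2 * normc h ^+ 2 * rnorm x = B * (K2 * normc h ^+ 2 * rnorm x) by ring.
  apply: ler_wpM2l => //; apply: le_trans g3 _.
  by apply: ler_wpM2r => //; apply: ler_wpM2l => //; rewrite lerXn2r ?nnegrE.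
- apply: le_trans (ler_wpM2l ne (h3 w')) _.
  have -> : K1 * K2 * normc h ^+ 2 * rnorm x = normc h * (K1 * normc h * (K2 * rnorm x)) by ring.
  apply: ler_pM => //; first by rewrite mulr_ge0 ?rnorm_ge0 ?mulr_ge0.
  apply: ler_pM => //; [by rewrite mulr_ge0|exact: rnorm_ge0|].
  by rewrite ler_wpM2l.
- apply: le_trans (h4 w) _.
  have -> : K1 * K2 * normc h ^+ 2 * rnorm x = K1 * normc h ^+ 2 * (K2 * rnorm x) by ring.
  apply: ler_pM => //; [by rewrite mulr_ge0 ?exprn_ge0|exact: rnorm_ge0|].
  by rewrite ler_wpM2l// lerXn2r ?nnegrE.
Qed.


Lemma extension_holomorphic (U : set R[i]) : (forall z, U z -> cone z) -> holomorphic_on U extension.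
Proof.
move=> UC z /UC cz; have [L bL [K K0 [d d0 hK]]] := extension_taylor cz.
exists L; split=> //; set F := fun h : R[i] => _.
have Fn h : 0 < normc h -> normc h <= d -> (0 <= F h /\ F h <= (K * normc h)%:E)%E.
  move=> h0 hd.
  pose S x := h^-1 *: (extension (z + h) x - extension z x) - L x.
  have -> : F h = opnorm S by [].
  split.
    apply: le_trans (_ : ((rnorm (S 0))%:E <= _)%E).
      by rewrite lee_fin rnorm_ge0.
    by apply: ereal_sup_ubound; exists 0 => //=; rewrite (sn0 sX).
  apply: opnorm_le; first by rewrite mulr_ge0 ?normc_ge0.
  move=> x; have hne : h != 0 by rewrite -normc_gt0.
  have -> : S x = h^-1 *: (extension (z + h) x - extension z x - h *: L x).
    by rewrite [RHS]scalerBr scalerA mulVf// scale1r.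
  rewrite (snZ sX) normcV ler_pdivrMl//; apply: le_trans (hK h x hd) _.
  by apply: le_of_eq; ring.
move=> V [e /= e0 heV]; apply/dnbhs_normcP.
exists (Num.min d (e / (1 + K))); first by rewrite lt_min d0 divr_gt0// ltr_pwDl.
move=> h h0; rewrite lt_min => /andP[/ltW hd].
rewrite ltr_pdivlMr ?ltr_pwDl// => he.
have [F0 F1] := Fn h h0 hd.
have Ff : F h \is a fin_num.
  by apply: fin_real; rewrite (lt_le_trans _ F0) ?ltNyr//= (le_lt_trans F1) ?ltry.
rewrite -(fineK Ff) in F0 F1 *; rewrite !lee_fin in F0 F1.
rewrite /preimage /= -(fineK Ff); apply: heV => /=; rewrite sub0r normrN ger0_norm//.
by apply: le_lt_trans F1 _; move: he; rewrite mulrDr mulr1 mulrC; lra.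
Qed.

Lemma half_geometric_sum (a : nat -> R) (K : R) m : (forall j, a j <= K / 2 ^+ j) -> 0 <= K ->
  \sum_(j < m) a j <= 2 * K.
Proof.
move=> ha K0; apply: (@le_trans _ _ (2 * K - 2 * K / 2 ^+ m)); last first.
  by rewrite lerBlDr lerDl divr_ge0 ?exprn_ge0// mulr_ge0.
elim: m => [|m IH]; first by rewrite big_ord0 expr0 divr1 subrr.
rewrite big_ord_recr /=; apply: le_trans (lerD IH (ha m)) _.
by rewrite exprS; apply: le_of_eq; field; rewrite expf_neq0.
Qed.

(** The series is estimated term by term: [aperture * growth] is [1 / 16], so the [j]-th term is at
    most [1 / 2 ^ j] times the constant, and the sum gives the factor 2. Convergence in each
    component transfers the bound to the limit. *)
Lemma extension_R_bounded :
  R_bounded_by p [set extension z | z in [set z | cone z /\ `|z| <= 1]] (2 * (M ^+ 2 * expR 1)).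
Proof.
apply/R_bounded_byP => // n S x hS.
have /choice2[z hz zS] : forall k, exists2 z, cone z /\ `|z| <= 1 & extension z = S k.
  by move=> k; have [z hz <-] := hS k; exists z.
have -> : (fun k => S k (x k)) = (fun k => extension (z k) (x k)) by apply/funext => k; rewrite zS.
have sV := rad_norm_seminorm (X := X) p1 n; have g0 := growth_gt0.
have a0 : 0 < aperture by rewrite invr_gt0 mulr_gt0.
pose t k := complex.Re (z k).
have t0 k : 0 < t k by case: (hz k) => [[]].
have ht k : 0 < t k <= 1.
  rewrite t0; case: (hz k) => _; rewrite normc_le1; apply: le_trans.
  by apply: le_trans (normr_Re _); exact: ler_norm.
have E0 : 0 <= M ^+ 2 * expR 1 by rewrite mulr_ge0 ?exprn_ge0 ?expR_ge0.
have N0 : 0 <= N x by exact: sn_ge0 sV _.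
pose y k := imaginary_part (z k).
pose term j : ('I_n -> X)%type := fun k => y k ^+ j *: coefficient (t k) (x k) j.
pose P m : ('I_n -> X)%type := fun k => coefficient_sum (power (y k)) (t k) (x k) m.
have hterm j : N (term j) <= M ^+ 2 * expR 1 * N x / 2 ^+ j.
  pose be k := (complex.Im (z k) / (aperture * t k)) ^+ j.
  have hbe k : `|be k| <= 1.
    have at0 : 0 < aperture * t k by rewrite mulr_gt0.
    rewrite /be normrX exprn_ile1// normrM normfV [X in _ / X]gtr0_norm//.
    by rewrite ler_pdivrMr// mul1r; case: (hz k) => [[]].
  pose v : 'I_n -> X := fun k => (t k ^+ j / j`!%:R)%:C *: D j (t k) (x k).
  (* The power of [i] is common to all components and leaves the norm as a modulus; the remaining
     factors [be k] are real, so the contraction principle for real scalars applies. *)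
  have -> : term j = ((Complex 0 1) ^+ j * (aperture ^+ j)%:C) *:
      ((fun k => (be k)%:C *: v k) : ('I_n -> X)%type).
    apply/funext => k.
    rewrite -[RHS]/(((Complex 0 1) ^+ j * (aperture ^+ j)%:C) *: ((be k)%:C *: v k)).
    rewrite /term /coefficient /v !scalerA; congr (_ *: _).
    have -> : y k = Complex 0 1 * (complex.Im (z k))%:C.
      by rewrite /y /imaginary_part; apply: eq_complexP => /=; ring.
    rewrite exprMn -rmorphXn -!mulrA; congr (_ * _); rewrite -!rmorphM; congr (_%:C).
    rewrite /be exprMn [(_ * t k)^-1 ^+ j]exprVn [(_ * t k) ^+ j]exprMn; field.
    by rewrite !expf_neq0 ?gt_eqF// ltr0n fact_gt0.
  rewrite (snZ sV) normcM normcX normcR [`|_|]ger0_norm ?exprn_ge0 ?(ltW a0)//.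
  have -> : normc (Complex 0 1 : R[i]) = 1 by rewrite /normc /= expr0n add0r expr1n sqrtr1.
  rewrite expr1n mul1r.
  apply: le_trans (ler_wpM2l (exprn_ge0 j (ltW a0)) (rad_norm_contraction p1 v hbe)) _.
  apply: le_trans (ler_wpM2l (exprn_ge0 j (ltW a0)) (R_derivative_n_bound j x ht)) _.
  have -> : aperture ^+ j * (M ^+ 2 * expR 1 * growth ^+ j * N x) =
     M ^+ 2 * expR 1 * N x * (16^-1) ^+ j.
    rewrite (_ : 16^-1 = aperture * growth) ?exprMn; first by ring.
    by rewrite /aperture; field; rewrite gt_eqF.
  rewrite -exprVn ler_wpM2l ?mulr_ge0// lerXn2r ?nnegrE ?invr_ge0//.
  by rewrite lef_pV2 ?posrE// ler_nat.
have hP m : N (P m) <= 2 * (M ^+ 2 * expR 1) * N x.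
  have -> : P m = \sum_(j < m) term j by apply/funext => k; rewrite fct_sumE.
  apply: le_trans (sn_sum sV _ _ _) _; rewrite -mulrA.
  by apply: (half_geometric_sum (a := fun j => N (term j))) => //; rewrite mulr_ge0.
apply: (@le_eps _ _ _ n%:R) => e e0.
have /choice2[i0 _ hi0] : forall k, exists2 i0, true & forall i, (i0 <= i)%N ->
    rnorm (P i k - extension (z k) (x k)) <= e.
  move=> k; have [ck _] := hz k; have [_ yr] := cone_radius ck.
  have [K _ hK] := sum_of_bound (t0 k).
  have [h _] := hK _ _ (x k) ler01 (power_coefficient (t0 k) yr).
  by have [i0 h0] := h e e0; exists i0.
pose m := (\max_k i0 k)%N.
apply: le_trans (snBl sV _ (P m)) _; rewrite addrC; apply: lerD => //.
rewrite (snBC sV); apply: le_trans (rad_norm_le_sum p1 _) _.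
apply: le_trans (_ : \sum_(k < n) e <= _); last by rewrite sumr_const card_ord mulr_natl.
by apply: ler_sum => k _; apply: hi0; exact: leq_bigmax.
Qed.

End Generator.

Lemma backward (R : realType) (X : completeNormedModType R[i]) (p M : R) (T : R -> X -> X)
    (f : {poly R[i]}) :
  1 <= p -> C0_semigroup T -> 1 <= M ->
  (forall n (t : 'I_n -> R) (x : 'I_n -> X), (forall k, 0 < t k < 1) ->
    rad_norm p (fun k => T (t k) (x k)) <= M * rad_norm p x) ->
  (lim (R_bound p [set poly_op f (T t) | t in `]0%R, eps[] @[eps --> 0^'+])
    < (disk_norm f)%:E)%E -> R_analytic p T.
Proof.
move=> p1 hT M1 hM /lim_R_bound_lt[eps [rho [e0 rho0 rf hf]]].
have [C' C'0 hC'] := R_lipschitz p1 hT M1 hM e0 rho0 rf hf.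
pose C := 1 + C'; have C1 : 1 <= C by rewrite lerDl.
have hC n (t : 'I_n -> R) (x : 'I_n -> X) u : (forall k, 0 < t k <= 1) -> 0 <= u <= 1 ->
    rad_norm p (fun k => T ((1 + u) * t k) (x k) - T (t k) (x k)) <= C * u * rad_norm p x.
  move=> ht hu; apply: le_trans (hC' n t x u ht hu) _; have /andP[u0 _] := hu.
  rewrite ler_wpM2r ?(sn_ge0 (rad_norm_seminorm p1 n))// ler_wpM2r//.
  by rewrite lerDr.
have a0 : 0 < aperture C by rewrite invr_gt0 mulr_gt0// (growth_gt0 C1).
have [delta d0 hd] := sector_cone a0.
exists delta; split=> //; exists (extension T); split.
- exact: extension_real.
- by move=> z /hd; exact: (extension_bounded_operator p1 hT M1 hM C1 hC).
- exact: (extension_holomorphic p1 hT M1 hM C1 hC).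
apply: le_lt_trans (ltry (2 * (M ^+ 2 * expR 1))).
apply: R_bound_le; first by rewrite mulr_ge0// mulr_ge0 ?exprn_ge0 ?expR_ge0 ?(le_trans _ M1).
apply/(R_bounded_byP p1) => n S x hS.
have := @extension_R_bounded _ _ _ _ p1 hT _ _ M1 hM C1 hC.
move=> /(R_bounded_byP p1); apply => k.
by have [z [/hd cz z1] <-] := hS k; exists z.
Qed.

Theorem corollary5p5 (R : realType) (X : completeNormedModType R[i]) (p : R)
    (T : R -> X -> X) :
  1 <= p -> C0_semigroup T ->
  (R_bound p [set T t | t in `]0%R, 1%R[] < +oo)%E ->
  (R_analytic p T <->
   exists f : {poly R[i]},
     (lim (R_bound p [set poly_op f (T t) | t in `]0%R, eps[]
             @[eps --> 0^'+]) < (disk_norm f)%:E)%E).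
Proof.
move=> p1 hT /R_bound_lt[M [M0 _ /(R_bounded_byP p1) hM]].
split=> [|[f]]; first exact: forward.
apply: (backward p1 hT (M := 1 + M)); first by rewrite lerDl.
move=> n t x ht; apply: (@le_trans _ _ (M * rad_norm p x)).
  by apply: (hM n (fun k => T (t k))) => k; exists (t k) => //; rewrite /= in_itv /= ht.
by rewrite ler_wpM2r ?(sn_ge0 (rad_norm_seminorm p1 n))// lerDr.
Qed.
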